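(* Let $\{u_1,\dots,u_m\}$ and $\{\phi_1,\dots,\phi_d\}$ be two sets of real-valued $C^1$ functions in $H^2(\mathbb{R}^n)$ which satisfy, for some $C,\alpha>0$, $$|\partial_{x_k}u_j(x)|\le Ce^{-\alpha|x|}\quad\forall x\in\mathbb{R}^n,\ \forall j\in\{1,\dots,m\},\ \forall k\in\{1,\dots,n\},$$ $$|\phi_i(x)|\le Ce^{-\alpha|x|}\quad\forall x\in\mathbb{R}^n,\ \forall i\in\{1,\dots,d\},$$ and also satisfy $$\langle\partial_{x_i}u_j,\partial_{x_k}u_j\rangle=0\quad\forall j\in\{1,\dots,m\},\ \forall i,k\in\{1,\dots,n\}\text{ with }i\ne k,$$ $$\langle\phi_r,\phi_q\rangle=0\quad\forall r,q\in\{1,\dots,d\}\text{ with }r\ne q.$$ Let $\psi\in H^2(\mathbb{R}^n)$ be given. Then there exist constants $L,\varepsilon>0$ and unique $C^1$ functions $\mathcal{S}$ and $\mathcal{A}$ defined on the set of all $y=[y_1,\dots,y_m]^\top\in\mathbb{R}^{nm}$ and all $u\in H^1(\mathbb{R}^n)$ which satisfy the conditions $$|y_j-y_k|>L\ \ \forall j,k\in\{1,\dots,m\}\text{ with }j\ne k,\qquad\Big\|u-\psi-\sum_{j=1}^mT_{y_j}u_j\Big\|_{L^2}<\varepsilon,\qquad|y_j|>L\ \ \forall j\in\{1,\dots,m\},$$ such that, using $s=\mathcal{S}(u,y)=[s_1,\dots,s_m]^\top\in\mathbb{R}^{nm}$ and $a=\mathcal{A}(u,y)=[a_1,\dots,a_d]^\top\in\mathbb{R}^d$,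 $u$ can be decomposed as $$u=\psi+\sum_{j=1}^mT_{y_j+s_j}u_j+v+\sum_{i=1}^da_i\phi_i,$$ where $v$ satisfies $$\langle v,T_{y_j+s_j}\partial_{x_k}u_j\rangle=0\quad\forall k\in\{1,\dots,n\},\ \forall j\in\{1,\dots,m\},\qquad\langle v,\phi_i\rangle=0\quad\forall i\in\{1,\dots,d\}.$$ In addition, if $A(y)=\inf\{|y_j|,|y_j-y_k|: j,k\in\{1,\dots,m\},\ j\ne k\}$ and $B(u,y)=\|u-\psi-\sum_{j=1}^mT_{y_j}u_j\|_{L^2}$, then $$\lim_{A(y)\to\infty,\ B(u,y)\to0}\mathcal{S}(u,y)=0,\qquad\lim_{A(y)\to\infty,\ B(u,y)\to0}\mathcal{A}(u,y)=0.$$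
   Context: $T_yu(x)=u(x-y)$ for $y\in\mathbb{R}^n$; $y_j,s_j\in\mathbb{R}^n$. $\langle\cdot,\cdot\rangle$ is the real $L^2(\mathbb{R}^n)$ scalar product.
   Formalization: Uniqueness of S and A is claimed only among C^1 pairs that also satisfy the two limits, and only for components s_j with u_j not identically 0 and a_i with phi_i not identically 0; uniqueness from the decomposition alone is false. *)

(* Defs.v *)
From HB Require Import structures.
From mathcomp Require Import all_boot all_order all_algebra.
From mathcomp Require Import all_classical all_reals all_analysis.

Set Implicit Arguments.
Unset Strict Implicit.
Unset Printing Implicit Defensive.

Import Order.TTheory GRing.Theory Num.Theory.
Import numFieldNormedType.Exports.

Local Open Scope classical_set_scope.
Local Open Scope ring_scope.

Definition measure_rV_display : measure_display -> measure_display.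
Proof. exact. Qed.

Definition rV_coord (T : Type) (n : nat) (i : 'I_n) (x : 'rV[T]_n) : T :=
  x ord0 i.

(* The product sigma-algebra on row vectors, as the library has it on
   n.-tuple; on 'rV[R]_n it is the Borel sigma-algebra. *)
Section measurable_rV.
Context {d : measure_display} {T : sigmaRingType d}.
Variable n : nat.

Let coord_set0 : g_sigma_preimage (@rV_coord T n) set0.
Proof. exact: sigma_algebra0. Qed.

Let coord_setC A : g_sigma_preimage (@rV_coord T n) A ->
  g_sigma_preimage (@rV_coord T n) (~` A).
Proof. exact: sigma_algebraC. Qed.

Let coord_bigcup (F : _^nat) : (forall i, g_sigma_preimage (@rV_coord T n) (F i)) ->
  g_sigma_preimage (@rV_coord T n) (\bigcup_i (F i)).
Proof. exact: sigma_algebra_bigcup. Qed.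

HB.instance Definition _ := @isMeasurable.Build (measure_rV_display d)
  'rV[T]_n (g_sigma_preimage (@rV_coord T n))
  coord_set0 coord_setC coord_bigcup.

End measurable_rV.

Section lebesgue_rV.
Context {R : realType}.

Lemma measurable_rV_coord n (i : 'I_n) :
  measurable_fun [set: 'rV[R]_n] (rV_coord i).
Proof.
move=> _ Y mY; rewrite setTI; apply: sub_sigma_algebra => /=.
rewrite -bigcup_seq/=; exists i => /=; first by rewrite mem_index_enum.
by exists Y => //; rewrite setTI.
Qed.

Lemma measurable_fun_rV d (T : measurableType d) n (f : T -> 'rV[R]_n) :
  (forall i, measurable_fun [set: T] (fun t => f t ord0 i)) ->
  measurable_fun [set: T] f.
Proof.
move=> mf.
have gen : g_sigma_preimage (fun i => rV_coord i \o f) `<=` measurable.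
  apply: smallest_sub; first exact: sigma_algebra_measurable.
  rewrite -bigcup_seq; apply: bigcup_sub => i _.
  by move=> A [B mB <-]; exact: mf.
move=> _ A mA; rewrite setTI; apply: gen.
by rewrite g_sigma_preimage_comp; exists A => //; rewrite setTI.
Qed.

Definition rV_cons n (p : R * 'rV[R]_n) : 'rV[R]_n.+1 :=
  \row_(i < n.+1) oapp (p.2 ord0) p.1 (unlift ord0 i).

Definition rV_uncons n (x : 'rV[R]_n.+1) : R * 'rV[R]_n :=
  (x ord0 ord0, \row_(i < n) x ord0 (lift ord0 i)).

Lemma rV_consK n : cancel (@rV_cons n) (@rV_uncons n).
Proof.
case=> a v; rewrite /rV_uncons /rV_cons mxE unlift_none; congr pair.
by apply/rowP => i; rewrite !mxE liftK.
Qed.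

Lemma rV_unconsK n : cancel (@rV_uncons n) (@rV_cons n).
Proof.
move=> x; apply/rowP => i; rewrite /rV_uncons /rV_cons mxE.
by case: (unliftP ord0 i) => [j|] ->; rewrite ?liftK ?unlift_none /= ?mxE.
Qed.

Lemma measurable_rV_cons n : measurable_fun [set: measurableTypeR R * 'rV[R]_n] (@rV_cons n).
Proof.
apply: measurable_fun_rV => i; case: (unliftP ord0 i) => [j|] ->.
  have -> : (fun p : measurableTypeR R * 'rV[R]_n => rV_cons p ord0 (lift ord0 j)) =
      rV_coord j \o snd.
    by apply/funext => p; rewrite /rV_cons mxE liftK.
  apply: measurableT_comp; first exact: measurable_rV_coord.
  exact: measurable_snd.
have -> : (fun p : measurableTypeR R * 'rV[R]_n => rV_cons p ord0 ord0) = fst.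
  by apply/funext => p; rewrite /rV_cons mxE unlift_none.
exact: measurable_fst.
Qed.

Lemma measurable_rV_uncons n :
  measurable_fun [set: 'rV[R]_n.+1]
    (@rV_uncons n : _ -> measurableTypeR R * 'rV[R]_n).
Proof.
apply: measurable_fun_pair => /=; first exact: measurable_rV_coord.
apply: measurable_fun_rV => i.
have -> : (fun x : 'rV[R]_n.+1 => (\row_(i < n) x ord0 (lift ord0 i)) ord0 i) =
    rV_coord (lift ord0 i).
  by apply/funext => x; rewrite mxE.
exact: measurable_rV_coord.
Qed.

Section cons_measure.
Variables (n : nat) (mu : {sigma_finite_measure set 'rV[R]_n -> \bar R}).

Definition cons_measure : set 'rV[R]_n.+1 -> \bar R :=
  pushforward (@lebesgue_measure R \x mu)%E (@rV_cons n).

Let cons_measure0 : cons_measure set0 = 0%E.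
Proof. by rewrite /cons_measure /pushforward preimage_set0 measure0. Qed.

Let cons_measure_ge0 A : (0 <= cons_measure A)%E.
Proof. exact: (measure_ge0 (lebesgue_measure \x mu)%E). Qed.

Let cons_measure_sigma_additive : semi_sigma_additive cons_measure.
Proof.
move=> F mF tF mUF; rewrite /cons_measure /pushforward preimage_bigcup.
have mpre A : measurable A -> measurable (@rV_cons n @^-1` A).
  by move=> mA; rewrite -[X in measurable X]setTI; exact: measurable_rV_cons.
apply: measure_semi_sigma_additive => [k||]; first exact: mpre.
- apply/trivIsetP => /= i j _ _ ij; rewrite -preimage_setI.
  by move/trivIsetP : tF => /(_ _ _ _ _ ij) ->//; rewrite preimage_set0.
- by rewrite -preimage_bigcup; exact: mpre.
Qed.

HB.instance Definition _ := isMeasure.Build _ _ _ cons_measure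
  cons_measure0 cons_measure_ge0 cons_measure_sigma_additive.

Let cons_measure_sigma_finite : sigma_finite setT cons_measure.
Proof.
have /sigma_finiteP[F [FT ndF Foo]] := sigma_finiteT (@lebesgue_measure R).
have /sigma_finiteP[G [GT ndG Goo]] := sigma_finiteT mu.
exists (fun k => @rV_uncons n @^-1` (F k `*` G k)).
  rewrite -preimage_bigcup; apply/esym/seteqP; split=> // x _ /=.
  have [k _ Fk] : (\bigcup_k F k) (rV_uncons x).1 by rewrite -FT.
  have [l _ Gl] : (\bigcup_k G k) (rV_uncons x).2 by rewrite -GT.
  exists (maxn k l) => //; split.
    by move: Fk; exact/subsetPset/ndF/leq_maxl.
  by move: Gl; exact/subsetPset/ndG/leq_maxr.
move=> k; have [mF Fk] := Foo k; have [mG Gk] := Goo k.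
split.
  rewrite -[X in measurable X]setTI; apply: measurable_rV_uncons => //.
  exact: measurableX.
rewrite /cons_measure /pushforward -comp_preimage.
rewrite (_ : _ \o _ = id) ?preimage_id; last first.
  by apply/funext => p /=; rewrite rV_consK.
by rewrite product_measure1E// lte_mul_pinfty// ge0_fin_numE.
Qed.

HB.instance Definition _ :=
  Measure_isSigmaFinite.Build _ _ _ cons_measure cons_measure_sigma_finite.

End cons_measure.

Fixpoint lebesgue_rV n : {sigma_finite_measure set 'rV[R]_n -> \bar R} :=
  match n with
  | 0 => \d_(0 : 'rV[R]_0)
  | n.+1 => cons_measure (lebesgue_rV n)
  end.

(* Sanity check: the measure of a box is the product of the measures of its
   sides. *)
Lemma lebesgue_rV_box n (I : 'I_n -> set R) :
  (forall i, measurable (I i)) ->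
  lebesgue_rV n [set x | forall i, I i (x ord0 i)] =
  (\prod_(i < n) lebesgue_measure (I i))%E.
Proof.
elim: n I => [|n IHn] I mI.
  by rewrite big_ord0 /= diracE mem_set// => -[].
have mbox k (J : 'I_k -> set R) : (forall i, measurable (J i)) ->
    measurable [set x : 'rV[R]_k | forall i, J i (x ord0 i)].
  move=> mJ; have -> : [set x : 'rV[R]_k | forall i, J i (x ord0 i)] =
      \bigcap_(i in [set: 'I_k]) (rV_coord i @^-1` J i).
    apply/seteqP; split=> x /= Jx; first by move=> i _; exact: (Jx i).
    by move=> i; apply: (Jx i).
  apply: fin_bigcap_measurable => // i _.
  by rewrite -[X in measurable X]setTI; exact: measurable_rV_coord.
have mI' i : measurable (I (lift ord0 i)) by exact: mI.
have mB := mbox n (fun i => I (lift ord0 i)) mI'.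
rewrite big_ord_recl -(IHn (fun i => I (lift ord0 i)) mI').
apply: etrans (product_measure1E lebesgue_measure _ (mI ord0) mB).
rewrite /= /cons_measure /pushforward; congr (_ _).
apply/seteqP; split=> [[a v]|[a v]] /=.
  move=> h; split=> [|i]; first by have := h ord0; rewrite mxE unlift_none.
  by have := h (lift ord0 i); rewrite mxE liftK.
move=> [h0 h] i; rewrite mxE.
by case: (unliftP ord0 i) => [j|] ->; rewrite ?liftK ?unlift_none //=; exact: h.
Qed.

End lebesgue_rV.

Section sobolev.
Context {R : realType} {n : nat}.
Local Notation V := 'rV[R]_n.
Local Notation mu := (@lebesgue_rV R n).

(* The library norm on 'rV[R]_n is the sup norm. *)
Definition enorm (x : V) : R := Num.sqrt (\sum_(i < n) x ord0 i ^+ 2).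

Definition translate (y : V) (f : V -> R) : V -> R := fun x => f (x - y).

Definition pderiv (k : 'I_n) (f : V -> R) : V -> R :=
  fun x => 'D_(delta_mx ord0 k : V) f x.

Fixpoint continuously_differentiable (p : nat) (f : V -> R) : Prop :=
  continuous f /\
  match p with
  | 0 => True
  | p.+1 => forall k : 'I_n,
      (forall x, derivable f x (delta_mx ord0 k : V)) /\
      continuously_differentiable p (pderiv k f)
  end.

Definition test_function (f : V -> R) : Prop :=
  (forall p, continuously_differentiable p f) /\
  compact (closure [set x | f x != 0]).

Definition L2 : set (V -> R) := [set f | f \in Lfun mu 2%:E].

Definition L2norm (f : V -> R) : R := fine ('N[mu]_2%:E [EFin \o f])%E.

Definition L2dot (f g : V -> R) : R := \int[mu]_x (f x * g x).

Definition weak_pderiv (k : 'I_n) (f g : V -> R) : Prop :=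
  forall phi, test_function phi -> L2dot f (pderiv k phi) = - L2dot g phi.

(* H^p, p a natural number; its elements are Borel representatives of the
   a.e.-equality classes. *)
Fixpoint sobolev (p : nat) : set (V -> R) :=
  [set f | L2 f /\
    match p with
    | 0 => True
    | p.+1 => forall k : 'I_n, exists2 g, sobolev p g & weak_pderiv k f g
    end].

(* A representative of the weak derivative, unique up to a.e. equality. *)
Definition wpderiv (k : 'I_n) (f : V -> R) : V -> R :=
  xget 0 [set g | L2 g /\ weak_pderiv k f g].

Definition H1norm (f : V -> R) : R :=
  Num.sqrt (L2norm f ^+ 2 + \sum_(k < n) L2norm (wpderiv k f) ^+ 2).

End sobolev.

(* F(u, y) is of class C^1, in the sense of Frechet, on the subset D of
   H^1 x R^(n m).  D is meant to be open and to contain only u in H^1.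
   Functions are not quotiented by a.e. equality, H1norm being a seminorm on
   them; continuity in H1norm makes F, on D, and its derivative invariant under
   a.e. equality. *)
Definition C1_on (R : realType) (n m : nat) (W : normedModType R)
    (D : ('rV[R]_n -> R) -> 'M[R]_(m, n) -> Prop)
    (F : ('rV[R]_n -> R) -> 'M[R]_(m, n) -> W) : Prop :=
  exists dF : ('rV[R]_n -> R) -> 'M[R]_(m, n) ->
              ('rV[R]_n -> R) -> 'M[R]_(m, n) -> W,
  forall u y, D u y ->
  [/\ forall (c : R) h1 h2 z1 z2, sobolev 1 h1 -> sobolev 1 h2 ->
        dF u y (c *: h1 + h2) (c *: z1 + z2) = c *: dF u y h1 z1 + dF u y h2 z2,
      exists K : R, forall h z, sobolev 1 h ->
        `|dF u y h z| <= K * (H1norm h + `|z|),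
      forall e : R, 0 < e -> exists2 r : R, 0 < r &
        forall h z, sobolev 1 h -> D (u + h) (y + z) -> H1norm h + `|z| < r ->
        `|F (u + h) (y + z) - F u y - dF u y h z| <= e * (H1norm h + `|z|) &
      forall e : R, 0 < e -> exists2 r : R, 0 < r &
        forall u' y', D u' y' -> H1norm (u' - u) + `|y' - y| < r ->
        forall h z, sobolev 1 h ->
        `|dF u' y' h z - dF u y h z| <= e * (H1norm h + `|z|)].

Section modulation.
Context {R : realType} {n m d : nat}.
Local Notation V := 'rV[R]_n.
Local Notation mu := (@lebesgue_rV R n).
Variables (psi : V -> R) (u_ : 'I_m -> V -> R) (phi_ : 'I_d -> V -> R).

(* The rows of y : 'M[R]_(m, n) are y_1, ..., y_m. *)
Definition multisoliton (y : 'M[R]_(m, n)) : V -> R :=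
  psi + \sum_(j < m) translate (row j y) (u_ j).

Definition defect (u : V -> R) (y : 'M[R]_(m, n)) : R :=
  L2norm (u - multisoliton y).

(* The infimum is +oo when m = 0. *)
Definition separation (y : 'M[R]_(m, n)) : \bar R :=
  ereal_inf ([set (enorm (row j y))%:E | j in [set: 'I_m]] `|`
             [set (enorm (row jk.1 y - row jk.2 y))%:E |
               jk in [set jk : 'I_m * 'I_m | jk.1 != jk.2]]).

Definition near_multisoliton (L eps : R) (u : V -> R) (y : 'M[R]_(m, n)) : Prop :=
  [/\ sobolev 1 u,
      forall j k : 'I_m, j != k -> L < enorm (row j y - row k y),
      defect u y < eps &
      forall j : 'I_m, L < enorm (row j y)].

Definition decomposes (u : V -> R) (y s : 'M[R]_(m, n)) (a : 'rV[R]_d) : Prop :=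
  exists v : V -> R,
  [/\ sobolev 1 v,
      ae_eq mu setT u
        (multisoliton (y + s) + v + \sum_(i < d) a ord0 i *: phi_ i),
      forall (k : 'I_n) (j : 'I_m),
        L2dot v (translate (row j (y + s)) (pderiv k (u_ j))) = 0 &
      forall i : 'I_d, L2dot v (phi_ i) = 0].

Definition tends_to0 (W : normedModType R) (L eps : R)
    (F : (V -> R) -> 'M[R]_(m, n) -> W) : Prop :=
  forall e : R, 0 < e -> exists M eta : R,
  [/\ 0 < M, 0 < eta &
      forall u y, near_multisoliton L eps u y ->
      (M%:E < separation y)%E -> defect u y < eta -> `|F u y| < e].

(* The limits belong to the properties among which uniqueness is asserted:
   C1_on and decomposes alone do not determine S, since other nondegenerate
   critical points of s |-> <u_j, T_s u_j>, away from s = 0, may yield other C^1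
   solutions. *)
Definition modulation (L eps : R)
    (S : (V -> R) -> 'M[R]_(m, n) -> 'M[R]_(m, n))
    (A : (V -> R) -> 'M[R]_(m, n) -> 'rV[R]_d) : Prop :=
  [/\ C1_on (near_multisoliton L eps) S /\ C1_on (near_multisoliton L eps) A,
      forall u y, near_multisoliton L eps u y -> decomposes u y (S u y) (A u y),
      tends_to0 L eps S &
      tends_to0 L eps A].

End modulation.

(* Main.v *)
(* For p = (z, a), the orthogonality conditions say that p = (y + s, a) is a
   critical point of the squared distance from u to the manifold
   Q(p) = psi + sum_j T_{z_j} u_j + sum_i a_i phi_i.  Distant translates of
   square-integrable functions are almost orthogonal (approximate them by test
   functions), so for well separated z the Gram matrix of the tangent vectors of
   Q is nearly diagonal; as the u_j are in H^2, the critical point equations are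
   C^1 in p.  A contraction argument with constants independent of u and y
   solves them for p near (y, 0), with a bound on |p - (y, 0)| proportional to
   the defect |u - Q(y, 0)|; this gives S, A, their smoothness and their limits.

   The solution is only locally unique.  Another solution (S', A') is compared
   with (S, A) along the path t |-> (Q(t y, 0) + (u - Q(y, 0)) / t, t y), t >= 1:
   the difference is continuous in t, tends to 0 as t grows, and vanishes as soon
   as it is smaller than a fixed constant, so that it is 0 at t = 1. *)

Require Import Defs.
From HB Require Import structures.
From mathcomp Require Import all_boot all_order all_algebra.
From mathcomp Require Import all_classical all_reals all_analysis.
From mathcomp Require Import measurable_realfun ring lra.

Set Implicit Arguments.
Unset Strict Implicit.
Unset Printing Implicit Defensive.

Import Order.TTheory GRing.Theory Num.Theory.
Import numFieldNormedType.Exports.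

Local Open Scope classical_set_scope.
Local Open Scope ring_scope.

(** * Translation invariance of the Lebesgue measure *)

(** The function [u] is never translated: it enters the critical point equations affinely, so they
    are smooth in [u] already for the L2 norm, and differentiating in [p] consumes only the
    regularity of the [u_j]. The constants are uniform because translations are isometries of L2:
    the norms of the tangent vectors and of their derivatives do not depend on [p], and [Q] is
    globally Lipschitz.

    The obstacle is degeneracy. A [u_j] or a [phi_i] may vanish; its parameter is then invisible to
    [Q], and the Gram matrix has a zero on its diagonal. The corresponding equation is replaced by
    one that keeps the parameter at its initial value, and uniqueness is claimed for the other
    parameters only. This splitting is consistent because a square-integrable function with one null
    weak partial derivative is itself null: a [u_j] either is null or has all its derivatives
    nondegenerate.

    Elements of L2 are functions, not classes, so the identities in degenerate directions are stated
    as the vanishing of a seminorm. *)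

Section matrix_norm.
Context {R : realType} {m n : nat}.
Implicit Types x : 'M[R]_(m, n).

Lemma coord_le_norm x i j : `|x i j| <= `|x|.
Proof.
rewrite [leRHS]/Num.Def.normr /= mx_normrE; apply/bigmax_geP; right => /=.
by exists (i, j).
Qed.

Lemma mx_norm_le x e : 0 <= e -> (forall i j, `|x i j| <= e) -> `|x| <= e.
Proof.
move=> e0 xe; rewrite [leLHS]/Num.Def.normr /= mx_normrE.
by apply/bigmax_leP; split => // -[i j] _ /=; exact: xe.
Qed.

End matrix_norm.

Section translation.
Context {R : realType}.

Lemma lebesgue_measure_translate (a : R) (A : set R) : measurable A ->
  lebesgue_measure ((fun x => x - a) @^-1` A) = lebesgue_measure A.
Proof.
move=> mA; rewrite -[LHS]/(pushforward lebesgue_measure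
  ((fun x => x - a) : measurableTypeR R -> measurableTypeR R) A).
apply/esym/lebesgue_measure_unique => //=; last first.
  move=> _ _ [[b c] _ <-]; rewrite /pushforward.
  rewrite (_ : _ @^-1` _ = `](b + a), (c + a)]%classic); last first.
    by apply/seteqP; split=> x /=; rewrite !in_itv/= ltrBrDr lerBlDr.
  rewrite !lebesgue_measure_itv /= !lte_fin ltrD2r; case: ifP => // _.
  by rewrite -!EFinD; congr EFin; ring.
apply: (@measurable_funB _ (measurableTypeR R) R setT idfun (cst a)).
  exact: measurable_id.
exact: measurable_cst.
Qed.

Variable n : nat.
Local Notation V := 'rV[R]_n.
Local Notation mu := (@lebesgue_rV R n).

Definition box (I : 'I_n -> set R) : set V := [set x | forall i, I i (x ord0 i)].

Definition boxes : set_system V :=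
  [set A | exists2 I : 'I_n -> set R, (forall i, measurable (I i)) & A = box I].

Lemma measurable_box I : (forall i, measurable (I i)) -> measurable (box I).
Proof.
move=> mI; rewrite (_ : box I = \bigcap_(i in [set: 'I_n]) (rV_coord i @^-1` I i)).
  apply: fin_bigcap_measurable => // i _.
  by rewrite -[X in measurable X]setTI; exact: measurable_rV_coord.
by apply/seteqP; split=> x /= Ix; [move=> i _|move=> i]; apply: Ix.
Qed.

Lemma lebesgue_box I : (forall i, measurable (I i)) ->
  mu (box I) = (\prod_(i < n) lebesgue_measure (I i))%E.
Proof. exact: lebesgue_rV_box. Qed.

Lemma boxI I J : box I `&` box J = box (fun i => I i `&` J i).
Proof.
apply/seteqP; split=> x /=; first by case=> Ix Jx i; split; [exact: Ix|exact: Jx].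
by move=> IJ; split=> i; have [] := IJ i.
Qed.

Lemma measurable_rVE (G : set_system V) : G `<=` measurable ->
  (forall (i : 'I_n) (A : set R), measurable A -> <<s G >> (rV_coord i @^-1` A)) ->
  measurable = <<s G >>.
Proof.
move=> Gm Gc; apply/seteqP; split.
  apply: smallest_sub; first exact: smallest_sigma_algebra.
  rewrite -bigcup_seq; apply: bigcup_sub => i _ _ [B mB <-].
  by rewrite setTI; exact: Gc.
by apply: smallest_sub => //; exact: sigma_algebra_measurable.
Qed.

Lemma measurable_boxesE : measurable = <<s boxes >>.
Proof.
apply: measurable_rVE => [_ [I mI ->]|i A mA]; first exact: measurable_box.
apply: sub_sigma_algebra; exists (fun j => if j == i then A else setT).
  by move=> j; case: ifP.
apply/seteqP; split=> x /=; rewrite /rV_coord.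
  by move=> Ax j; case: eqP => [->|].
by move=> /(_ i); rewrite eqxx.
Qed.

Lemma measurable_translate (y : V) : measurable_fun setT (fun x : V => x - y).
Proof.
apply: measurable_fun_rV => i; under eq_fun do rewrite !mxE.
apply: measurable_funB => //; exact: measurable_rV_coord.
Qed.

(** Boxes form a pi-system generating the Borel sets, cubes of finite measure exhaust the space, and
    a translated box is a box with translated sides; uniqueness of measures does the rest. *)
Lemma lebesgue_rV_translate (y : V) (A : set V) : measurable A ->
  mu ((fun x => x - y) @^-1` A) = mu A.
Proof.
move=> mA; pose g (k : nat) := box (fun=> `[- k%:R, k%:R]%classic).
have finbox k : (mu (g k) < +oo)%E.
  rewrite /g lebesgue_box => [|i]; last exact: measurable_itv.
  rewrite -ge0_fin_numE; last by apply: prode_ge0 => i _; exact: measure_ge0.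
  by apply: prode_fin_num => i _; rewrite lebesgue_measure_itv/=; case: ifP.
have mt := measurable_translate y.
rewrite -[LHS]/(pushforward mu (fun x => x - y) A).
apply: esym; apply: (measure_unique boxes g measurable_boxesE) => //.
- by move=> _ _ [I mI ->] [J mJ ->]; rewrite boxI; eexists; last reflexivity;
     move=> i; exact: measurableI.
- by move=> k; eexists; last reflexivity.
- apply/seteqP; split=> // x _; exists (Num.bound `|x|) => // i /=.
  rewrite in_itv/= -ler_norml; apply: le_trans (ltW (archi_boundP _)) => //.
  exact: coord_le_norm.
- move=> _ [I mI ->].
  transitivity (mu (box (fun i => (fun t => t - y ord0 i) @^-1` I i))).
    apply: etrans (lebesgue_box mI) _; apply: esym; apply: etrans (lebesgue_box _) _.
      by move=> i; rewrite -[X in measurable X]setTI; exact: measurable_funB.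
    by apply: eq_bigr => i _; rewrite lebesgue_measure_translate.
  rewrite /= /pushforward; congr (mu _).
  by apply/seteqP; split=> x /= Ix i; have := Ix i; rewrite !mxE.
Qed.

Lemma ge0_integral_translate (y : V) (f : V -> \bar R) :
  measurable_fun setT f -> (forall x, 0 <= f x)%E ->
  (\int[mu]_x f (x - y)%R = \int[mu]_x f x)%E.
Proof.
move=> mf f0; have mt := measurable_translate y.
transitivity (\int[pushforward mu (fun x : V => (x - y)%R)]_x f x)%E.
  by rewrite (ge0_integral_pushforward mt).
by apply: eq_measure_integral => A mA _; exact: lebesgue_rV_translate.
Qed.

Lemma integral_translate (y : V) (f : V -> \bar R) :
  mu.-integrable setT f ->
  mu.-integrable setT (fun x => f (x - y)) /\
  (\int[mu]_x f (x - y)%R = \int[mu]_x f x)%E.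
Proof.
move=> /integrableP[mf fi]; have mt := measurable_translate y.
have fti : mu.-integrable setT (fun x => f (x - y)).
  apply/integrableP; split; first exact: measurableT_comp.
  rewrite (ge0_integral_translate y (f := abse \o f))//; last by move=> x; exact: abse_ge0.
  exact: measurableT_comp.
split => //.
transitivity (\int[pushforward mu (fun x : V => (x - y)%R)]_x f x)%E.
  by rewrite (integral_pushforward mt).
by apply: eq_measure_integral => A mA _; exact: lebesgue_rV_translate.
Qed.

End translation.

(** * The semi-inner product on L2 *)

Section L2_hilbert.
Context d (T : measurableType d) (R : realType).
Variable mu : {measure set T -> \bar R}.

Local Notation H := (LfunType mu (@lee1n R 2)).
Implicit Types f g h : H.

Definition dot f g : R := \int[mu]_x ((f : T -> R) x * (g : T -> R) x).
Definition nrm f : R := fine ('N[mu]_2%:E [EFin \o f])%E.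

Lemma measurable_L2 f : measurable_fun setT (f : T -> R).
Proof. by have /andP[/[1!inE]] := LfunP f. Qed.

Lemma integral_sqrE (f : T -> R) :
  (\int[mu]_x (`|(EFin \o f) x| `^ 2) = \int[mu]_x (f x ^+ 2)%:E)%E.
Proof.
by apply: eq_integral => x _; rewrite /= powR_mulrn// real_normK ?num_real.
Qed.

Lemma le_L2 (f g : T -> R) : measurable_fun setT f ->
  g \in Lfun mu 2%:E -> (forall x, `|f x| <= `|g x|) -> f \in Lfun mu 2%:E.
Proof.
move=> mf /andP[/[!inE]/= mg ng] fg; apply/andP; rewrite !inE/=; split=> //.
apply: le_lt_trans ng; rewrite unlock /Lnorm gt0_ler_poweR ?invr_ge0//.
- by rewrite in_itv/= leey integral_ge0.
- by rewrite in_itv/= leey integral_ge0.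
rewrite !integral_sqrE; apply: ge0_le_integral => //.
- by move=> x _; rewrite lee_fin sqr_ge0.
- exact/measurable_EFinP/measurable_funX.
- exact/measurable_EFinP/measurable_funX.
- by move=> x _; rewrite lee_fin -[leLHS]real_normK ?num_real// -[leRHS]real_normK
    ?num_real// lerXn2r ?nnegrE.
Qed.

Lemma indic_L2 (A : set T) : measurable A -> (mu A < +oo)%E ->
  \1_A \in Lfun mu 2%:E.
Proof.
move=> mA Aoo; apply/andP; rewrite !inE/=; split; first exact: measurable_indic.
rewrite /finite_norm unlock poweR_lty//.
rewrite integral_sqrE (eq_integral (fun x => (\1_A x)%:E)); last first.
  by move=> x _; rewrite indicE; case: (x \in A); rewrite ?expr1n ?expr0n.
by rewrite integral_indic// setIT.
Qed.

Lemma integrable_dot f g :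
  mu.-integrable setT (EFin \o (fun x => (f : T -> R) x * (g : T -> R) x)).
Proof. by apply/Lfun1_integrable; exact: (Lfun2_mul_Lfun1 (LfunP f) (LfunP g)). Qed.

Lemma dotC f g : dot f g = dot g f.
Proof. by apply: eq_Rintegral => x _; rewrite mulrC. Qed.

Lemma dotDl f g h : dot (f + g) h = dot f h + dot g h.
Proof.
rewrite /dot -RintegralD//; [|exact: integrable_dot..].
by apply: eq_Rintegral => x _; rewrite -mulrDl.
Qed.

Lemma dotZl a f g : dot (a *: f) g = a * dot f g.
Proof.
rewrite /dot -RintegralZl//; [|exact: integrable_dot..].
by apply: eq_Rintegral => x _; rewrite mulrA.
Qed.

Lemma dotDr f g h : dot f (g + h) = dot f g + dot f h.
Proof. by rewrite dotC dotDl !(dotC f). Qed.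

Lemma dotZr a f g : dot f (a *: g) = a * dot f g.
Proof. by rewrite dotC dotZl dotC. Qed.

Lemma dotNl f g : dot (- f) g = - dot f g.
Proof. by rewrite -scaleN1r dotZl mulN1r. Qed.

Lemma dotNr f g : dot f (- g) = - dot f g.
Proof. by rewrite dotC dotNl dotC. Qed.

Lemma dotBl f g h : dot (f - g) h = dot f h - dot g h.
Proof. by rewrite dotDl dotNl. Qed.

Lemma dotBr f g h : dot f (g - h) = dot f g - dot f h.
Proof. by rewrite dotDr dotNr. Qed.

Lemma dot0l f : dot 0 f = 0.
Proof. by rewrite -(scale0r 0) dotZl mul0r. Qed.

Lemma dot_suml I (r : seq I) (P : pred I) (F : I -> H) g :
  dot (\sum_(i <- r | P i) F i) g = \sum_(i <- r | P i) dot (F i) g.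
Proof.
by apply: (big_morph (dot^~ g)) => [x y|]; [exact: dotDl|exact: dot0l].
Qed.

Lemma nrm_ge0 f : 0 <= nrm f.
Proof. by rewrite fine_ge0// Lnorm_ge0. Qed.

Lemma nrm_sqr f : nrm f ^+ 2 = dot f f.
Proof.
have := @powR_Lnorm _ T R mu (EFin \o f) 2 (lt0r_neq0 (ltr0n R 2)).
rewrite -[X in (X `^ _)%E](@finite_norm_fine _ _ _ mu _ (@lee1n R 2)) poweR_EFin.
rewrite powR_mulrn ?nrm_ge0// => /(congr1 fine) /= ->.
rewrite /dot /Rintegral; congr fine; apply: eq_integral => x _.
by rewrite powR_mulrn// -normrX ger0_norm ?sqr_ge0.
Qed.

Lemma dot_le f g : `|dot f g| <= nrm f * nrm g.
Proof.
apply: le_trans (le_normr_Rintegral _ (integrable_dot f g)) _ => //.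
rewrite -lee_fin EFinM.
rewrite !(@finite_norm_fine _ _ _ mu _ (@lee1n R 2)).
apply: le_trans (@hoelder _ _ _ mu f g 2 2 _ _ _ _ _) => //; last first.
  by rewrite [RHS]splitr !div1r.
rewrite Lnorm1 /Rintegral fineK//; apply: integrable_fin_num => //.
by have /integrable_abse := integrable_dot f g.
Qed.

Lemma nrmD f g : nrm (f + g) <= nrm f + nrm g.
Proof. exact: ler_LnormD. Qed.

Lemma nrmZ a f : nrm (a *: f) = `|a| * nrm f.
Proof.
apply: EFin_inj; rewrite EFinM !(@finite_norm_fine _ _ _ mu _ (@lee1n R 2)).
exact: LnormZ.
Qed.

Lemma nrmN f : nrm (- f) = nrm f.
Proof. by rewrite -scaleN1r nrmZ normrN1 mul1r. Qed.

Lemma nrmB f g : nrm (f - g) = nrm (g - f).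
Proof. by rewrite -opprB nrmN. Qed.

Lemma nrm0 : nrm 0 = 0.
Proof. by rewrite -(scale0r 0) nrmZ normr0 mul0r. Qed.

Lemma nrm_sum I (r : seq I) (P : pred I) (F : I -> H) :
  nrm (\sum_(i <- r | P i) F i) <= \sum_(i <- r | P i) nrm (F i).
Proof.
elim/big_rec2 : _ => [|i x y _ yx]; first by rewrite nrm0.
by apply: le_trans (nrmD _ _) _; rewrite lerD2l.
Qed.

Lemma dot_ae f f' g : ae_eq mu setT f f' -> dot f g = dot f' g.
Proof.
move=> ff'; rewrite /dot /Rintegral; congr fine; apply: ae_eq_integral => //.
- by have /integrableP[] := integrable_dot f g.
- by have /integrableP[] := integrable_dot f' g.
- by apply: filterS ff' => x /= ->.
Qed.

Lemma nrm0_ae f : nrm f = 0 -> ae_eq mu setT f (cst 0).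
Proof. by move/fine_Lnormr_eq0; apply: filterS => x + _; exact. Qed.

End L2_hilbert.

Section L2_limits.
Context d (T : measurableType d) (R : realType).
Variable mu : {measure set T -> \bar R}.
Local Notation H := (LfunType mu (@lee1n R 2)).

(** Made total by the value [0] off L2, so that plain functions can be used in the semi-inner
    product space; [toL2K] removes it. *)
Definition toL2 (f : T -> R) : H := insubd (0 : H) f.

Lemma toL2K f : f \in Lfun mu 2%:E -> toL2 f = f :> (T -> R).
Proof. by move=> f2; rewrite /toL2 -[LHS]/(val (insubd (0 : H) f)) insubdK. Qed.

Lemma toL2_val (f : H) : toL2 f = f.
Proof. exact: valKd. Qed.

(** Dominated convergence for the squares of [f_ k - f], which are bounded by [4 g^2]. *)
Lemma L2_dominated (f_ : nat -> H) (f g : H) :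
  (forall x, (f_ ^~ x : nat -> R) @ \oo --> (f : T -> R) x) ->
  (forall k x, `|(f_ k : T -> R) x| <= `|(g : T -> R) x|) ->
  nrm (f_ k - f) @[k --> \oo] --> (0 : R).
Proof.
move=> f_f f_g.
have fg x : `|(f : T -> R) x| <= `|(g : T -> R) x|.
  rewrite -(cvg_lim _ (cvg_norm (f_f x)))//; apply: limr_le.
    exact: cvgP (cvg_norm (f_f x)).
  by apply: nearW => k; exact: f_g.
pose D k : H := f_ k - f; have DE k x : (D k : T -> R) x = (f_ k : T -> R) x - (f : T -> R) x by [].
have [] := @dominated_convergence _ T R mu setT measurableT
  (fun k x => ((D k : T -> R) x * (D k : T -> R) x)%:E) (cst 0)
  (fun x => (4 * ((g : T -> R) x * (g : T -> R) x))%:E).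
- by move=> k; have /integrableP[] := integrable_dot (D k) (D k).
- exact: measurable_cst.
- apply: aeW => x _; apply: cvg_EFin; first exact: nearW.
  have D0 : (fun k => (D k : T -> R) x) @ \oo --> (0 : R).
    by have := cvgB (f_f x) (cvg_cst ((f : T -> R) x)); rewrite subrr; exact.
  by have := cvgM D0 D0; rewrite mulr0; exact.
- have /(integrableZl measurableT 4) := integrable_dot g g.
  by apply: eq_integrable => // x _; rewrite /= EFinM.
- apply: aeW => x k _; rewrite -[leLHS]/(`|(D k : T -> R) x * (D k : T -> R) x|%:E) lee_fin.
  rewrite normrM -expr2 -expr2 -[X in 4 * X]real_normK ?num_real//.
  have -> : 4 = 2 ^+ 2 :> R by ring.
  rewrite -exprMn lerXn2r ?nnegrE ?mulr_ge0// DE.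
  apply: le_trans (ler_normB _ _) _; apply: le_trans (lerD (f_g k x) (fg x)) _.
  by move: `|(g : T -> R) x| => c; lra.
move=> _ _; rewrite integral0 => /fine_cvg; rewrite /= => cD.
apply/cvgrPdist_lt => e e0; have e20 : 0 < e ^+ 2 by rewrite exprn_gt0.
have {}cD : dot (D k) (D k) @[k --> \oo] --> (0 : R) := cD.
have := cD; move/cvgrPdist_lt/(_ _ e20); apply: filterS => k.
rewrite !sub0r !normrN -nrm_sqr -/(D k).
rewrite !ger0_norm ?exprn_ge0 ?nrm_ge0// ltr_pXn2r ?nnegrE ?nrm_ge0//.
exact: ltW.
Qed.

End L2_limits.

(** * Test functions and their density in L2 *)

Section smooth_real.
Context {R : realType}.
Implicit Types f g : R -> R.

(** The derivative is a witness, so that sums, products and affine substitutions go by induction. At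
    degree [0] nothing is required, not even continuity; one extra degree supplies it. *)
Fixpoint smooth (p : nat) f : Prop :=
  if p is p.+1 then
    exists2 df : R -> R, forall x, is_derive x (1 : R) f (df x) & smooth p df
  else True.

Lemma smoothW p f : smooth p.+1 f -> smooth p f.
Proof.
elim: p f => // p IH f [df fdf sdf]; exists df => //; exact: IH.
Qed.

Lemma smoothD p f g : smooth p f -> smooth p g -> smooth p (fun x => f x + g x).
Proof.
elim: p f g => // p IH f g [df fdf sf] [dg gdg sg].
by exists (fun x => df x + dg x); [move=> x; exact: is_deriveD|exact: IH].
Qed.

Lemma smoothM p f g : smooth p f -> smooth p g -> smooth p (fun x => f x * g x).
Proof.
elim: p f g => // p IH f g sf sg; have [df fdf sf'] := sf; have [dg gdg sg'] := sg.
exists (fun x => f x * dg x + g x * df x); first by move=> x; exact: is_deriveM.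
by apply: smoothD; apply: IH => //; exact: smoothW.
Qed.

Lemma smooth_cst p c : smooth p (fun=> c).
Proof.
by elim: p c => // p IH c; exists (fun=> 0); [move=> x; exact: is_derive_cst|exact: IH].
Qed.

Lemma is_derive_affine f (a c x l : R) :
  is_derive (a * x + c) (1 : R) f l -> is_derive x (1 : R) (fun x => f (a * x + c)) (l * a).
Proof.
move=> fl; apply: (@is_derive1_comp R f (fun x => a * x + c)).
have := is_deriveD (is_deriveZ a (is_derive_id x (1 : R))) (is_derive_cst c x 1).
by rewrite addr0 /GRing.scale/= mulr1.
Qed.

Lemma smooth_affine p f a c : smooth p f -> smooth p (fun x => f (a * x + c)).
Proof.
elim: p f => // p IH f [df fdf sdf]; exists (fun x => df (a * x + c) * a).
  by move=> x; exact: is_derive_affine.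
by apply: smoothM; [exact: IH|exact: smooth_cst].
Qed.

(** The inequality between [y / n] and [expR (y / n)], raised to the power [n]. *)
Lemma exprn_expR_le n (y : R) : 0 <= y -> y ^+ n * expR (- y) <= n%:R ^+ n.
Proof.
case: n => [|n] y0; first by rewrite !expr0 mul1r -expR0 ler_expR oppr_le0.
rewrite expRN -ler_pdivlMr ?invrK ?invr_gt0 ?expR_gt0//.
have -> : y = n.+1%:R * (y / n.+1%:R) by rewrite mulrC divfK// pnatr_eq0.
rewrite expRM_natl exprMn ler_pM2l ?exprn_gt0 ?ltr0n//.
rewrite lerXn2r ?nnegrE ?divr_ge0 ?expR_ge0//.
by rewrite (le_trans _ (expR_ge1Dx _))// lerDr.
Qed.

(** The factors [x^-k] close the family of [exp(-1/x)] under differentiation, up to linear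
    combinations. *)
Definition flat (k : nat) (x : R) : R := if 0 < x then x ^- k * expR (- x^-1) else 0.

Lemma flat_ge0 k x : 0 <= flat k x.
Proof.
by rewrite /flat; case: ifP => // x0; rewrite mulr_ge0 ?expR_ge0// invr_ge0 exprn_ge0// ltW.
Qed.

Lemma flat_le k x : flat k x <= k.+1%:R ^+ k.+1 * `|x|.
Proof.
rewrite /flat; case: ifPn => [x0|_]; last by rewrite mulr_ge0// exprn_ge0.
rewrite gtr0_norm// -ler_pdivrMr//.
have := @exprn_expR_le k.+1 x^-1; rewrite invr_ge0 (ltW x0) => /(_ isT).
by apply: le_trans; rewrite exprSr exprVn mulrAC.
Qed.

(** Away from [0] this is the product rule. At [0] the difference quotient of [flat k] is
    [flat k.+1], which [flat_le] forces to [0]. *)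
Lemma is_derive_flat k x :
  is_derive x (1 : R) (flat k) (flat k.+2 x - k%:R * flat k.+1 x).
Proof.
have [x0|x0|<-] := ltgtP 0 x.
- pose i (y : R) := y^-1.
  have di : is_derive x (1 : R) i (- i x ^+ 2).
    have := is_deriveV (lt0r_neq0 x0) (is_derive_id x (1 : R)).
    by rewrite /GRing.scale/= mulr1 exprVn.
  apply: (@near_eq_is_derive _ _ _ (i ^+ k * (expR \o (- i)))).
    near=> y; rewrite /flat ifT; last by near: y; exact: lt_nbhsr.
    by rewrite !fctE /i exprVn.
  apply: (is_derive_eq (is_deriveM (is_deriveX k di)
    (is_derive1_comp (is_derive_expR _) (is_deriveN di)))).
  rewrite /flat x0 /GRing.scale/= !fctE -!exprVn -/(i x).
  by case: k => [|k]; rewrite ?exprS; ring.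
- apply: (@near_eq_is_derive _ _ _ (cst 0)).
    near=> y; rewrite /flat ltNge (ltW (_ : y < 0))//.
    by near: y; exact: lt_nbhsl.
  rewrite /flat ltNge (ltW x0)/= mulr0 subr0; exact: is_derive_cst.
- have fl0 j : flat j 0 = 0 by rewrite /flat ltxx.
  rewrite !fl0 mulr0 subr0.
  suff h : (fun h : R => h^-1 *: ((flat k \o shift 0) (h *: 1) - flat k 0)) @ 0^' --> (0 : R).
    by apply: DeriveDef; [apply/cvg_ex; exists 0|exact: cvg_lim h].
  apply/cvgr0Pnorm_le => e e0.
  near=> h.
  have h0 : h != 0 by near: h; exact: nbhs_dnbhs_neq.
  rewrite fl0 subr0 /= addr0 /GRing.scale/= mulr1.
  have -> : h^-1 * flat k h = flat k.+1 h.
    rewrite /flat; case: ifP => _; last by rewrite mulr0.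
    by rewrite mulrA exprS invfM.
  rewrite ger0_norm ?flat_ge0//; apply: le_trans (flat_le _ _) _.
  rewrite mulrC -ler_pdivlMr ?exprn_gt0//.
  near: h; apply: dnbhs0_le; by rewrite divr_gt0// exprn_gt0.
Unshelve. all: by end_near. Qed.

Lemma smooth_flat p k : smooth p (flat k).
Proof.
elim: p k => // p IH k; exists (fun x => flat k.+2 x + - k%:R * flat k.+1 x).
  by move=> x; rewrite mulNr; exact: is_derive_flat.
by apply: smoothD => //; apply: smoothM => //; exact: smooth_cst.
Qed.

End smooth_real.

Section bump.
Context {R : realType}.
Implicit Types a b x : R.

(** On []a, b[] this is [exp(-1/((N+1)(x-a))) exp(-1/((N+1)(b-x)))]: as both flanks steepen, it
    converges pointwise to the indicator. The arguments are in the affine form of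
    [smooth_affine]. *)
Definition bumpR (N : nat) a b x : R :=
  flat 0 (N.+1%:R * x + - (N.+1%:R * a)) * flat 0 (- N.+1%:R * x + N.+1%:R * b).

Lemma smooth_bumpR p N a b : smooth p (bumpR N a b).
Proof. by apply: smoothM; apply: smooth_affine; exact: smooth_flat. Qed.

Lemma flat0_le1 x : flat 0 x <= 1.
Proof.
rewrite /flat; case: ifP => // x0.
by rewrite expr0 invr1 mul1r -expR0 ler_expR oppr_le0 invr_ge0 ltW.
Qed.

Lemma bumpR_ge0 N a b x : 0 <= bumpR N a b x.
Proof. by rewrite mulr_ge0 ?flat_ge0. Qed.

Lemma bumpR_le1 N a b x : bumpR N a b x <= 1.
Proof. by rewrite mulr_ile1 ?flat_ge0 ?flat0_le1. Qed.

Lemma bumpR_eq0 N a b x : x \notin `]a, b[ -> bumpR N a b x = 0.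
Proof.
rewrite in_itv/= negb_and -!leNgt /bumpR -mulrN -mulrDr mulNr [- _ + _]addrC -mulrN -mulrDr.
rewrite /flat !pmulr_rgt0// !subr_gt0 !ltNge => /orP[] ->; first by rewrite mul0r.
by rewrite mulr0.
Qed.

Lemma flat0_cvg x : 0 < x -> flat 0 (N.+1%:R * x) @[N --> \oo] --> (1 : R).
Proof.
move=> x0; rewrite (_ : (fun N : nat => _) = (fun N : nat => expR (- (N.+1%:R^-1 * x^-1)))).
  rewrite -[X in _ --> X]expR0; apply: continuous_cvg; first exact: continuous_expR.
  rewrite -oppr0 -(mul0r x^-1); apply: cvgN; apply: cvgMl; exact: cvg_harmonic.
apply/funext => N; rewrite /flat pmulr_rgt0// x0 expr0 invr1 mul1r invfM//.
Qed.

Lemma bumpR_cvg a b x :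
  bumpR N a b x @[N --> \oo] --> (\1_(`]a, b[%classic) x : R).
Proof.
rewrite indicE; case: (boolP (x \in `]a, b[)) => [xab|xab]; last first.
  rewrite memNset; last by apply/negP.
  by under eq_fun do rewrite bumpR_eq0//; exact: cvg_cst.
rewrite mem_set//= -[1%:R]mulr1; move: xab; rewrite in_itv/= => /andP[ax xb].
rewrite /bumpR.
under eq_fun do rewrite -mulrN -mulrDr mulNr [- _ + _]addrC -mulrN -mulrDr.
by apply: cvgM; apply: flat0_cvg; rewrite subr_gt0.
Qed.

End bump.

Section line_derivative.
Context {R : realType}.

Lemma is_derive_line (V W : normedModType R) (f : V -> W) (a v : V) (t : R) (l : W) :
  is_derive t (1 : R) (fun s : R => f (s *: v + a)) l <-> is_derive (t *: v + a) v f l.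
Proof.
have E : (fun h : R => h^-1 *: (((fun s : R => f (s *: v + a)) \o shift t) (h *: 1)
      - (fun s : R => f (s *: v + a)) t)) =
    (fun h : R => h^-1 *: ((f \o shift (t *: v + a)) (h *: v) - f (t *: v + a))).
  apply/funext => h /=; congr (_ *: (f _ - _)).
  by rewrite scalerDl -addrA /GRing.scale/= mulr1.
by split=> -[d <-]; apply: DeriveDef; rewrite /derivable /derive; rewrite ?E// -?E.
Qed.

End line_derivative.

Section product_bump.
Context {R : realType} {n : nat}.
Local Notation V := 'rV[R]_n.

Lemma continuous_coord (i : 'I_n) : continuous (fun x : V => x ord0 i).
Proof. by move=> x; exact: coord_continuous. Qed.

Lemma smooth_continuous p (f : R -> R) : smooth p.+1 f -> continuous f.
Proof.
move=> [df fdf _] x; apply/differentiable_continuous/derivable1_diffP.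
by case: (fdf x).
Qed.

Lemma continuous_prod_coord (f : 'I_n -> R -> R) : (forall i, continuous (f i)) ->
  continuous (fun x : V => \prod_(i < n) f i (x ord0 i)).
Proof.
move=> cf x; rewrite -fct_prodE; elim/big_ind: _ => [|g h cg ch|i _].
- exact: cst_continuous.
- exact: continuousM.
- by apply: continuous_comp; [exact: continuous_coord|exact: cf].
Qed.

(** Differentiation along [k] replaces the factor [f k] by its derivative and leaves a product of
    the same kind. The extra degree pays for the continuity of the last derivatives. *)
Lemma continuously_differentiable_prod p (f : 'I_n -> R -> R) :
  (forall i, smooth p.+1 (f i)) ->
  continuously_differentiable p (fun x : V => \prod_(i < n) f i (x ord0 i)).
Proof.
elim: p f => [|p IH] f sf.
  by split => //; apply: continuous_prod_coord => i; exact: smooth_continuous (sf i).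
split; first by apply: continuous_prod_coord => i; exact: smooth_continuous (sf i).
move=> k; have [df fdf sdf] := sf k.
pose g i := if i == k then df else f i.
have fg x : is_derive x (delta_mx ord0 k : V) (fun x : V => \prod_(i < n) f i (x ord0 i))
    (\prod_(i < n) g i (x ord0 i)).
  rewrite -[X in is_derive X](add0r x) -[X in is_derive (X + _)](scale0r (delta_mx ord0 k)).
  apply/is_derive_line.
  rewrite (_ : (fun s : R => _) =
      (fun s : R => f k (1 * s + x ord0 k) * \prod_(i < n | i != k) f i (x ord0 i))); last first.
    apply/funext => s; rewrite (bigD1 k)//= !mxE !eqxx mulr1 mul1r; congr (_ * _).
    by apply: eq_bigr => i ik; rewrite !mxE (negbTE ik) andbF mulr0 add0r.
  have -> : \prod_(i < n) g i (x ord0 i) =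
      df (x ord0 k) * \prod_(i < n | i != k) f i (x ord0 i).
    rewrite (bigD1 k)//= {1}/g eqxx; congr (_ * _).
    by apply: eq_bigr => i ik; rewrite /g (negbTE ik).
  have fk : is_derive (0 : R) (1 : R) (fun s => f k (1 * s + x ord0 k)) (df (x ord0 k) * 1).
    by apply: is_derive_affine; rewrite mulr0 add0r.
  apply: (is_derive_eq (is_deriveM fk (is_derive_cst _ _ _))).
  by rewrite scaler0 add0r mulr1 /GRing.scale/= mulrC.
split; first by move=> x; case: (fg x).
rewrite (_ : pderiv k _ = fun x : V => \prod_(i < n) g i (x ord0 i)).
  apply: IH => i; rewrite /g; case: eqP => // _; exact: smoothW.
by apply/funext => x; case: (fg x).
Qed.

End product_bump.

(** * Borel measurability of continuous functions *)

Section continuous_measurable.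
Context {R : realType} {n : nat}.
Local Notation V := 'rV[R]_n.
Local Notation mu := (@lebesgue_rV R n).

Lemma measurable_open_rV (U : set V) : open U -> measurable U.
Proof.
move=> oU.
(* Countably many boxes, with rational centres and half-widths [1/(k+1)]; those contained in [U]
   cover it. *)
pose B (qk : 'rV[rat]_n * nat) : set V := box (fun i =>
  `](ratr (qk.1 ord0 i) - qk.2.+1%:R^-1), (ratr (qk.1 ord0 i) + qk.2.+1%:R^-1)[%classic).
have -> : U = \bigcup_qk (if `[< B qk `<=` U >] then B qk else set0).
  apply/seteqP; split=> [x Ux|x [qk _]]; last by case: ifPn => // /asboolP; exact.
  have /nbhs_ballP[e /= e0 xeU] : nbhs x U by exact: open_nbhs_nbhs.
  have [k ke] : exists k, k.+1%:R^-1 < e / 2 :> R.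
    have e20 : 0 < e / 2 by rewrite divr_gt0.
    by have /cvgrPdist_lt/(_ _ e20)[k _ /(_ k (leqnn k))] := @cvg_harmonic R;
      rewrite sub0r normrN ger0_norm ?invr_ge0// => ?; exists k.
  have q_ i : exists q : rat, `|x ord0 i - ratr q| < k.+1%:R^-1.
    have /rat_in_itvoo[q] : x ord0 i - k.+1%:R^-1 < x ord0 i + k.+1%:R^-1.
      by rewrite ltrD2l gtrN ?invr_gt0.
    by rewrite in_itv/= -ltr_distlC; exists q.
  have {}q_ i := cid (q_ i).
  exists (\row_i (sval (q_ i)), k) => //=; case: asboolP => [_ i/=|].
    by rewrite in_itv/= -ltr_distl mxE; case: (q_ i).
  case=> y Bxy; apply: xeU; rewrite -ball_normE /=.
  apply: le_lt_trans (_ : _ <= k.+1%:R^-1 + k.+1%:R^-1) _; last by rewrite (splitr e) ltrD.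
  apply: mx_norm_le => [|j i]; first by rewrite addr_ge0.
  rewrite ord1 !mxE; apply: le_trans (ler_distD (ratr (sval (q_ i))) _ _) _.
  rewrite lerD//; first by case: (q_ i) => q /= /ltW.
  by have := Bxy i; rewrite /= in_itv/= -ltr_distl mxE distrC => /ltW.
apply: countable_bigcupT_measurable => // qk; case: ifP => // _.
by apply: measurable_box => i; exact: measurable_itv.
Qed.

Lemma measurable_continuous_rV (f : V -> R) : continuous f -> measurable_fun setT f.
Proof.
move=> /continuousP cf; apply: (measurability _ (RGenOpens.measurableE R)).
move=> _ [_ [a [b ->] <-]]; rewrite setTI; apply: measurable_open_rV.
exact/cf/interval_open.
Qed.

Definition cube (M : R) : set V := box (fun=> `[- M, M]%classic).

Lemma measurable_cube M : measurable (cube M).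
Proof. by apply: measurable_box => i; exact: measurable_itv. Qed.

Lemma cube_lty M : (mu (cube M) < +oo)%E.
Proof.
rewrite lebesgue_box => [|i]; last exact: measurable_itv.
rewrite -ge0_fin_numE; last by apply: prode_ge0 => i _; exact: measure_ge0.
by apply: prode_fin_num => i _; rewrite lebesgue_measure_itv/=; case: ifP.
Qed.

Lemma cubeE M x : 0 <= M -> cube M x <-> `|x| <= M.
Proof.
move=> M0; split=> [Mx|xM i].
  by apply: mx_norm_le => // i j; have := Mx j; rewrite (ord1 i)/= in_itv/= ler_norml.
by rewrite /= in_itv/= -ler_norml (le_trans (coord_le_norm _ _ _)).
Qed.

End continuous_measurable.

Section test_functions.
Context {R : realType} {n : nat}.
Local Notation V := 'rV[R]_n.
Local Notation mu := (@lebesgue_rV R n).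
Implicit Types f g phi : V -> R.

Lemma cdiff_continuous p f : continuously_differentiable p f -> continuous f.
Proof. by case: p => [|p] []. Qed.

Lemma cdiffD p f g : continuously_differentiable p f ->
  continuously_differentiable p g -> continuously_differentiable p (f + g).
Proof.
elim: p f g => [|p IH] f g [cf df] [cg dg].
  by split => // x; apply: continuousD; [exact: cf|exact: cg].
split; first by move=> x; apply: continuousD; [exact: cf|exact: cg].
move=> k; have [fk dfk] := df k; have [gk dgk] := dg k; split.
  by move=> x; exact: derivableD.
rewrite (_ : pderiv k _ = pderiv k f + pderiv k g); first exact: IH.
by apply/funext => x; rewrite /pderiv deriveD.
Qed.

Lemma cdiffZ p f (c : R) : continuously_differentiable p f ->
  continuously_differentiable p (c *: f).
Proof.
elim: p f => [|p IH] f [cf df].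
  by split => // x; apply: continuousZr; exact: cf.
split; first by move=> x; apply: continuousZr; exact: cf.
move=> k; have [fk dfk] := df k; split; first by move=> x; exact: derivableZ.
rewrite (_ : pderiv k _ = c *: pderiv k f); first exact: IH.
by apply/funext => x; rewrite /pderiv deriveZ.
Qed.

Lemma is_derive_translate (y : V) f (v : V) x l :
  is_derive (x - y) v f l -> is_derive x v (translate y f) l.
Proof.
have E : (fun h : R => h^-1 *: ((translate y f \o shift x) (h *: v) - translate y f x)) =
    (fun h => h^-1 *: ((f \o shift (x - y)) (h *: v) - f (x - y))).
  by apply/funext => h; rewrite /translate /= addrA.
by case=> df <-; apply: DeriveDef; rewrite /derivable /derive E.
Qed.

Lemma pderiv_translate k (y : V) f :
  (forall x, derivable f x (delta_mx ord0 k : V)) ->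
  pderiv k (translate y f) = translate y (pderiv k f).
Proof. 
move=> df; apply/funext => x; rewrite /pderiv.
by case: (@is_derive_translate y f (delta_mx ord0 k) x _ (DeriveDef (df (x - y)) erefl)).
Qed.

Lemma continuous_translate (y : V) f : continuous f -> continuous (translate y f).
Proof.
move=> cf x; apply: (@continuous_comp V V R (fun x => x - y) f x); last exact: cf.
by apply: continuousB; [exact: cvg_id|exact: cst_continuous].
Qed.

Lemma cdiff_translate p (y : V) f : continuously_differentiable p f ->
  continuously_differentiable p (translate y f).
Proof.
elim: p f => [|p IH] f [cf df]; first by split => //; exact: continuous_translate.
split; first exact: continuous_translate.
move=> k; have [fk dfk] := df k; split.
  move=> x; have [//] := @is_derive_translate y f (delta_mx ord0 k) x _ (DeriveDef (fk _) erefl).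
by rewrite pderiv_translate//; exact: IH.
Qed.

Lemma compact_supportP phi :
  compact (closure [set x | phi x != 0]) <-> exists M, forall x, phi x != 0 -> `|x| <= M.
Proof.
split=> [/compact_bounded[M [_ /(_ (M + 1))]]|[M phiM]].
  rewrite ltrDl ltr01 => /(_ isT) bM; exists (M + 1) => x px.
  by apply: bM; exact: subset_closure.
apply: bounded_closed_compact; last exact: closed_closure.
have cM : closed [set x : V | `|x| <= M].
  apply: (@closed_comp _ _ (fun x : V => `|x|) [set t : R | t <= M]) => //.
  by move=> x _; exact: norm_continuous.
exists M; split; first exact: num_real.
move=> M' MM' x; have := closureS phiM.
by rewrite -((closure_id _).1 cM) => /[apply] /= xM; apply: le_trans (ltW MM').
Qed.

Lemma test_functionP phi : test_function phi <->
  (forall p, continuously_differentiable p phi) /\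
  exists M, forall x, phi x != 0 -> `|x| <= M.
Proof. by split=> -[sphi /compact_supportP]. Qed.

Lemma test_functionD f g : test_function f -> test_function g -> test_function (f + g).
Proof.
move=> /test_functionP[sf [M fM]] /test_functionP[sg [N gN]].
apply/test_functionP; split=> [p|]; first exact: cdiffD.
exists (Num.max M N) => x; rewrite le_max => fg0.
have [fx0|/fM->//] := eqVneq (f x) 0; have [gx0|/gN->//] := eqVneq (g x) 0.
  by move: fg0; rewrite -[(f + g) x]/(f x + g x) fx0 gx0 addr0 eqxx.
by rewrite orbT.
Qed.

Lemma test_functionZ (c : R) f : test_function f -> test_function (c *: f).
Proof.
move=> /test_functionP[sf [M fM]].
apply/test_functionP; split=> [p|]; first exact: cdiffZ.
exists M => x cf0; apply: fM; apply: contra cf0 => /eqP fx0.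
by rewrite -[(c *: f) x]/(c * f x) fx0 mulr0.
Qed.

Lemma test_function_translate y f : test_function f -> test_function (translate y f).
Proof.
move=> /test_functionP[sf [M fM]].
apply/test_functionP; split=> [p|]; first exact: cdiff_translate.
exists (M + `|y|) => x /fM xyM; rewrite -(subrK y x).
by rewrite (le_trans (ler_normD _ _))// lerD2r.
Qed.

Lemma pderiv_support k f M : (forall x, f x != 0 -> `|x| <= M) ->
  forall x, pderiv k f x != 0 -> `|x| <= M.
Proof.
move=> fM x; apply: contraNT; rewrite -ltNge => Mx.
rewrite /pderiv (@near_eq_derive _ _ _ f (cst 0)) ?derive_cst//.
near=> z; apply/eqP; apply: contraTT (_ : M < `|z|) => [/fM|]; first by rewrite -leNgt.
by near: z; apply: (cvgr_gt `|x|) => //; exact: norm_continuous.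
Unshelve. all: by end_near. Qed.

Lemma test_function_pderiv k f : test_function f -> test_function (pderiv k f).
Proof.
move=> /test_functionP[sf [M fM]]; apply/test_functionP; split=> [p|].
  by have [_ /(_ k)[]] := sf p.+1.
by exists M; exact: pderiv_support.
Qed.

Lemma test_function0 : test_function (0 : V -> R).
Proof.
apply/test_functionP; split; last by exists 0 => x; rewrite eqxx.
elim=> [|p IH]; first by split => // x; exact: cst_continuous.
split; first by move=> x; exact: cst_continuous.
move=> k; split; first by move=> x; exact: derivable_cst.
by rewrite (_ : pderiv k 0 = 0)//; apply/funext => x; exact: derive_cst.
Qed.

Lemma test_function_derivable k f x : test_function f -> derivable f x (delta_mx ord0 k : V).
Proof. by move=> [/(_ 1%N)[_ /(_ k)[]]]. Qed.

(** One [M] serves as bound and as radius of the support, so that the majorant is a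
    square-integrable multiple of an indicator. *)
Lemma test_function_bounded f : test_function f ->
  exists2 M, 0 <= M & forall x, `|f x| <= `|M * \1_(cube M) x|.
Proof.
move=> /test_functionP[sf [M fM]]; have cf := cdiff_continuous (sf 0%N).
have [N0 [_ fN]] : bounded_set (f @` (closure [set x | f x != 0])).
  apply/compact_bounded/continuous_compact; last by apply/compact_supportP; exists M.
  exact: continuous_subspaceT.
have [N N_ge0 {}fN] : exists2 N, 0 <= N & forall x, `|f x| <= N.
  exists `|N0 + 1| => // x; have [->|fx] := eqVneq (f x) 0; first by rewrite normr0.
  apply: le_trans (ler_norm _); apply: fN; first by rewrite ltrDl.
  by exists x => //; exact: subset_closure.
have MN : M <= Num.max M N by rewrite le_max lexx.
have NM : N <= Num.max M N by rewrite le_max lexx orbT.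
exists (Num.max M N) => [|x]; first exact: le_trans NM.
have [->|fx] := eqVneq (f x) 0; first by rewrite normr0.
rewrite indicE mem_set ?mulr1; last first.
  by apply/(cubeE _ (le_trans N_ge0 NM)); apply: le_trans MN; exact: fM.
by apply: le_trans (ler_norm _); exact: le_trans NM.
Qed.

Lemma scaled_cube_L2 (c M : R) : (fun x : V => c * \1_(cube M) x) \in Lfun mu 2%:E.
Proof.
rewrite (_ : (fun x => _) = c \o* \1_(cube M)); last first.
  by apply/funext => x /=; rewrite mulrC.
apply: Lfun_scale; first by rewrite ler1n.
by apply: indic_L2; [exact: measurable_cube|exact: cube_lty].
Qed.

Lemma test_function_L2 f : test_function f -> f \in Lfun mu 2%:E.
Proof.
move=> tf; have [M _ fM] := test_function_bounded tf.
apply: le_L2 (scaled_cube_L2 M M) fM; apply: measurable_continuous_rV.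
exact: cdiff_continuous (tf.1 0%N).
Qed.

Definition box_bump (N : nat) (a b : 'I_n -> R) (x : V) : R :=
  \prod_(i < n) bumpR N (a i) (b i) (x ord0 i).

Definition open_box (a b : 'I_n -> R) : set V := box (fun i => `](a i), (b i)[%classic).

Lemma open_box_norm a b x : open_box a b x -> `|x| <= \sum_i (`|a i| + `|b i|).
Proof.
move=> xab; have s0 : 0 <= \sum_i (`|a i| + `|b i|).
  by apply: sumr_ge0 => i _; rewrite addr_ge0.
apply: mx_norm_le => // i j; rewrite ord1 {i}.
have := xab j; rewrite /= in_itv/= => /andP[/ltW ax /ltW xb].
apply: (@le_trans _ _ (`|a j| + `|b j|)); last first.
  by rewrite (bigD1 j)//= lerDl sumr_ge0// => i _; rewrite addr_ge0.
rewrite ler_norml; apply/andP; split.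
  by apply: le_trans ax; rewrite lerNl (le_trans (ler_norm _))// normrN lerDl.
by apply: le_trans xb _; rewrite (le_trans (ler_norm _))// lerDr.
Qed.

Lemma box_bump_eq0 N a b x : ~ open_box a b x -> box_bump N a b x = 0.
Proof.
move=> /existsNP[i xi]; rewrite /box_bump (bigD1 i)//= bumpR_eq0 ?mul0r//.
exact/negP.
Qed.

Lemma box_bumpP N a b : test_function (box_bump N a b).
Proof.
apply/test_functionP; split=> [p|].
  by apply: (@continuously_differentiable_prod _ _ _ (fun i => bumpR N (a i) (b i)))
    => i; exact: smooth_bumpR.
exists (\sum_i (`|a i| + `|b i|)) => x bx0; apply: open_box_norm.
by apply: contrapT => /(box_bump_eq0 N) xab; rewrite xab eqxx in bx0.
Qed.

Lemma box_bump_le1 N a b x : 0 <= box_bump N a b x <= 1.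
Proof.
apply/andP; split; first by apply: prodr_ge0 => i _; exact: bumpR_ge0.
by apply: prodr_ile1 => i _; rewrite bumpR_ge0 bumpR_le1.
Qed.

Lemma box_bump_cvg a b x :
  box_bump N a b x @[N --> \oo] --> (\1_(open_box a b) x : R).
Proof.
have -> : \1_(open_box a b) x =
    \prod_(i < n) \1_(`](a i), (b i)[%classic) (x ord0 i) :> R.
  rewrite indicE; have [xI|xI] := pselect (open_box a b x).
    by rewrite mem_set//= big1// => i _; rewrite indicE mem_set//; exact: xI.
  rewrite memNset//; move/existsNP: xI => [i xi].
  by rewrite (bigD1 i)//= indicE memNset ?mul0r.
rewrite /box_bump; elim: (index_enum _) => [|i s IH].
  by under eq_fun do rewrite big_nil; rewrite big_nil; exact: cvg_cst.
under eq_fun do rewrite big_cons; rewrite big_cons.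
by apply: cvgM => //; exact: bumpR_cvg.
Qed.

End test_functions.

Section density.
Context {R : realType} {n : nat}.
Local Notation V := 'rV[R]_n.
Local Notation mu := (@lebesgue_rV R n).
Local Notation H := (LfunType mu (@lee1n R 2)).
Implicit Types f g : H.

Definition test_limit f :=
  forall e, 0 < e -> exists2 phi : H, test_function phi & nrm (f - phi) < e.

Lemma test_limit0 : test_limit 0.
Proof. by move=> e e0; exists 0; rewrite ?subr0 ?nrm0//; exact: test_function0. Qed.

Lemma test_limitD f g : test_limit f -> test_limit g -> test_limit (f + g).
Proof.
move=> tf tg e e0; have e20 : 0 < e / 2 by rewrite divr_gt0.
have [phi tphi fphi] := tf _ e20; have [psi tpsi gpsi] := tg _ e20.
exists (phi + psi); first exact: test_functionD.
rewrite opprD addrACA; apply: le_lt_trans (nrmD _ _) _.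
by rewrite (splitr e) ltrD.
Qed.

Lemma test_limitZ c f : test_limit f -> test_limit (c *: f).
Proof.
move=> tf e e0; have c0 : 0 < `|c| + 1 by rewrite ltr_wpDl.
have [phi tphi fphi] := tf _ (divr_gt0 e0 c0).
exists (c *: phi); first exact: test_functionZ.
rewrite -scalerBr nrmZ; move: fphi; rewrite ltr_pdivlMr//.
by apply: le_lt_trans; rewrite mulrC ler_wpM2l ?nrm_ge0// lerDl.
Qed.

Lemma test_limit_sum I (r : seq I) (P : pred I) (F : I -> H) :
  (forall i, P i -> test_limit (F i)) -> test_limit (\sum_(i <- r | P i) F i).
Proof.
by move=> tF; elim/big_ind : _ => //; [exact: test_limit0|exact: test_limitD].
Qed.

Lemma test_limit_cvg (f_ : nat -> H) f : (forall k, test_limit (f_ k)) ->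
  nrm (f_ k - f) @[k --> \oo] --> (0 : R) -> test_limit f.
Proof.
move=> tf /cvgrPdist_lt f_f e e0; have e20 : 0 < e / 2 by rewrite divr_gt0.
have [k _ /(_ k (leqnn k))] := f_f _ e20.
rewrite sub0r normrN ger0_norm ?nrm_ge0// nrmB => fk.
have [phi tphi fphi] := tf k _ e20; exists phi => //.
rewrite -(subrKA (f_ k)); apply: le_lt_trans (nrmD _ _) _.
by rewrite (splitr e) ltrD.
Qed.

Lemma measurable_open_box (a b : 'I_n -> R) : measurable (open_box a b).
Proof. by apply: measurable_box => i; exact: measurable_itv. Qed.

Lemma sub_indic_L2 (A : set V) M : measurable A -> A `<=` cube M -> \1_A \in Lfun mu 2%:E.
Proof.
move=> mA AM; apply: indic_L2 => //; apply: le_lt_trans (cube_lty M).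
by apply: le_measure => //; rewrite inE//; exact: measurable_cube.
Qed.

Lemma cube_indic_L2 M : \1_(cube M) \in Lfun mu 2%:E.
Proof. by apply: (@sub_indic_L2 _ M) => //; exact: measurable_cube. Qed.

Lemma open_box_sub (a b : 'I_n -> R) : exists M, open_box a b `<=` cube M.
Proof.
exists (\sum_i (`|a i| + `|b i|)) => x /open_box_norm; rewrite cubeE//.
by apply: sumr_ge0 => i _; rewrite addr_ge0.
Qed.

Lemma test_limit_open_box (a b : 'I_n -> R) : test_limit (toL2 mu \1_(open_box a b)).
Proof.
have [M abM] := open_box_sub a b.
have bE N : toL2 mu (box_bump N a b) = box_bump N a b :> (V -> R).
  by rewrite toL2K// test_function_L2//; exact: box_bumpP.
have ab2 := sub_indic_L2 (measurable_open_box a b) abM.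
apply: (@test_limit_cvg (fun N => toL2 mu (box_bump N a b))).
  move=> N e e0; exists (toL2 mu (box_bump N a b)); last by rewrite subrr nrm0.
  by rewrite bE; exact: box_bumpP.
apply: (@L2_dominated _ _ _ _ _ _ (toL2 mu \1_(cube M))) => [x|N x].
  rewrite toL2K//; under eq_fun do rewrite bE.
  exact: box_bump_cvg.
rewrite bE toL2K ?cube_indic_L2//.
have [xab|xab] := pselect (open_box a b x); last by rewrite box_bump_eq0// normr0.
rewrite [X in _ <= `|X|]indicE mem_set; last exact: abM.
by have /andP[b0 b1] := box_bump_le1 N a b x; rewrite normr1 ger0_norm.
Qed.

(** These boxes are stable under intersection, by taking maxima of the corners, and an entry [-oo]
    leaves its coordinate free, which gives the cylinders. *)
Definition upper_boxes : set_system V :=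
  [set A | exists a : 'I_n -> \bar R, A = box (fun i => [set t | (a i < t%:E)%E])].

Lemma measurable_upper_boxesE : measurable = <<s upper_boxes >>.
Proof.
have mU (a : \bar R) : measurable [set t : R | (a < t%:E)%E].
  case: a => [r||].
  - rewrite (_ : [set _ | _] = `]r, +oo[%classic); first exact: measurable_itv.
    by apply/seteqP; split=> t /=; rewrite in_itv/= andbT lte_fin.
  - by rewrite (_ : [set _ | _] = set0)//; apply/seteqP; split.
  - by rewrite (_ : [set _ | _] = setT)//; apply/seteqP; split=> // t _ /=; rewrite ltNyr.
apply: measurable_rVE => [_ [a ->]|i A mA]; first by apply: measurable_box => i.
suff : <<s @RGenOInfty.G R >> `<=` [set A | <<s upper_boxes >> (rV_coord i @^-1` A)].
  apply; have : (ocitv (R:=R)).-sigma.-measurable A := mA.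
  by rewrite RGenOInfty.measurableE.
have [s0 sC sU] := @smallest_sigma_algebra _ setT upper_boxes.
apply: smallest_sub.
  split => [|B sB|F sF] /=; first by rewrite preimage_set0.
    by have := sC _ sB; rewrite !setTD -preimage_setC.
  by rewrite preimage_bigcup; exact: sU.
move=> _ [r ->]; apply: sub_sigma_algebra.
exists (fun j => if j == i then r%:E else -oo%E); apply/seteqP; split=> x /=.
  rewrite /rV_coord in_itv/= andbT => rx j /=; case: eqP => [->|_]; last by rewrite ltNyr.
  by rewrite lte_fin.
by move=> /(_ i); rewrite /= eqxx /rV_coord in_itv/= andbT lte_fin.
Qed.

Definition trunc_indic N (A : set V) : H :=
  toL2 mu \1_(A `&` open_box (fun=> - N%:R) (fun=> N%:R)).

Lemma trunc_indicE N A : measurable A ->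
  trunc_indic N A = \1_(A `&` open_box (fun=> - N%:R) (fun=> N%:R)) :> (V -> R).
Proof.
move=> mA; have [M QM] := open_box_sub (fun=> - N%:R) (fun=> N%:R).
rewrite /trunc_indic toL2K//; apply: (@sub_indic_L2 _ M).
  by apply: measurableI => //; exact: measurable_open_box.
by move=> x [_ /QM].
Qed.

(** Dynkin's theorem, starting from the upper boxes. Truncation to a fixed cube puts every indicator
    in L2 and provides the majorant for countable disjoint unions. *)
Lemma test_limit_measurable N (A : set V) : measurable A -> test_limit (trunc_indic N A).
Proof.
move=> mA; have : <<s upper_boxes >> A by rewrite -measurable_upper_boxesE.
move: A {mA}; apply: dynkin_induction; first exact: measurable_upper_boxesE.
- move=> _ _ [a ->] [b ->]; exists (fun i => maxe (a i) (b i)).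
  by rewrite boxI; congr box; apply/funext => i; apply/seteqP; split=> t /=;
     rewrite gt_max => /andP.
- by rewrite /trunc_indic setTI; exact: test_limit_open_box.
- move=> _ [a ->].
  (* The lower corner of the truncated box; an entry [+oo] gives the empty interval []N, N[]. *)
  pose c i := if a i is r%:E then Num.max r (- N%:R) else if a i is +oo%E then N%:R else - N%:R.
  rewrite /trunc_indic boxI (_ : box _ = open_box c (fun=> N%:R)).
    exact: test_limit_open_box.
  congr box; apply/funext => i; apply/seteqP; split=> t /=; rewrite /c !in_itv/=.
    case: (a i) => [r||] [] //.
    by rewrite lte_fin gt_max => -> /andP[-> ->].
  case: (a i) => [r||].
  + by rewrite gt_max lte_fin => /andP[/andP[-> ->] ->].
  + by move=> /andP[/lt_trans h /h]; rewrite ltxx.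
  + by rewrite ltNyr.
- move=> S mS tS; have mSC := measurableC mS.
  have -> : trunc_indic N (~` S) = trunc_indic N setT - trunc_indic N S.
    apply/LfuneqP => x.
    rewrite -[RHS]/((trunc_indic N setT : V -> R) x - (trunc_indic N S : V -> R) x).
    rewrite !trunc_indicE// !indicE !in_setI in_setC in_setT.
    by case: (x \in S); case: (x \in _); rewrite /= ?subrr ?subr0.
  apply: test_limitD; first by rewrite /trunc_indic setTI; exact: test_limit_open_box.
  by rewrite -scaleN1r; exact: test_limitZ.
move=> F mF tF tFN.
pose G K := \big[setU/set0]_(k < K) F k.
have mG K : measurable (G K) by apply: bigsetU_measurable => k _; exact: mF.
have mUF : measurable (\bigcup_k F k) by exact: bigcupT_measurable.
have GP K x : G K x <-> exists2 k, (k < K)%N & F k x.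
  rewrite /G -bigcup_mkord; split=> [[k /= kK Fkx]|[k kK Fkx]]; by exists k.
have tG K : test_limit (trunc_indic N (G K)).
  elim: K => [|K IH].
    rewrite (_ : trunc_indic _ _ = 0); first exact: test_limit0.
    by apply/LfuneqP => x; rewrite trunc_indicE// /G big_ord0 set0I indic0.
  have -> : trunc_indic N (G K.+1) = trunc_indic N (G K) + trunc_indic N (F K).
    apply/LfuneqP => x.
    rewrite -[RHS]/((trunc_indic N (G K) : V -> R) x + (trunc_indic N (F K) : V -> R) x).
    rewrite !trunc_indicE// !indicE !in_setI /G big_ord_recr/= in_setU -/(G K).
    have : ~ (G K x /\ F K x).
      move=> [/GP[k kK Fkx] FKx]. have := tF k K I I (ex_intro _ x (conj Fkx FKx)).
      by move=> kKE; rewrite kKE ltnn in kK.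
    case: (boolP (x \in G K)) => [/set_mem xG|_]; case: (boolP (x \in F K)) => [/set_mem xF|_];
      case: (x \in open_box _ _) => //=; rewrite ?addr0 ?add0r// => /(_ (conj xG xF)) [].
  exact: test_limitD.
apply: (test_limit_cvg tG).
apply: (@L2_dominated _ _ _ _ _ _ (trunc_indic N setT)) => [x|K x].
  rewrite trunc_indicE//; under eq_fun do rewrite trunc_indicE//.
  have [[k _ Fkx]|nF] := pselect ((\bigcup_k F k) x).
    apply: cvg_near_cst; exists k.+1 => // K /= kK.
    rewrite !indicE !in_setI; congr ((nat_of_bool (_ && _))%:R).
    by rewrite !mem_set//; [exists k|apply/GP; exists k].
  apply: cvg_near_cst; exists 0%N => // K _.
  have nG : ~ G K x by move=> /GP[k _ Fkx]; apply: nF; exists k.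
  by rewrite !indicE !in_setI (memNset nF) (memNset nG).
rewrite !trunc_indicE// !indicE !in_setI in_setT.
by case: (x \in _); case: (x \in _); rewrite /= ?normr1 ?normr0.
Qed.

Import HBNNSimple.

(** Simple functions increasing to [f] are cut off to growing cubes. Each is a finite combination of
    truncated indicators of its level sets, and [f] itself is the majorant. *)
Lemma test_dense_ge0 f : (forall x, 0 <= (f : V -> R) x) -> test_limit f.
Proof.
move=> f0; have mf : measurable_fun setT (EFin \o f).
  by apply/measurable_EFinP; exact: measurable_L2.
pose g k := nnsfun_approx measurableT mf k.
have gf x : (g k x) @[k --> \oo] --> (f : V -> R) x.
  by have /(_ x I)/fine_cvg := @cvg_nnsfun_approx _ _ R setT measurableT _ mf (fun x _ => f0 x).
have g_le k x : g k x <= (f : V -> R) x.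
  rewrite -(cvg_lim _ (gf x))//; apply: nondecreasing_cvgn_le; last exact: cvgP (gf x).
  by move=> i j ij; have /lefP := nd_nnsfun_approx measurableT mf ij; exact.
pose Q k : set V := open_box (fun=> - k%:R) (fun=> k%:R).
pose h k x : R := g k x * \1_(Q k) x.
have h2 k : h k \in Lfun mu 2%:E.
  apply: le_L2 (LfunP f) _.
    apply: measurable_funM => //; apply: measurable_indic; exact: measurable_open_box.
  move=> x; rewrite /h indicE; case: (x \in Q k); rewrite ?mulr1 ?mulr0 ?normr0//.
  by rewrite !ger0_norm.
apply: (@test_limit_cvg (fun k => toL2 mu (h k))).
  move=> k; pose s := finmap.enum_fset (fset_set (range (g k))).
  have mg r : measurable (g k @^-1` [set r]).
    by rewrite -[X in measurable X]setTI; exact: measurable_funP.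
  have -> : toL2 mu (h k) = \sum_(r <- s) r *: trunc_indic k (g k @^-1` [set r]).
    apply/LfuneqP => x; rewrite toL2K// /h fimfunE fsbig_finite//= mulr_suml.
    have vE (F : R -> H) : (\sum_(r <- s) F r : V -> R) x = \sum_(r <- s) (F r : V -> R) x.
      by elim/big_rec2: _ => // r a b _ <-.
    apply: esym; apply: etrans (vE _) _; apply: eq_bigr => r _.
    rewrite -[LHS]/(r * (trunc_indic k (g k @^-1` [set r]) : V -> R) x) trunc_indicE//.
    by rewrite -mulrA indicI.
  apply: test_limit_sum => r _; apply: test_limitZ; exact: test_limit_measurable.
apply: (@L2_dominated _ _ _ _ _ _ f) => [x|k x].
  under eq_fun do rewrite toL2K//.
  have Q1 : (\1_(Q k) x : R) @[k --> \oo] --> (1 : R).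
    apply: cvg_near_cst; exists (Num.bound `|x|) => // k /= xk.
    rewrite indicE mem_set// => i /=.
    rewrite in_itv/= -ltr_norml; apply: le_lt_trans (coord_le_norm _ _ _) _.
    by apply: lt_le_trans (archi_boundP _) _ => //; rewrite ler_nat.
  by have := cvgM (gf x) Q1; rewrite mulr1; exact.
rewrite toL2K// /h indicE; case: (x \in Q k); rewrite ?mulr1 ?mulr0 ?normr0//.
by rewrite !ger0_norm.
Qed.

Theorem test_dense f : test_limit f.
Proof.
pose p (f : H) (x : V) : R := Num.max ((f : V -> R) x) 0.
have p2 g : p g \in Lfun mu 2%:E.
  apply: le_L2 (LfunP g) _ => [|x].
    by apply: measurable_maxr => //; exact: measurable_L2.
  by rewrite /p; case: (leP ((g : V -> R) x) 0) => _; rewrite ?normr0.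
have -> : f = toL2 mu (p f) - toL2 mu (p (- f)).
  apply/LfuneqP => x; rewrite -[RHS]/((toL2 mu (p f) : V -> R) x - (toL2 mu (p (- f)) : V -> R) x).
  rewrite !toL2K// /p -[(- f : H) x]/(- (f : V -> R) x).
  move: ((f : V -> R) x) => t; case: (leP t 0) => [t0|/ltW t0].
    by rewrite max_l ?oppr_ge0// sub0r opprK.
  by rewrite max_r ?oppr_le0// subr0.
apply: test_limitD; last rewrite -scaleN1r; last apply: test_limitZ;
  by apply: test_dense_ge0 => x; rewrite toL2K// le_max lexx orbT.
Qed.

End density.

(** * Translations and weak derivatives in L2 *)

Section translation_L2.
Context {R : realType} {n : nat}.
Local Notation V := 'rV[R]_n.
Local Notation mu := (@lebesgue_rV R n).
Local Notation H := (LfunType mu (@lee1n R 2)).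
Implicit Types (f g h : H) (y z : V).

Lemma translate_L2 y (f : V -> R) : f \in Lfun mu 2%:E -> translate y f \in Lfun mu 2%:E.
Proof.
move=> /andP[/[!inE]/= mf nf]; apply/andP; rewrite !inE/=; split.
  apply: measurableT_comp => //; exact: measurable_translate.
move: nf; rewrite /finite_norm unlock !integral_sqrE.
rewrite (@ge0_integral_translate _ _ y (fun x => (f x ^+ 2)%:E))//.
  exact/measurable_EFinP/measurable_funX.
by move=> x; rewrite lee_fin sqr_ge0.
Qed.

Definition tr y f : H := toL2 mu (translate y f).

Lemma trE y f : tr y f = translate y f :> (V -> R).
Proof. by rewrite toL2K// translate_L2// LfunP. Qed.

Lemma toL2_translate y (f : V -> R) : f \in Lfun mu 2%:E ->
  toL2 mu (translate y f) = tr y (toL2 mu f).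
Proof. by move=> f2; apply/LfuneqP => x; rewrite trE !toL2K// translate_L2. Qed.

Lemma trD y f g : tr y (f + g) = tr y f + tr y g.
Proof.
apply/LfuneqP => x; rewrite trE.
by rewrite -[RHS]/((tr y f : V -> R) x + (tr y g : V -> R) x) !trE.
Qed.

Lemma trZ y c f : tr y (c *: f) = c *: tr y f.
Proof.
by apply/LfuneqP => x; rewrite trE -[RHS]/(c * (tr y f : V -> R) x) !trE.
Qed.

Lemma trB y f g : tr y (f - g) = tr y f - tr y g.
Proof. by rewrite trD -scaleN1r trZ scaleN1r. Qed.

Lemma tr_tr y z f : tr y (tr z f) = tr (y + z) f.
Proof.
by apply/LfuneqP => x; rewrite trE /translate !trE /translate opprD addrA.
Qed.

Lemma tr0 f : tr 0 f = f.
Proof. by apply/LfuneqP => x; rewrite trE /translate subr0. Qed.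

Lemma dot_tr y f g : dot (tr y f) (tr y g) = dot f g.
Proof.
rewrite /dot /Rintegral; congr fine; rewrite !trE.
by have [_] := integral_translate y (integrable_dot f g).
Qed.

Lemma dot_trl y f g : dot (tr y f) g = dot f (tr (- y) g).
Proof. by rewrite -[LHS](dot_tr (- y)) tr_tr addNr tr0. Qed.

Lemma nrm_tr y f : nrm (tr y f) = nrm f.
Proof.
by apply/eqP; rewrite -(@eqrXn2 _ 2) ?nrm_ge0// !nrm_sqr dot_tr.
Qed.

(** By density, one factor of [dot f f] may be replaced by a test function. Estimates that are
    available only against test functions, as for weak derivatives, thereby become norm
    estimates. *)
Lemma nrm_le_dual f K : 0 <= K ->
  (forall phi : H, test_function phi -> `|dot f phi| <= K * nrm phi) -> nrm f <= K.
Proof.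
move=> K0 fK; have [->|f0] := eqVneq (nrm f) 0; first by [].
have {}f0 : 0 < nrm f by rewrite lt0r f0 nrm_ge0.
rewrite -(ler_pM2r f0) -expr2 nrm_sqr; apply/ler_addgt0Pr => e e0.
have fK0 : 0 < nrm f + K by rewrite ltr_wpDr.
have [phi tphi fphi] := test_dense f (divr_gt0 e0 fK0).
have -> : dot f f = dot f (f - phi) + dot f phi by rewrite -dotDr subrK.
have phif : nrm phi <= nrm f + nrm (f - phi).
  by rewrite -[X in nrm X <= _](subKr f) (le_trans (nrmD _ _))// nrmN.
move: fphi; rewrite ltr_pdivlMr// => fphi.
have := le_trans (ler_norm _) (dot_le f (f - phi)).
have := le_trans (ler_norm _) (fK _ tphi).
have := ler_wpM2l K0 phif.
move: (nrm_ge0 (f - phi)) fphi; nra.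
Qed.

(** Dominated convergence speaks of sequences; a failure at all radii [1/(k+1)] would produce a
    sequence contradicting it. [P] allows a restriction to nonzero increments. *)
Lemma seq_eps_delta (W : normedModType R) (P : W -> Prop) (F : W -> R) :
  (forall y_ : nat -> W, (forall k, P (y_ k)) -> (forall k, `|y_ k| < k.+1%:R^-1) ->
     F (y_ k) @[k --> \oo] --> (0 : R)) ->
  forall e, 0 < e -> exists2 r, 0 < r & forall w, P w -> `|w| < r -> F w < e.
Proof.
move=> F0 e e0; apply: contrapT => nr.
have y_ k : exists w, [/\ P w, `|w| < k.+1%:R^-1 & e <= F w].
  apply: contrapT => ny; apply: nr; exists k.+1%:R^-1; first by rewrite invr_gt0.
  by move=> w Pw wk; rewrite ltNge; apply/negP => eF; apply: ny; exists w.
have [u uP] := choice y_.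
have := F0 u (fun k => let: And3 a _ _ := uP k in a) (fun k => let: And3 _ b _ := uP k in b).
move=> /cvgrPdist_lt/(_ _ e0)[k _ /(_ k (leqnn k))].
rewrite sub0r normrN => /(le_lt_trans (ler_norm _)); rewrite ltNge.
by case: (uP k) => _ _ ->.
Qed.

Lemma seq_cvg0 (W : normedModType R) (y_ : nat -> W) :
  (forall k, `|y_ k| < k.+1%:R^-1) -> y_ @ \oo --> (0 : W).
Proof.
move=> y0; apply/cvgr0Pnorm_lt => e e0.
have /cvgrPdist_lt/(_ _ e0) := @cvg_harmonic R; apply: filterS => k.
rewrite sub0r normrN ger0_norm ?invr_ge0//; exact: lt_trans.
Qed.

Lemma test_dominated (phi : V -> R) : test_function phi -> exists g : H,
  forall y, `|y| <= 1 -> forall x, `|phi (x - y)| <= `|(g : V -> R) x|.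
Proof.
move=> tphi; have [M M0 phiM] := test_function_bounded tphi.
(* Widening the cube by [1] covers all the translates at once. *)
exists (toL2 mu (fun x : V => M * \1_(cube (M + 1)) x)) => y y1 x.
rewrite toL2K ?scaled_cube_L2//.
apply: le_trans (phiM _) _; rewrite !normrM ler_wpM2l// !indicE.
case: (boolP (x - y \in cube M)) => [|_]; last by rewrite normr0.
move=> /set_mem/(cubeE _ M0) xyM; rewrite mem_set//; apply/(cubeE _ (addr_ge0 M0 ler01)).
by rewrite -(subrK y x) (le_trans (ler_normD _ _))// lerD.
Qed.

(** For a test function this is dominated convergence. Density and the isometry of translations
    extend it, with a third of [e] for each of the three errors. *)
Lemma tr_continuous f e : 0 < e ->
  exists2 r, 0 < r & forall y, `|y| < r -> nrm (tr y f - f) < e.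
Proof.
move=> e0; have e30 : 0 < e / 3 by rewrite divr_gt0.
have [phi tphi fphi] := test_dense f e30.
suff [r r0 rphi] : exists2 r, 0 < r & forall y, True -> `|y| < r -> nrm (tr y phi - phi) < e / 3.
  exists r => // y /(rphi _ I) yphi.
  have -> : tr y f - f = tr y (f - phi) + (tr y phi - phi) + (phi - f).
    by rewrite trB !subrKA.
  apply: le_lt_trans (nrmD _ _) _; rewrite (nrmB phi f).
  apply: le_lt_trans (lerD (nrmD _ _) (lexx _)) _; rewrite nrm_tr.
  by move: fphi yphi => /=; lra.
apply: (@seq_eps_delta V (fun=> True) (fun y => nrm (tr y phi - phi))) => // y_ _ y0.
have [g phig] := test_dominated tphi.
apply: (@L2_dominated _ _ _ _ _ _ g) => [x|k x].
  under eq_fun do rewrite trE /translate.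
  have c := cdiff_continuous (tphi.1 0%N).
  apply: (@cvg_comp _ _ _ (fun k => x - y_ k) phi); last exact: c.
  by have := cvgB (cvg_cst x) (seq_cvg0 y0); rewrite subr0; exact.
rewrite trE; apply: phig; apply: le_trans (ltW (y0 k)) _.
by rewrite invf_le1 ?ler1n.
Qed.

Lemma tr_orthogonal f g e : 0 < e -> exists2 L, 0 < L &
  forall a b, L < `|a - b| -> `|dot (tr a f) (tr b g)| < e.
Proof.
move=> e0.
have f0 : 0 < e / 2 / (nrm g + 1) by rewrite !divr_gt0// ltr_wpDl ?nrm_ge0.
have [phi tphi fphi] := test_dense f f0.
(* [psi] is chosen after [phi], because its error is multiplied by the norm of [phi]. *)
have p0 : 0 < e / 2 / (nrm phi + 1) by rewrite !divr_gt0// ltr_wpDl ?nrm_ge0.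
have [psi tpsi gpsi] := test_dense g p0.
have [_ [M phiM]] := (test_functionP _).1 tphi; have [_ [N psiN]] := (test_functionP _).1 tpsi.
exists (Num.max 1 (M + N)) => [|a b]; first by rewrite lt_max ltr01.
rewrite gt_max => /andP[_ MN].
have z : dot (tr a phi) (tr b psi) = 0.
  rewrite /dot /Rintegral integral0_eq// => x _; rewrite !trE /translate.
  have [->|/phiM xa] := eqVneq ((phi : V -> R) (x - a)) 0; first by rewrite mul0r.
  have [->|/psiN xb] := eqVneq ((psi : V -> R) (x - b)) 0; first by rewrite mulr0.
  suff : `|a - b| <= M + N by rewrite leNgt MN.
  rewrite -(subrKA x) (le_trans (ler_normD _ _))// lerD//; first by rewrite distrC.
have -> : dot (tr a f) (tr b g) = dot (tr a (f - phi)) (tr b g) + dot (tr a phi) (tr b (g - psi)).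
  by rewrite !trB dotBl dotBr z subr0 subrK.
apply: le_lt_trans (ler_normD _ _) _.
apply: le_lt_trans (lerD (dot_le _ _) (dot_le _ _)) _; rewrite !nrm_tr (splitr e).
have gg := nrm_ge0 g; have pp := nrm_ge0 phi.
apply: ltrD.
  move: fphi; rewrite ltr_pdivlMr ?ltr_wpDl//; apply: le_lt_trans.
  by rewrite ler_wpM2l ?nrm_ge0// lerDl.
move: gpsi; rewrite ltr_pdivlMr ?ltr_wpDl//; apply: le_lt_trans.
by rewrite mulrC ler_wpM2l ?nrm_ge0// lerDl.
Qed.

End translation_L2.

(** * Weak derivatives as limits of difference quotients of translations *)

Section weak_derivative.
Context {R : realType}.

Lemma MVT0 (F dF : R -> R) t : (forall s, is_derive s (1 : R) F (dF s)) ->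
  exists2 c, `|c| <= `|t| & F t - F 0 = dF c * t.
Proof.
move=> FdF; have cF a b : {within `[a, b], continuous F}.
  apply: continuous_subspaceT => s; apply/differentiable_continuous/derivable1_diffP.
  by case: (FdF s).
have [t0|t0] := leP 0 t.
  have [c] := @MVT_segment R F dF 0 t t0 (fun s _ => FdF s) (cF _ _).
  by rewrite in_itv/= subr0 => /andP[c0 ct] E; exists c => //; rewrite !ger0_norm.
have [c] := @MVT_segment R F dF t 0 (ltW t0) (fun s _ => FdF s) (cF _ _).
rewrite in_itv/= sub0r => /andP[tc c0] E; exists c;
    first by rewrite (ler0_norm c0) (ler0_norm (ltW t0)) lerN2.
by rewrite -opprB E mulrN opprK.
Qed.

Context {n : nat}.
Local Notation V := 'rV[R]_n.
Local Notation mu := (@lebesgue_rV R n).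
Local Notation H := (LfunType mu (@lee1n R 2)).
Implicit Types (f g h : H) (y z : V).
Local Notation e_ k := (delta_mx ord0 k : V).

Lemma test_diff_quot k (phi : H) e : test_function phi -> 0 < e ->
  exists2 r, 0 < r & forall t, t != 0 -> `|t| < r ->
    nrm (t^-1 *: (tr (- (t *: e_ k)) phi - phi) - toL2 mu (pderiv k phi)) < e.
Proof.
move=> tphi e0; have tdphi := test_function_pderiv k tphi.
have dphi2 := test_function_L2 tdphi.
have qE t x : (t^-1 *: (tr (- (t *: e_ k)) phi - phi) : H) x =
    t^-1 * ((phi : V -> R) (t *: e_ k + x) - (phi : V -> R) x) :> R.
  rewrite -[LHS]/(t^-1 * ((tr (- (t *: e_ k)) phi : V -> R) x - (phi : V -> R) x)).
  by rewrite trE /translate opprK [x + _]addrC.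
have dphi s x : is_derive s (1 : R) (fun s => (phi : V -> R) (s *: e_ k + x))
    (pderiv k phi (s *: e_ k + x)).
  by apply/is_derive_line; apply: DeriveDef => //; exact: test_function_derivable.
apply: (@seq_eps_delta R R (fun t => t != 0) (fun t =>
  nrm (t^-1 *: (tr (- (t *: e_ k)) phi - phi) - toL2 mu (pderiv k phi)))) => // t_ tn0 t0.
have [g dg] := test_dominated tdphi.
apply: (@L2_dominated _ _ _ _ (fun j => (t_ j)^-1 *: (tr (- (t_ j *: e_ k)) phi - phi))
  _ g) => [x|j x].
  under eq_fun do rewrite qE; rewrite toL2K//.
  have t_0 : t_ @ \oo --> (0 : R)^'.
    move=> A A0; have h : \forall j \near \oo, t_ j != 0 -> A (t_ j) := seq_cvg0 t0 A0.
    by rewrite nbhs_filterE; apply: filterS h => j; apply; exact: tn0.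
  have hd : (fun h : R => h^-1 *: (((phi : V -> R) \o shift x) (h *: e_ k) - (phi : V -> R) x))
      @ (0 : R)^' --> pderiv k phi x by exact: test_function_derivable.
  exact: (cvg_comp _ _ t_0 hd).
rewrite qE.
(* The quotient is a value of the derivative at a point shifted by at most [1], so the majorant of
   the translates of the derivative dominates it. *)
have [c ct] := MVT0 (t_ j) (fun s => dphi s x); rewrite scale0r add0r => ->.
rewrite mulrC mulfK// -[c *: _ + x]addrC -[c *: e_ k]opprK; apply: dg.
rewrite normrN normrZ; apply: le_trans (_ : `|c| * 1 <= 1).
  rewrite ler_wpM2l//; apply: mx_norm_le => // i l; rewrite mxE.
  by case: (_ && _); rewrite ?normr1 ?normr0.
rewrite mulr1; apply: le_trans ct _; apply: le_trans (ltW (t0 j)) _.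
by rewrite invf_le1 ?ler1n.
Qed.

Lemma L2dotE f g : L2dot f g = dot f g. Proof. by []. Qed.

(** The translation is moved onto [phi], whose difference quotients converge in L2; the definition
    of the weak derivative then brings [h] in. *)
Lemma is_derive_dot_tr k f h (phi : H) t : weak_pderiv k f h -> test_function phi ->
  is_derive t (1 : R) (fun s => dot (tr (s *: e_ k) f) phi) (- dot (tr (t *: e_ k) h) phi).
Proof.
move=> fh tphi; have dphi2 := test_function_L2 (test_function_pderiv k tphi).
have -> : - dot (tr (t *: e_ k) h) phi = dot (tr (t *: e_ k) f) (toL2 mu (pderiv k phi)).
  rewrite !dot_trl -toL2_translate//.
  have /fh := test_function_translate (- (t *: e_ k)) tphi.
  rewrite pderiv_translate; last by move=> x; exact: test_function_derivable.
  rewrite -{1}[translate _ (pderiv k phi)](toL2K (mu := mu)) ?translate_L2//.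
  by rewrite -[translate _ phi]trE !L2dotE => ->.
suff c : (fun s : R => s^-1 *: (((fun s => dot (tr (s *: e_ k) f) phi) \o shift t) (s *: 1)
    - dot (tr (t *: e_ k) f) phi)) @ 0^' --> dot (tr (t *: e_ k) f) (toL2 mu (pderiv k phi)).
  by apply: DeriveDef; [apply/cvg_ex; eexists; exact: c|exact: cvg_lim c].
apply/cvgrPdist_lt => e e0; set F := tr (t *: e_ k) f.
have F0 : 0 < nrm F + 1 by rewrite ltr_wpDl ?nrm_ge0.
have [r r0 q] := test_diff_quot k tphi (divr_gt0 e0 F0).
near=> s.
have s0 : s != 0 by near: s; exact: nbhs_dnbhs_neq.
have sr : `|s| < r by near: s; exact: dnbhs0_lt.
rewrite -[X in `|_ - X|]/(s^-1 * (dot (tr ((s * 1 + t) *: e_ k) f) phi - dot F phi)).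
rewrite mulr1 scalerDl -tr_tr dot_trl -/F -dotBr -dotZr -dotBr.
apply: le_lt_trans (dot_le _ _) _; rewrite nrmB.
have := q s s0 sr; rewrite ltr_pdivlMr//; apply: le_lt_trans.
by rewrite mulrC ler_wpM2l ?nrm_ge0// lerDl.
Unshelve. all: by end_near. Qed.

(** Tested against [phi], the remainder is an increment of the scalar function [F], whose derivative
    at [c] is [- dot (tr (c *: e_ k) h - h) phi]. The mean value theorem bounds it, and duality
    removes [phi]. *)
Lemma weak_diff_quot k f h t s : weak_pderiv k f h ->
  (forall c, `|c| <= `|t| -> nrm (tr (c *: e_ k) h - h) <= s) ->
  nrm (tr (t *: e_ k) f - f + t *: h) <= `|t| * s.
Proof.
move=> fh hs; have s0 : 0 <= s by apply: le_trans (hs t _) => //; exact: nrm_ge0.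
apply: nrm_le_dual => [|phi tphi]; first by rewrite mulr_ge0.
pose F c := dot (tr (c *: e_ k) f) phi + c * dot h phi.
have dF c : is_derive c (1 : R) F (- dot (tr (c *: e_ k) h) phi + dot h phi).
  apply: is_deriveD; first exact: is_derive_dot_tr.
  have := is_deriveM (is_derive_id c (1 : R)) (is_derive_cst (dot h phi) c (1 : R)).
  by rewrite scaler0 add0r /GRing.scale/= mulr1.
have [c ct] := MVT0 t dF.
rewrite /F scale0r tr0 mul0r addr0 => E.
have -> : dot (tr (t *: e_ k) f - f + t *: h) phi = - dot (tr (c *: e_ k) h - h) phi * t.
  by rewrite dotDl !dotBl dotZl opprB [in RHS]addrC -E; ring.
rewrite normrM normrN mulrC -mulrA ler_wpM2l//.
by apply: le_trans (dot_le _ _) _; rewrite ler_wpM2r ?nrm_ge0// hs.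
Qed.

Lemma weak_pderiv_unique k (f : V -> R) g g' :
  weak_pderiv k f g -> weak_pderiv k f g' -> nrm (g - g') = 0.
Proof.
move=> fg fg'; apply/eqP; rewrite eq_le nrm_ge0 andbT; apply: nrm_le_dual => // phi tphi.
have /oppr_inj E : - dot g phi = - dot g' phi by rewrite -!L2dotE -fg// -fg'.
by rewrite mul0r dotBl E subrr normr0.
Qed.

Lemma weak_pderiv_ball k f h e : weak_pderiv k f h -> 0 < e ->
  exists2 r, 0 < r & forall t, `|t| < r -> nrm (tr (t *: e_ k) f - f + t *: h) <= e * `|t|.
Proof.
move=> fh e0; have [r r0 hr] := tr_continuous h e0.
exists r => // t tr_; rewrite mulrC; apply: weak_diff_quot => // c ct; apply/ltW/hr.
have : `|e_ k| <= 1.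
  by apply: mx_norm_le => // i l; rewrite mxE; case: (_ && _); rewrite ?normr1 ?normr0.
move=> ek; rewrite normrZ; apply: le_lt_trans tr_; apply: le_trans ct.
by rewrite -[leRHS]mulr1 ler_wpM2l.
Qed.

Lemma weak_pderiv_lipschitz k f h t : weak_pderiv k f h ->
  nrm (tr (t *: e_ k) f - f) <= `|t| * (3 * nrm h).
Proof.
move=> fh; have -> : tr (t *: e_ k) f - f = (tr (t *: e_ k) f - f + t *: h) - t *: h.
  by rewrite addrK.
apply: le_trans (nrmD _ _) _; rewrite nrmN nrmZ.
(* [2 * nrm h] bounds the oscillation of [h] under translations of any size. *)
have : nrm (tr (t *: e_ k) f - f + t *: h) <= `|t| * (2 * nrm h).
  apply: weak_diff_quot => // c _; apply: le_trans (nrmD _ _) _.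
  by rewrite nrmN nrm_tr mulr_natl mulr2n.
by move=> H1; apply: le_trans (lerD H1 (lexx _)) _; lra.
Qed.

(* [f] is equal to all of its translates along [e_ k], hence orthogonal to
   itself. *)
Lemma weak_pderiv_eq0 k f h : weak_pderiv k f h -> nrm h = 0 -> nrm f = 0.
Proof.
move=> fh h0; have tf t : nrm (tr (t *: e_ k) f - f) = 0.
  by apply/eqP; rewrite eq_le nrm_ge0 andbT (le_trans (weak_pderiv_lipschitz t fh))// h0 !mulr0.
apply/eqP; rewrite -sqrf_eq0 nrm_sqr; apply/negP => /negP/eqP f0.
have {}f0 : 0 < dot f f by rewrite -nrm_sqr lt0r sqr_ge0 nrm_sqr andbT; apply/eqP.
have [L L0 fL] := tr_orthogonal f f f0.
pose t := L + 1; have := fL (t *: e_ k) 0.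
have ek : `|t| <= `|t *: e_ k - 0|.
  by have := coord_le_norm (t *: e_ k - 0) ord0 k; rewrite subr0 !mxE !eqxx mulr1.
have t0 : 0 <= t by rewrite addr_ge0 ?ltW.
rewrite (lt_le_trans _ ek) => [/(_ isT)|]; last by rewrite ger0_norm// ltrDl.
rewrite tr0; have -> : dot (tr (t *: e_ k) f) f = dot f f.
  apply/eqP; rewrite -subr_eq0 -dotBl -normr_eq0 eq_le normr_ge0 andbT.
  by apply: le_trans (dot_le _ _) _; rewrite tf mul0r.
by rewrite ger0_norm ?ltxx// ltW.
Qed.

(** Were [f x] nonzero, [f] would be nonzero on a box around [x], and such a box has positive
    measure. *)
Lemma continuous_ae0 (f : V -> R) : continuous f -> ae_eq mu setT f (cst 0) -> forall x, f x = 0.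
Proof.
move=> cf [N [mN N0 fN]] x; apply: contrapT => /eqP fx0.
have : \forall y \near x, f y != 0 by exact: cvgr_neq0 (cf x) fx0.
move=> /nbhs_ballP[r /= r0 xr].
pose I (i : 'I_n) := `](x ord0 i - r / 2), (x ord0 i + r / 2)[%classic.
have mI i : measurable (I i) by exact: measurable_itv.
have IN : box I `<=` N.
  move=> y Iy; apply: fN => /= fy0.
  have : `|x - y| <= r / 2.
    apply: mx_norm_le => [|i j]; first by rewrite divr_ge0// ltW.
    by rewrite ord1 !mxE; have := Iy j; rewrite /I/= in_itv/= -ltr_distl distrC => /ltW.
  move=> xy; have : ball x r y.
    rewrite -ball_normE /=; apply: le_lt_trans xy _.
    by rewrite ltr_pdivrMr// ltr_pMr// ltr1n.
  by move=> /xr; rewrite fy0// eqxx.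
have muN : mu N = 0%E := N0.
have : (mu (box I) <= mu N)%E by apply: le_measure => //; rewrite inE//; exact: measurable_box.
rewrite muN lebesgue_box// leNgt => /negP; apply.
have -> : (\prod_(i < n) lebesgue_measure (I i) = \prod_(i < n) r%:E)%E.
  apply: eq_bigr => i _; rewrite lebesgue_measure_itv/= lte_fin ifT.
    rewrite -EFinD; congr EFin; lra.
  by move: r0; move: (x ord0 i) => t; lra.
by elim/big_ind: _ => // a b a0 b0; exact: mule_gt0.
Qed.

(* The difference quotients converge to [h] in L2 and to [pderiv k f]
   pointwise, and Fatou's lemma identifies the limits. *)
Lemma pderiv_weak k f h : (forall x, derivable (f : V -> R) x (e_ k)) ->
  weak_pderiv k f h -> pderiv k f \in Lfun mu 2%:E /\ ae_eq mu setT (pderiv k f) h.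
Proof.
move=> df fh; pose t_ j : R := j.+1%:R^-1.
have t0 j : 0 < t_ j by rewrite invr_gt0.
pose D j : H := (t_ j)^-1 *: (tr (- (t_ j *: e_ k)) f - f).
have DE j x : (D j : V -> R) x = (t_ j)^-1 * ((f : V -> R) (t_ j *: e_ k + x) - (f : V -> R) x).
  rewrite -[LHS]/((t_ j)^-1 * ((tr (- (t_ j *: e_ k)) f : V -> R) x - (f : V -> R) x)).
  by rewrite trE /translate opprK [x + _]addrC.
have Dcvg x : (D j : V -> R) x @[j --> \oo] --> pderiv k f x.
  under eq_fun do rewrite DE.
  have t_0 : t_ @ \oo --> (0 : R)^'.
    move=> A A0; have h' : \forall j \near \oo, t_ j != 0 -> A (t_ j) := @cvg_harmonic R _ A0.
    by rewrite nbhs_filterE; apply: filterS h' => j; apply; rewrite lt0r_neq0.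
  have hd : (fun h : R => h^-1 *: (((f : V -> R) \o shift x) (h *: e_ k) - (f : V -> R) x))
      @ (0 : R)^' --> pderiv k f x by exact: df.
  exact: (cvg_comp _ _ t_0 hd).
have Dh : nrm (D j - h) @[j --> \oo] --> (0 : R).
  apply/cvgrPdist_le => e e0; have [r r0 fr] := weak_pderiv_ball fh e0.
  have /cvgrPdist_lt/(_ _ r0) := @cvg_harmonic R; apply: filterS => j.
  rewrite sub0r normrN -/(t_ j) => tr_; rewrite sub0r normrN ger0_norm ?nrm_ge0//.
  have := fr (- t_ j); rewrite normrN => /(_ tr_); rewrite (gtr0_norm (t0 j)) => fj.
  rewrite -(ler_pM2r (t0 j)) -[t_ j in X in X <= _](gtr0_norm (t0 j)) mulrC -nrmZ.
  rewrite scalerBr scalerA mulfV ?lt0r_neq0// scale1r.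
  by move: fj; rewrite !scaleNr.
pose d x : R := pderiv k f x - (h : V -> R) x.
have mp : measurable_fun setT (pderiv k f).
  apply: (@measurable_fun_cvg _ _ _ setT (fun j => D j : V -> R)) => [j|x _].
    exact: measurable_L2.
  exact: Dcvg.
have md : measurable_fun setT d by apply: measurable_funB => //; exact: measurable_L2.
have d0 : (\int[mu]_x (d x ^+ 2)%:E <= 0)%E.
  pose q j x := (((D j - h : H) : V -> R) x ^+ 2)%:E.
  have -> : (\int[mu]_x (d x ^+ 2)%:E = \int[mu]_x limn_einf (q ^~ x))%E.
    apply: eq_integral => x _; suff /cvg_limn_einf_sup[->] : q ^~ x @ \oo --> (d x ^+ 2)%:E by [].
    apply: cvg_EFin; first exact: nearW.
    have dx : (D j - h : H) x @[j --> \oo] --> d x.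
      by have := cvgB (Dcvg x) (cvg_cst ((h : V -> R) x)); exact.
    exact: (cvgM dx dx).
  apply: le_trans (fatou _ _ _ _) _ => //.
  - move=> j; apply/measurable_EFinP/measurable_funX; exact: measurable_L2.
  - by move=> j x _; rewrite lee_fin sqr_ge0.
  have qE j : (\int[mu]_x q j x)%E = (nrm (D j - h) ^+ 2)%:E.
    rewrite nrm_sqr /dot /Rintegral fineK//; apply: integrable_fin_num => //.
    exact: integrable_dot.
  under eq_fun do rewrite qE.
  suff /cvg_limn_einf_sup[-> _] : (nrm (D j - h) ^+ 2)%:E @[j --> \oo] --> 0%E by [].
  apply: cvg_EFin; first exact: nearW.
  by have := cvgM Dh Dh; rewrite mulr0; exact.
have d2 : d \in Lfun mu 2%:E.
  apply/andP; rewrite !inE/=; split=> //.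
  rewrite /finite_norm unlock integral_sqrE poweR_lty//.
  by apply: le_lt_trans d0 _.
have nd : nrm (toL2 mu d) = 0.
  apply/eqP; rewrite -sqrf_eq0 nrm_sqr -[dot _ _]/(fine _) fine_eq0; last first.
    by apply: integrable_fin_num => //; exact: integrable_dot.
  rewrite eq_le integral_ge0 ?andbT => [|x _]; last by rewrite lee_fin -expr2 sqr_ge0.
  by rewrite toL2K.
have p2 : pderiv k f \in Lfun mu 2%:E.
  have -> : pderiv k f = (toL2 mu d + h : H) :> (V -> R).
    by apply/funext => x; rewrite -[RHS]/((toL2 mu d : V -> R) x + (h : V -> R) x) toL2K// /d subrK.
  exact: LfunP.
split => //; apply: filterS (nrm0_ae nd) => x /(_ I) + _; rewrite toL2K// /d => /eqP.
by rewrite subr_eq0 => /eqP.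
Qed.

End weak_derivative.

(** * The implicit function theorem with uniform constants *)

(* Joins the existing structures on ['rV[R]_n] into a completeNormedModType. *)
HB.instance Definition _ (R : realType) (n : nat) := Complete.on 'rV[R]_n.

Section implicit_function.
Context {R : realType}.

Lemma half_contraction_fixed_point (W : completeNormedModType R) (U : set W) (f : W -> W) :
  closed U -> U !=set0 -> (forall x, U x -> U (f x)) ->
  (forall x y, U x -> U y -> `|f x - f y| <= `|x - y| / 2) ->
  exists2 p, U p & f p = p.
Proof.
move=> cU U0 fU fc.
pose F : {fun U >-> U} := mkfun fU.
have cF : is_contraction F.
  exists (2^-1)%:nng; split; first by rewrite /= invf_lt1// ltr1n.
  by move=> [x y] [/= Ux Uy]; rewrite mulrC; exact: fc.
by have [p Up pE] := banach_fixed_point cF cU U0; exists p.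
Qed.

Context {N : nat} {X : lmodType R}.
Local Notation P := 'rV[R]_N.
(** The equation [G x p = 0] is affine in the datum [x], with linear part [B p], and has derivative
    [M x p] in the unknown [p]. It is solved in the ball of radius [rho] around [c x], where [Mid]
    keeps that derivative within one half of the identity. [X] carries no topology: smallness in [x]
    is measured by [nx], a seminorm in the application. *)
Variables (nx : X -> R) (Dom : X -> Prop) (G : X -> P -> P) (B : P -> X -> P)
  (M : X -> P -> P -> P) (c : X -> P) (rho K : R).
Hypothesis nx_ge0 : forall x, 0 <= nx x.
Hypothesis rho_gt0 : 0 < rho.
Hypothesis K_ge0 : 0 <= K.
Hypothesis GB : forall x h p, G (x + h) p = G x p + B p h.
Hypothesis Blin : forall p a h1 h2, B p (a *: h1 + h2) = a *: B p h1 + B p h2.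
Hypothesis Bbound : forall p h, `|B p h| <= K * nx h.
Hypothesis Bcont : forall p e, 0 < e -> exists2 r, 0 < r &
  forall p', `|p' - p| < r -> forall h, `|B p' h - B p h| <= e * nx h.
Hypothesis Mlin : forall x p a w1 w2, M x p (a *: w1 + w2) = a *: M x p w1 + M x p w2.
Hypothesis Mdiff : forall x p e, 0 < e -> exists2 r, 0 < r &
  forall w, `|w| < r -> `|G x (p + w) - G x p - M x p w| <= e * `|w|.
Hypothesis Mcont : forall x p e, 0 < e -> exists2 r, 0 < r &
  forall x' p', nx (x' - x) < r -> `|p' - p| < r ->
  forall w, `|M x' p' w - M x p w| <= e * `|w|.
Hypothesis Mid : forall x p, Dom x -> `|p - c x| <= rho ->
  forall w, `|w - M x p w| <= `|w| / 2.
Hypothesis Gc : forall x, Dom x -> `|G x (c x)| <= rho / 4.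
Hypothesis c_lip : forall x x', `|c x' - c x| <= nx (x' - x).

Let M0 x p : M x p 0 = 0.
Proof. by have := Mlin x p (-1) 0 0; rewrite scaler0 addr0 scaleN1r addNr. Qed.

Let MZ x p a w : M x p (a *: w) = a *: M x p w.
Proof. by rewrite -[a *: w]addr0 Mlin M0 addr0. Qed.

Let MB x p (w w' : P) : M x p (w - w') = M x p w - M x p w'.
Proof. by rewrite addrC -scaleN1r Mlin scaleN1r addrC. Qed.

(** A scalar statement, because the mean value theorem will be applied to one coordinate at a time;
    in the sup norm this loses no constant. *)
Lemma is_derive_M x (p w : P) (t : R) (j : 'I_N) : is_derive t (1 : R)
  (fun s : R => (p + s *: w) ord0 j - G x (p + s *: w) ord0 j)
  ((w - M x (p + t *: w) w) ord0 j).
Proof.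
set F := fun s : R => _.
suff h : (fun h : R => h^-1 *: ((F \o shift t) (h *: 1) - F t)) @ (0 : R)^'
    --> (w - M x (p + t *: w) w) ord0 j.
  by apply: DeriveDef; [apply/cvg_ex; eexists; exact: h|exact: cvg_lim h].
apply/cvgrPdist_le => e e0.
have w0 : 0 < `|w| + 1 by rewrite ltr_wpDl.
have [r r0 Mr] := Mdiff x (p + t *: w) (divr_gt0 e0 w0).
near=> h.
have h0 : h != 0 by near: h; exact: nbhs_dnbhs_neq.
have hr : `|h| < r / (`|w| + 1) by near: h; apply: dnbhs0_lt; rewrite divr_gt0.
have hw : `|h *: w| < r.
  rewrite normrZ; move: hr; rewrite ltr_pdivlMr//; apply: le_lt_trans.
  by rewrite ler_wpM2l// lerDl.
have -> : (w - M x (p + t *: w) w) ord0 j - h^-1 *: ((F \o shift t) (h *: 1) - F t) =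
    h^-1 * (G x (p + t *: w + h *: w) - G x (p + t *: w) - M x (p + t *: w) (h *: w)) ord0 j.
  rewrite -[h^-1 *: _]/(h^-1 * (F (h * 1 + t) - F t)) /F MZ mulr1.
  have -> : p + (h + t) *: w = p + t *: w + h *: w by rewrite scalerDl addrA addrAC.
  by rewrite !mxE; field.
rewrite normrM normfV; rewrite -ler_pdivlMl ?invr_gt0 ?normr_gt0// invrK.
apply: le_trans (coord_le_norm _ _ _) _; apply: le_trans (Mr _ hw) _.
rewrite normrZ mulrCA ler_wpM2l// mulrAC ler_pdivrMr// ler_wpM2l ?ltW//.
by rewrite ltrDl.
Unshelve. all: by end_near. Qed.

Lemma G_contraction x (p p' : P) : Dom x -> `|p - c x| <= rho -> `|p' - c x| <= rho ->
  `|p' - G x p' - (p - G x p)| <= `|p' - p| / 2.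
Proof.
move=> Dx px p'x; pose w := p' - p.
apply: mx_norm_le => [|i j]; first by rewrite divr_ge0.
rewrite ord1 {i}; set F := fun s : R => (p + s *: w) ord0 j - G x (p + s *: w) ord0 j.
have cF : {within `[0, 1], continuous F}.
  apply: continuous_subspaceT => s; apply/differentiable_continuous/derivable1_diffP.
  by case: (is_derive_M x p w s j).
have [t] := @MVT_segment R F _ 0 1 ler01 (fun s _ => is_derive_M x p w s j) cF.
rewrite in_itv/= => /andP[t0 t1].
have -> : F 1 - F 0 = (p' - G x p' - (p - G x p)) ord0 j.
  by rewrite /F scale1r scale0r addr0 /w [p + _]addrC subrK !mxE.
rewrite subr0 mulr1 => ->; apply: le_trans (coord_le_norm _ _ _) _.
apply: Mid => //.
(* The ball is convex, so the segment from [p] to [p'] stays where [Mid] applies. *)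
have -> : p + t *: w - c x = (1 - t) *: (p - c x) + t *: (p' - c x).
  by apply/rowP => i; rewrite !mxE; ring.
apply: le_trans (ler_normD _ _) _; rewrite !normrZ !ger0_norm// ?subr_ge0//.
have -> : rho = (1 - t) * rho + t * rho by ring.
by rewrite lerD// ler_wpM2l// subr_ge0.
Qed.

(** The map [p - G x p] sends the ball of radius [rho / 2] to itself, since
    [(rho / 2) / 2 + rho / 4 = rho / 2]. Uniqueness will hold up to [rho], and this margin absorbs a
    change of the centre [c x]. *)
Lemma implicit_exists x : Dom x ->
  exists p, `|p - c x| <= rho / 2 /\ G x p = 0.
Proof.
move=> Dx; have r20 : 0 < rho / 2 by rewrite divr_gt0.
have r2 : rho / 2 <= rho by rewrite ler_pdivrMr// ler_peMr ?ler1n// ltW.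
pose U := closed_ball (c x) (rho / 2).
have UE p : U p <-> `|p - c x| <= rho / 2.
  by rewrite /U closed_ballE// /closed_ball_/= distrC.
have [|||p p' Up Up'|p Up pE] := @half_contraction_fixed_point P U (fun p => p - G x p).
- exact: closed_ball_closed.
- by exists (c x); apply/UE; rewrite subrr normr0 ltW.
- move=> p /UE pc; apply/UE.
  have -> : p - G x p - c x = (p - G x p - (c x - G x (c x))) - G x (c x).
    by apply/rowP => i; rewrite !mxE; ring.
  apply: le_trans (ler_normB _ _) _.
  have H1 : `|p - G x p - (c x - G x (c x))| <= `|p - c x| / 2.
    apply: G_contraction => //; first by rewrite subrr normr0 ltW.
    exact: le_trans r2.
  by have := Gc Dx; move: H1 pc; lra.
- by apply: G_contraction => //; [move/UE: Up'|move/UE: Up] => h; exact: le_trans r2.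
exists p; split; first exact/UE.
by apply: oppr_inj; apply: (addrI p); rewrite pE oppr0 addr0.
Qed.

Definition implicit_fun x : P := xget 0 [set p | `|p - c x| <= rho / 2 /\ G x p = 0].

Lemma implicit_funP x : Dom x -> `|implicit_fun x - c x| <= rho / 2 /\ G x (implicit_fun x) = 0.
Proof.
move=> Dx; rewrite /implicit_fun; case: xgetP => [p _//|/(_ _)].
by have [p Hp /(_ p)] := implicit_exists Dx.
Qed.

(** [p] is the sum of [p - G x p], which contracts, and of [G x p], which must therefore expand.
    Uniqueness, the bound on the solution and its Lipschitz dependence all come from here. *)
Lemma G_expand x (p p' : P) : Dom x -> `|p - c x| <= rho -> `|p' - c x| <= rho ->
  `|p' - p| <= 2 * `|G x p' - G x p|.
Proof.
move=> Dx px p'x; have := G_contraction Dx px p'x.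
have -> : p' - p = (p' - G x p' - (p - G x p)) + (G x p' - G x p).
  by apply/rowP => i; rewrite !mxE; ring.
set a := p' - G x p' - (p - G x p); set b := G x p' - G x p.
by have := ler_normD a b; lra.
Qed.

Let implicit_fun_ball x : Dom x -> `|implicit_fun x - c x| <= rho.
Proof.
move=> Dx; apply: le_trans (implicit_funP Dx).1 _.
by rewrite ler_pdivrMr// ler_peMr ?ler1n// ltW.
Qed.

Lemma implicit_unique x (p : P) : Dom x -> `|p - c x| <= rho -> G x p = 0 -> p = implicit_fun x.
Proof.
move=> Dx px Gp; apply/eqP; rewrite -subr_eq0 -normr_eq0 eq_le normr_ge0 andbT.
by apply: le_trans (G_expand Dx (implicit_fun_ball Dx) px) _;
  rewrite Gp (implicit_funP Dx).2 subrr normr0 mulr0.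
Qed.

Lemma implicit_bound x : Dom x -> `|implicit_fun x - c x| <= 2 * `|G x (c x)|.
Proof.
move=> Dx; have cc : `|c x - c x| <= rho by rewrite subrr normr0 ltW.
by apply: le_trans (G_expand Dx cc (implicit_fun_ball Dx)) _; rewrite (implicit_funP Dx).2 sub0r normrN.
Qed.

(** The same fixed point theorem, for the affine map whose fixed points are the solutions [q]. *)
Lemma M_inverse x (p : P) w : Dom x -> `|p - c x| <= rho -> exists q, M x p q = w.
Proof.
move=> Dx px.
have [|||q q' _ _|q _ qE] := @half_contraction_fixed_point P setT (fun q => w + (q - M x p q)).
- exact: closedT.
- by exists 0.
- by [].
- have -> : w + (q - M x p q) - (w + (q' - M x p q')) = (q - q') - M x p (q - q').
    by rewrite MB; apply/rowP => i; rewrite !mxE; ring.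
  exact: Mid.
by exists q; apply/rowP => i; move/rowP/(_ i): qE; rewrite !mxE; lra.
Qed.

Lemma M_expand x (p : P) w : Dom x -> `|p - c x| <= rho -> `|w| <= 2 * `|M x p w|.
Proof.
move=> Dx px; have := Mid Dx px w; have := ler_normD (w - M x p w) (M x p w).
by rewrite subrK; lra.
Qed.

Definition Minv x p w : P := xget 0 [set q | M x p q = w].

Lemma MinvK x (p : P) w : Dom x -> `|p - c x| <= rho -> M x p (Minv x p w) = w.
Proof.
move=> Dx px; rewrite /Minv; case: xgetP => [q _//|].
by have [q Hq /(_ q)] := M_inverse w Dx px.
Qed.

Definition implicit_der x h : P := - Minv x (implicit_fun x) (B (implicit_fun x) h).

Let implicit_derM x h : Dom x -> M x (implicit_fun x) (implicit_der x h) = - B (implicit_fun x) h.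
Proof.
by move=> Dx; rewrite /implicit_der -scaleN1r MZ MinvK ?implicit_fun_ball// scaleN1r.
Qed.

Lemma implicit_der_linear x a h1 h2 : Dom x ->
  implicit_der x (a *: h1 + h2) = a *: implicit_der x h1 + implicit_der x h2.
Proof.
move=> Dx; apply/eqP; rewrite -subr_eq0 -normr_eq0 eq_le normr_ge0 andbT.
apply: le_trans (M_expand _ Dx (implicit_fun_ball Dx)) _.
by rewrite MB Mlin !implicit_derM// Blin scalerN opprD subrr normr0 mulr0.
Qed.

Lemma implicit_der_bound x h : Dom x -> `|implicit_der x h| <= 2 * K * nx h.
Proof.
move=> Dx; apply: le_trans (M_expand _ Dx (implicit_fun_ball Dx)) _.
by rewrite implicit_derM// normrN -mulrA ler_wpM2l.
Qed.

(** The solution for [x'] is tested in the equation for [x]: as [G] is affine in [x], the error is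
    [- B (implicit_fun x') (x' - x)]. The bound on [x' - x] keeps this solution in the ball around
    [c x]. *)
Lemma implicit_lipschitz x x' : Dom x -> Dom x' -> nx (x' - x) <= rho / 2 ->
  `|implicit_fun x' - implicit_fun x| <= 2 * K * nx (x' - x).
Proof.
move=> Dx Dx' xx'.
have sx' : `|implicit_fun x' - c x| <= rho.
  rewrite -(subrKA (c x')) (splitr rho) (le_trans (ler_normD _ _))// lerD//.
    exact: (implicit_funP Dx').1.
  exact: le_trans (c_lip _ _) _.
apply: le_trans (G_expand Dx (implicit_fun_ball Dx) sx') _.
rewrite (implicit_funP Dx).2 subr0 -mulrA ler_wpM2l//.
have := GB x (x' - x) (implicit_fun x'); rewrite [x + _]addrC subrK (implicit_funP Dx').2 => /eqP.
by rewrite eq_sym addr_eq0 => /eqP ->; rewrite normrN.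
Qed.

Lemma implicit_differentiable x e : Dom x -> 0 < e -> exists2 r, 0 < r &
  forall h, Dom (x + h) -> nx h < r ->
  `|implicit_fun (x + h) - implicit_fun x - implicit_der x h| <= e * nx h.
Proof.
(* The factor [2] is lost in [M_expand]; [1] and [2 * K] bound [h] and the increment of the solution
   in units of [nx h]. *)
move=> Dx e0; pose k := e / (2 * (1 + 2 * K)).
have k0 : 0 < k by rewrite divr_gt0// mulr_gt0// ltr_wpDr// mulr_ge0.
have [r1 r10 Br] := Bcont (implicit_fun x) k0; have [r2 r20 Mr] := Mdiff x (implicit_fun x) k0.
have K1 : 0 < 2 * K + 1 by rewrite ltr_wpDl// mulr_ge0.
pose r12 := Num.min r1 r2.
have r120 : 0 < r12 by rewrite lt_min r10.
exists (Num.min (rho / 2) (r12 / (2 * K + 1))) => [|h Dxh].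
  by rewrite lt_min !divr_gt0.
rewrite lt_min => /andP[/ltW hr hr12].
have hE : x + h - x = h by rewrite addrC addKr.
have := implicit_lipschitz Dx Dxh; rewrite hE => /(_ hr).
set w := implicit_fun (x + h) - implicit_fun x => wK.
have wr : `|w| < r12.
  apply: le_lt_trans wK _; move: hr12; rewrite ltr_pdivlMr//; apply: le_lt_trans.
  by rewrite mulrC ler_wpM2l// lerDl.
have wE : implicit_fun (x + h) = implicit_fun x + w by rewrite /w [implicit_fun x + _]addrC subrK.
apply: le_trans (M_expand _ Dx (implicit_fun_ball Dx)) _; rewrite MB implicit_derM// opprK.
(* This is the equation at [x + h]. It reduces the remainder of the solution to that of [G] in [p]
   and to the variation of [B]. *)
have E : G x (implicit_fun x + w) = - B (implicit_fun (x + h)) h.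
  by apply/eqP; rewrite -addr_eq0 -wE -GB (implicit_funP Dxh).2.
move: wr; rewrite lt_min => /andP[wr1 wr2].
have := Mr w wr2; rewrite E (implicit_funP Dx).2 subr0 => H1.
have := Br _ wr1 h => H2.
have -> : M x (implicit_fun x) w + B (implicit_fun x) h =
    - (- B (implicit_fun (x + h)) h - M x (implicit_fun x) w)
    - (B (implicit_fun (x + h)) h - B (implicit_fun x) h).
  by apply/rowP => i; rewrite !mxE; ring.
apply: (@le_trans _ _ (2 * (k * `|w| + k * nx h))).
  rewrite ler_wpM2l// (le_trans (ler_normB _ _))// normrN lerD//.
apply: (@le_trans _ _ (2 * (k * (2 * K * nx h) + k * nx h))).
  by rewrite ler_wpM2l// lerD2r ler_wpM2l// ltW.
rewrite le_eqVlt; apply/orP; left; apply/eqP; rewrite /k; field.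
by rewrite lt0r_neq0// ltr_wpDr// mulr_ge0.
Qed.

Lemma implicit_der_continuous x e : Dom x -> 0 < e -> exists2 r, 0 < r &
  forall x', Dom x' -> nx (x' - x) < r -> forall h, `|implicit_der x' h - implicit_der x h| <= e * nx h.
Proof.
move=> Dx e0; pose k := e / (2 * (1 + 2 * K)).
have k0 : 0 < k by rewrite divr_gt0// mulr_gt0// ltr_wpDr// mulr_ge0.
have [r1 r10 Br] := Bcont (implicit_fun x) k0; have [r2 r20 Mr] := Mcont x (implicit_fun x) k0.
have K1 : 0 < 2 * K + 1 by rewrite ltr_wpDl// mulr_ge0.
pose r12 := Num.min r1 r2.
have r120 : 0 < r12 by rewrite lt_min r10.
exists (Num.min r2 (Num.min (rho / 2) (r12 / (2 * K + 1)))) => [|x' Dx'].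
  by rewrite !lt_min r20 !divr_gt0.
rewrite !lt_min => /andP[xr2 /andP[/ltW hr hr12]] h.
have wK := implicit_lipschitz Dx Dx' hr.
have wr : `|implicit_fun x' - implicit_fun x| < r12.
  apply: le_lt_trans wK _; move: hr12; rewrite ltr_pdivlMr//; apply: le_lt_trans.
  by rewrite mulrC ler_wpM2l// lerDl.
move: wr; rewrite lt_min => /andP[wr1 wr2].
apply: le_trans (M_expand _ Dx' (implicit_fun_ball Dx')) _; rewrite MB implicit_derM//.
have -> : - B (implicit_fun x') h - M x' (implicit_fun x') (implicit_der x h) =
    - (B (implicit_fun x') h - B (implicit_fun x) h)
    - (M x' (implicit_fun x') (implicit_der x h) - M x (implicit_fun x) (implicit_der x h)).
  by rewrite (implicit_derM h Dx); apply/rowP => i; rewrite !mxE; ring.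
apply: (@le_trans _ _ (2 * (k * nx h + k * `|implicit_der x h|))).
  rewrite ler_wpM2l// (le_trans (ler_normB _ _))// normrN lerD//.
    exact: Br.
  exact: Mr.
apply: (@le_trans _ _ (2 * (k * nx h + k * (2 * K * nx h)))).
  rewrite ler_wpM2l// lerD2l; apply: ler_wpM2l; [exact: ltW|exact: implicit_der_bound].
rewrite le_eqVlt; apply/orP; left; apply/eqP; rewrite /k; field.
by rewrite lt0r_neq0// ltr_wpDr// mulr_ge0.
Qed.

End implicit_function.

(** * Critical points of the distance to a parametrized set *)

Section finite_radius.
Context {R : realType}.

Lemma fin_radius (I : finType) (A : I -> R -> Prop) :
  (forall i r r', r' <= r -> A i r -> A i r') ->
  (forall i, exists2 r, 0 < r & A i r) -> exists2 r, 0 < r & forall i, A i r.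
Proof.
move=> Amono Aex; pose r i := sval (cid2 (Aex i)).
have rP i : 0 < r i /\ A i (r i) by rewrite /r; case: cid2.
exists (\big[Num.min/1]_i r i) => [|i].
  by elim/big_ind: _ => // [a b a0 b0|i _]; [rewrite lt_min a0|exact: (rP i).1].
by apply: Amono (rP i).2; exact: bigmin_le.
Qed.

End finite_radius.

Section projection.
Context d (T : measurableType d) (R : realType).
Variable mu : {measure set T -> \bar R}.
Local Notation H := (LfunType mu (@lee1n R 2)).
Context {N : nat}.
Local Notation P := 'rV[R]_N.
Local Notation X := (H * P)%type.
Implicit Types (p w : P) (x : X).

(** The [f i] are the partial derivatives of [Q], and the [f' i k] those of [f i]. The squared norms
    [D i] do not depend on [p]; some may be [0], and [Qdeg] and [fdeg] say that such a parameter
    affects neither [Q], up to a null function, nor the nondegenerate tangent vectors. *)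
Variables (Q : P -> H) (f : 'I_N -> P -> H) (f' : 'I_N -> 'I_N -> P -> H) (D : 'I_N -> R)
  (F LQ : R).
Hypothesis F_ge0 : 0 <= F.
Hypothesis LQ_ge0 : 0 <= LQ.
Hypothesis Qdiff : forall p e, 0 < e -> exists2 r, 0 < r & forall w, `|w| < r ->
  nrm (Q (p + w) - Q p - \sum_k w ord0 k *: f k p) <= e * `|w|.
Hypothesis Qlip : forall p p', nrm (Q p' - Q p) <= LQ * `|p' - p|.
Hypothesis fdiff : forall i p e, 0 < e -> exists2 r, 0 < r & forall w, `|w| < r ->
  nrm (f i (p + w) - f i p - \sum_k w ord0 k *: f' i k p) <= e * `|w|.
Hypothesis f_le : forall i p, nrm (f i p) <= F.
Hypothesis f'_le : forall i k p, nrm (f' i k p) <= F.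
Hypothesis f'cont : forall i k p e, 0 < e -> exists2 r, 0 < r & forall w, `|w| < r ->
  nrm (f' i k (p + w) - f' i k p) <= e.
Hypothesis f_dot : forall i p, dot (f i p) (f i p) = D i.
Hypothesis Qdeg : forall p p', (forall i, D i != 0 -> p ord0 i = p' ord0 i) ->
  nrm (Q p - Q p') = 0.
Hypothesis fdeg : forall i p p', D i != 0 ->
  (forall k, D k != 0 -> p ord0 k = p' ord0 k) -> f i p = f i p'.

Let E i := (D i)^-1.
Let z i : R := (D i == 0)%:R.
Let S : R := \sum_i `|E i|.

(* [z] singles out the directions along which [Q] is constant; there the
   equation [G x p = 0] is completed by [p = x.2], and [E] vanishes since
   [0^-1 = 0]. *)
Let G x p : P := \row_i (z i * (p ord0 i - x.2 ord0 i) - E i * dot (x.1 - Q p) (f i p)).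
Let B p (h : X) : P := \row_i (- z i * h.2 ord0 i - E i * dot h.1 (f i p)).
(** The derivative of [dot (x.1 - Q p) (f i p)] along the [k]-th parameter: a curvature term, small
    with the residual [x.1 - Q p], minus an entry of the Gram matrix. *)
Let phi x p i k := dot (x.1 - Q p) (f' i k p) - dot (f k p) (f i p).
Let M x p w : P := \row_i (z i * w ord0 i - E i * \sum_k w ord0 k * phi x p i k).

Let nx (x : X) := nrm x.1 + `|x.2|.

(** Dividing by the diagonal of the Gram matrix, where it is nonzero, brings the diagonal of the
    linearization close to [1]; [z] does so in the degenerate directions. *)
Let zE i : z i + E i * D i = 1.
Proof.
rewrite /z /E; have [->|D0] := eqVneq (D i) 0; first by rewrite mulr0 addr0.
by rewrite mulVf// add0r.
Qed.

Let z01 i : 0 <= z i <= 1.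
Proof. by rewrite /z; case: eqP => _; rewrite lexx ler01. Qed.

Let S_ge0 : 0 <= S.
Proof. by apply: sumr_ge0. Qed.

Let E_le i : `|E i| <= S.
Proof. by rewrite /S (bigD1 i)//= lerDl sumr_ge0. Qed.

Let nx_ge0 x : 0 <= nx x.
Proof. by rewrite addr_ge0 ?nrm_ge0. Qed.

Let GB x h p : G (x + h) p = G x p + B p h.
Proof.
apply/rowP => i; rewrite !mxE /=.
have -> : x.1 + h.1 - Q p = x.1 - Q p + h.1 by rewrite addrAC.
by rewrite dotDl; ring.
Qed.

Let Blin p a h1 h2 : B p (a *: h1 + h2) = a *: B p h1 + B p h2.
Proof. by apply/rowP => i; rewrite !mxE /= dotDl dotZl; ring. Qed.

Let K := 1 + S * F.

Let K_ge0 : 0 <= K.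
Proof. by rewrite addr_ge0// mulr_ge0. Qed.

Let Bbound p h : `|B p h| <= K * nx h.
Proof.
apply: mx_norm_le => [|i j]; first by rewrite mulr_ge0.
rewrite ord1 {i} mxE mulNr; apply: le_trans (ler_normB _ _) _.
rewrite normrN !normrM.
have h2 := coord_le_norm h.2 ord0 j; have /andP[z0 z1] := z01 j.
have H1 : `|z j| * `|h.2 ord0 j| <= `|h.2|.
  by rewrite ger0_norm// (le_trans _ h2)// ler_piMl.
have H2 : `|E j| * `|dot h.1 (f j p)| <= S * (nrm h.1 * F).
  apply: ler_pM => //; apply: le_trans (dot_le _ _) _.
  by rewrite ler_wpM2l ?nrm_ge0.
apply: le_trans (lerD H1 H2) _; rewrite /K /nx.
have := nrm_ge0 h.1; have : 0 <= `|h.2| by []; have SF : 0 <= S * F by rewrite mulr_ge0.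
by move: (nrm h.1) (`|h.2|) => a b b0 a0; rewrite mulrDl mul1r mulrDr; nra.
Qed.

Let fcont i p e : 0 < e -> exists2 r, 0 < r & forall w, `|w| < r ->
  nrm (f i (p + w) - f i p) <= e.
Proof.
move=> e0; have [r r0 fr] := fdiff i p ltr01.
have NF : 0 < 1 + N%:R * F by rewrite ltr_wpDr// mulr_ge0.
exists (Num.min r (e / (1 + N%:R * F))) => [|w]; first by rewrite lt_min r0 divr_gt0.
rewrite lt_min => /andP[/fr wr]; rewrite ltr_pdivlMr// => we.
rewrite -(subrK (\sum_k w ord0 k *: f' i k p) (f i (p + w) - f i p)).
apply: le_trans (nrmD _ _) _; apply: le_trans (ltW we); rewrite mulrDr mulr1.
apply: lerD; first by rewrite mul1r in wr.
apply: le_trans (nrm_sum _ _ _) _.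
apply: (@le_trans _ _ (\sum_(k < N) `|w| * F)).
  apply: ler_sum => k _; rewrite nrmZ ler_pM ?nrm_ge0//; exact: coord_le_norm.
by rewrite sumr_const card_ord -[leLHS]mulr_natl mulrCA lexx.
Qed.

Let Bcont p e : 0 < e -> exists2 r, 0 < r &
  forall p', `|p' - p| < r -> forall h, `|B p' h - B p h| <= e * nx h.
Proof.
move=> e0; have S1 : 0 < S + 1 by rewrite ltr_wpDl.
have [|i|r r0 fr] := @fin_radius R _ (fun i r => forall w, `|w| < r ->
  nrm (f i (p + w) - f i p) <= e / (S + 1)).
- by move=> i r r' r'r fr w wr'; apply: fr; exact: lt_le_trans r'r.
- by apply: fcont; rewrite divr_gt0.
exists r => // p' p'r h; apply: mx_norm_le => [|i j]; first by rewrite mulr_ge0 ?nx_ge0// ltW.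
rewrite ord1 {i} !mxE.
have -> : - z j * h.2 ord0 j - E j * dot h.1 (f j p') - (- z j * h.2 ord0 j - E j * dot h.1 (f j p))
    = - (E j * dot h.1 (f j p' - f j p)) by rewrite dotBr; ring.
rewrite normrN normrM.
have fp := fr j _ p'r; rewrite [p + _]addrC subrK in fp.
apply: (@le_trans _ _ (S * (nrm h.1 * (e / (S + 1))))).
  apply: ler_pM => //; apply: le_trans (dot_le _ _) _.
  by rewrite ler_wpM2l ?nrm_ge0.
have -> : S * (nrm h.1 * (e / (S + 1))) = (S * (e / (S + 1))) * nrm h.1 by ring.
apply: ler_pM.
- by rewrite mulr_ge0// divr_ge0 ?ltW.
- exact: nrm_ge0.
- by rewrite mulrCA ger_pMr// ler_pdivrMr// mul1r lerDl.
- by rewrite /nx lerDl.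
Qed.

Let Mlin x p a w1 w2 : M x p (a *: w1 + w2) = a *: M x p w1 + M x p w2.
Proof.
apply/rowP => i; rewrite !mxE /=.
have -> : \sum_k (a *: w1 + w2) ord0 k * phi x p i k =
    a * (\sum_k w1 ord0 k * phi x p i k) + \sum_k w2 ord0 k * phi x p i k.
  by rewrite mulr_sumr -big_split; apply: eq_bigr => k _; rewrite !mxE /=; ring.
ring.
Qed.

Let sum_le w (a : 'I_N -> R) e : 0 <= e -> (forall k, `|a k| <= e) ->
  `|\sum_k w ord0 k * a k| <= N%:R * e * `|w|.
Proof.
move=> e0 ae; apply: le_trans (ler_norm_sum _ _ _) _.
apply: (@le_trans _ _ (\sum_(k < N) `|w| * e)).
  apply: ler_sum => k _; rewrite normrM ler_pM//; exact: coord_le_norm.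
by rewrite sumr_const card_ord -[leLHS]mulr_natl mulrA mulrAC lexx.
Qed.

Let Mdiff x p e : 0 < e -> exists2 r, 0 < r &
  forall w, `|w| < r -> `|G x (p + w) - G x p - M x p w| <= e * `|w|.
Proof.
move=> e0; pose v := x.1 - Q p.
pose A := S * (nrm v + N%:R * F + F) + 1.
have A0 : 0 < A by rewrite ltr_wpDl// mulr_ge0// !addr_ge0 ?nrm_ge0// mulr_ge0.
pose e1 := e / A; have e10 : 0 < e1 by rewrite divr_gt0.
have [r1 r10 Qr] := Qdiff p e10.
have [|i|r2 r20 fr] := @fin_radius R _ (fun i r => forall w, `|w| < r ->
  nrm (f i (p + w) - f i p) <= e1).
- by move=> i r r' r'r fr w wr'; apply: fr; exact: lt_le_trans r'r.
- exact: fcont.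
have [|i|r3 r30 f'r] := @fin_radius R _ (fun i r => forall w, `|w| < r ->
  nrm (f i (p + w) - f i p - \sum_k w ord0 k *: f' i k p) <= e1 * `|w|).
- by move=> i r r' r'r f'r w wr'; apply: f'r; exact: lt_le_trans r'r.
- exact: fdiff.
exists (Num.min r1 (Num.min r2 r3)) => [|w]; first by rewrite !lt_min r10 r20.
rewrite !lt_min => /and3P[wr1 wr2 wr3].
apply: mx_norm_le => [|i j]; first by rewrite mulr_ge0// ltW.
rewrite ord1 {i} !mxE.
set q := Q (p + w) - Q p - \sum_k w ord0 k *: f k p.
set s := f j (p + w) - f j p - \sum_k w ord0 k *: f' j k p.
(* Three errors remain: the remainder of [f j] against the residual, the linear increment of [Q]
   against the increment of [f j], and the remainder of [Q]. *)
have -> : z j * (p ord0 j + w ord0 j - x.2 ord0 j) - E j * dot (x.1 - Q (p + w)) (f j (p + w))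
   - (z j * (p ord0 j - x.2 ord0 j) - E j * dot (x.1 - Q p) (f j p))
   - (z j * w ord0 j - E j * \sum_k w ord0 k * phi x p j k) =
   E j * (- dot v s + \sum_k w ord0 k * dot (f k p) (f j (p + w) - f j p) + dot q (f j (p + w))).
  have -> : x.1 - Q (p + w) = v - (q + \sum_k w ord0 k *: f k p) by rewrite /q subrK /v opprB addrA subrK.
  have fE : f j (p + w) = f j p + (s + \sum_k w ord0 k *: f' j k p).
    by rewrite /s subrK [f j p + _]addrC subrK.
  rewrite dotBl dotDl.
  have -> : dot v (f j (p + w)) = dot v (f j p) + dot v s + \sum_k w ord0 k * dot v (f' j k p).
    rewrite {1}fE !dotDr addrA; congr (_ + _).
    by rewrite dotC dot_suml; apply: eq_bigr => k _; rewrite dotZl dotC.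
  have -> : dot (\sum_k w ord0 k *: f k p) (f j (p + w)) =
      \sum_k w ord0 k * dot (f k p) (f j p) +
      \sum_k w ord0 k * dot (f k p) (f j (p + w) - f j p).
    rewrite dot_suml -big_split; apply: eq_bigr => k _ /=.
    by rewrite dotZl dotBr; ring.
  have -> : \sum_k w ord0 k * phi x p j k = \sum_k w ord0 k * dot v (f' j k p) -
     \sum_k w ord0 k * dot (f k p) (f j p).
    by rewrite -sumrB; apply: eq_bigr => k _; rewrite mulrBr.
  ring.
rewrite normrM; apply: (@le_trans _ _ (S * (nrm v * (e1 * `|w|) + N%:R * (F * e1) * `|w| + e1 * `|w| * F))).
  apply: ler_pM => //; apply: le_trans (ler_normD _ _) _; apply: lerD.
    apply: le_trans (ler_normD _ _) _; rewrite normrN; apply: lerD.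
      by apply: le_trans (dot_le _ _) _; rewrite ler_wpM2l ?nrm_ge0// f'r.
    apply: sum_le => [|k]; first by rewrite mulr_ge0// ltW.
    by apply: le_trans (dot_le _ _) _; rewrite ler_pM ?nrm_ge0// fr.
  by apply: le_trans (dot_le _ _) _; rewrite ler_pM ?nrm_ge0// Qr.
have -> : S * (nrm v * (e1 * `|w|) + N%:R * (F * e1) * `|w| + e1 * `|w| * F) =
  (e1 * (A - 1)) * `|w| by rewrite /A; ring.
rewrite ler_wpM2r// /e1 mulrAC ler_pdivrMr// ler_wpM2l ?ltW//.
by rewrite gtrDl oppr_lt0.
Qed.

Let dot_diff_le (a a' b b' : H) : `|dot a' b' - dot a b| <=
  nrm (a' - a) * nrm b' + nrm a * nrm (b' - b).
Proof.
have -> : dot a' b' - dot a b = dot (a' - a) b' + dot a (b' - b).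
  by rewrite dotBl dotBr; ring.
by apply: le_trans (ler_normD _ _) _; rewrite lerD// dot_le.
Qed.

Let phicont x p i k e : 0 < e -> exists2 r, 0 < r & forall x' p', nx (x' - x) < r ->
  `|p' - p| < r -> `|phi x' p' i k - phi x p i k| <= e.
Proof.
move=> e0; pose v := x.1 - Q p.
pose A := 3 * F + nrm v + LQ * F + 1.
have A0 : 0 < A by rewrite ltr_wpDl// !addr_ge0 ?nrm_ge0// mulr_ge0.
pose e1 := e / A; have e10 : 0 < e1 by rewrite divr_gt0.
have [r1 r10 fr] := f'cont i k p e10.
have [r2 r20 fi] := fcont i p e10.
have [r3 r30 fk] := fcont k p e10.
exists (Num.min e1 (Num.min r1 (Num.min r2 r3))) => [|x' p'].
  by rewrite !lt_min e10 r10 r20.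
rewrite !lt_min => /and4P[xe _ _ _] /and4P[pe p1 p2 p3].
have := fr _ p1; have := fi _ p2; have := fk _ p3; rewrite [p + _]addrC subrK => Hk Hi Hf.
rewrite /phi.
set a1 := dot _ (f' i k p'); set a2 := dot (f k p') _; set a3 := dot _ (f' i k p); set a4 := dot (f k p) _.
have -> : a1 - a2 - (a3 - a4) = (a1 - a3) - (a2 - a4) by ring.
apply: le_trans (ler_normB _ _) _; rewrite /a1 /a2 /a3 /a4 {a1 a2 a3 a4}.
apply: le_trans (lerD (dot_diff_le _ _ _ _) (dot_diff_le _ _ _ _)) _; rewrite -/v.
have Hv : nrm (x'.1 - Q p' - v) <= e1 + LQ * e1.
  have -> : x'.1 - Q p' - v = (x' - x).1 + (Q p - Q p').
    by rewrite -[(x' - x).1]/(x'.1 - x.1) /v opprB [Q p - x.1]addrC addrACA [- Q p' + _]addrC.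
  apply: le_trans (nrmD _ _) _; apply: lerD.
    by apply: le_trans (ltW xe); rewrite lerDl.
  by rewrite nrmB (le_trans (Qlip _ _))// ler_wpM2l// ltW.
apply: (@le_trans _ _ ((e1 + LQ * e1) * F + nrm v * e1 + (e1 * F + F * e1))).
  by rewrite !lerD// ler_pM ?nrm_ge0// ?addr_ge0 ?mulr_ge0 ?ltW//.
have -> : (e1 + LQ * e1) * F + nrm v * e1 + (e1 * F + F * e1) = e1 * (A - 1) by rewrite /A; ring.
by rewrite /e1 mulrAC ler_pdivrMr// ler_wpM2l ?ltW// gtrDl oppr_lt0.
Qed.

Let Mcont x p e : 0 < e -> exists2 r, 0 < r &
  forall x' p', nx (x' - x) < r -> `|p' - p| < r ->
  forall w, `|M x' p' w - M x p w| <= e * `|w|.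
Proof.
move=> e0; pose A := S * N%:R + 1.
have A0 : 0 < A by rewrite ltr_wpDl// mulr_ge0.
pose e1 := e / A; have e10 : 0 < e1 by rewrite divr_gt0.
have [|[i k]|r r0 pr] := @fin_radius R ('I_N * 'I_N)%type (fun ik r => forall x' p',
  nx (x' - x) < r -> `|p' - p| < r -> `|phi x' p' ik.1 ik.2 - phi x p ik.1 ik.2| <= e1).
- by move=> ik r r' r'r pr x' p' xr' pr'; apply: pr; exact: lt_le_trans r'r.
- exact: phicont.
exists r => // x' p' xr p'r w; apply: mx_norm_le => [|i j]; first by rewrite mulr_ge0// ltW.
rewrite ord1 {i} !mxE.
have -> : z j * w ord0 j - E j * (\sum_k w ord0 k * phi x' p' j k)
   - (z j * w ord0 j - E j * \sum_k w ord0 k * phi x p j k) =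
   - (E j * \sum_k w ord0 k * (phi x' p' j k - phi x p j k)).
  by under [in RHS]eq_bigr do rewrite mulrBr; rewrite sumrB; ring.
rewrite normrN normrM; apply: (@le_trans _ _ (S * (N%:R * e1 * `|w|))).
  by apply: ler_pM => //; apply: sum_le => [|k]; [exact: ltW|exact: (pr (j, k))].
have -> : S * (N%:R * e1 * `|w|) = e1 * (A - 1) * `|w| by rewrite /A; ring.
by rewrite ler_wpM2r// /e1 mulrAC ler_pdivrMr// ler_wpM2l ?ltW// gtrDl oppr_lt0.
Qed.

(** Required on a whole ball, because the linearization has to be controlled along all segments in
    the contraction argument. *)
Definition gap delta rho q := forall p, `|p - q| <= rho ->
  forall i k, i != k -> `|dot (f i p) (f k p)| <= delta.

(** By [zE] the diagonal Gram entries cancel against the identity. There remain the off-diagonal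
    entries, at most [delta], and the curvature terms, at most [eta * F]. *)
Let Mid_coef (delta eta rho : R) x : 0 <= delta -> 0 <= eta ->
  S * (N%:R * (delta + eta * F)) <= 2^-1 -> gap delta rho x.2 ->
  (forall p, `|p - x.2| <= rho -> nrm (x.1 - Q p) <= eta) ->
  forall p, `|p - x.2| <= rho -> forall w, `|w - M x p w| <= `|w| / 2.
Proof.
move=> d0 e0 SN gx vx p px w; apply: mx_norm_le => [|i j]; first by rewrite divr_ge0.
rewrite ord1 {i} !mxE.
pose a k := phi x p j k + (if k == j then D j else 0).
have aE : \sum_k w ord0 k * a k = \sum_k w ord0 k * phi x p j k + w ord0 j * D j.
  rewrite /a; under eq_bigr do rewrite mulrDr; rewrite big_split /=; congr (_ + _).
  by rewrite (bigD1 j)//= eqxx big1 ?addr0// => k /negbTE ->; rewrite mulr0.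
have -> : w ord0 j - (z j * w ord0 j - E j * \sum_k w ord0 k * phi x p j k) =
    E j * \sum_k w ord0 k * a k.
  by rewrite aE -[X in X - _](mul1r (w ord0 j)) -(zE j); ring.
rewrite normrM; have de : 0 <= delta + eta * F by rewrite addr_ge0// mulr_ge0.
apply: (@le_trans _ _ (S * (N%:R * (delta + eta * F) * `|w|))).
  apply: ler_pM => //; apply: sum_le => // k; rewrite /a /phi.
  have v1 : `|dot (x.1 - Q p) (f' j k p)| <= eta * F.
    by apply: le_trans (dot_le _ _) _; rewrite ler_pM ?nrm_ge0// vx.
  move: v1; case: eqVneq => [->|kj] v1; first by rewrite f_dot subrK (le_trans v1)// lerDr.
  by rewrite addr0 [delta + _]addrC (le_trans (ler_normB _ _))// lerD// gx.
by rewrite mulrA [leRHS]mulrC ler_wpM2r.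
Qed.

Let D_eq0 i p : D i = 0 -> nrm (f i p) = 0.
Proof. by move=> D0; apply/eqP; rewrite -sqrf_eq0 nrm_sqr f_dot D0. Qed.

(** In a degenerate direction the tangent vector is null, so its orthogonality condition holds
    although [G] does not encode it. *)
Let G_eq0 x p : G x p = 0 -> forall i, dot (x.1 - Q p) (f i p) = 0.
Proof.
move=> /rowP Gp i; have := Gp i; rewrite !mxE /z /E.
have [D0 _|D0 /eqP] := eqVneq (D i) 0.
  apply/eqP; rewrite -normr_eq0 eq_le normr_ge0 andbT.
  by apply: le_trans (dot_le _ _) _; rewrite D_eq0// mulr0.
by rewrite mul0r sub0r oppr_eq0 mulf_eq0 invr_eq0 (negbTE D0) => /eqP.
Qed.

(** A critical point need not satisfy the completing equations. Resetting its degenerate coordinates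
    to those of [x.2] achieves this and changes [Q p] only by a null function. *)
Let G_crit x p : (forall i, dot (x.1 - Q p) (f i p) = 0) ->
  G x (\row_i (if D i == 0 then x.2 ord0 i else p ord0 i)) = 0.
Proof.
move=> crit; set p' := \row_i _; apply/rowP => i; rewrite !mxE /z /E.
have pp' k : D k != 0 -> p' ord0 k = p ord0 k by move=> /negbTE Dk; rewrite mxE Dk.
have [D0|D0] := eqVneq (D i) 0; first by rewrite D0 subrr mulr0 invr0 mul0r subrr.
rewrite mul0r sub0r (fdeg D0 pp') -[x.1 - Q p'](subrKA (Q p)).
rewrite dotDl crit add0r; apply/eqP; rewrite oppr_eq0 mulf_eq0; apply/orP; right.
rewrite -normr_eq0 eq_le normr_ge0 andbT; apply: le_trans (dot_le _ _) _.
by rewrite nrmB Qdeg// mul0r.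
Qed.

(** The constants precede [Dom], since the separation that cuts out the domain is to be chosen in
    terms of [delta] and [rho]. *)
Theorem projection_C1 : exists (rho delta eps K : R) (sol : X -> P) (dsol : X -> X -> P),
  [/\ 0 < rho, 0 < delta, 0 < eps & 0 <= K] /\
  forall Dom : X -> Prop,
    (forall x, Dom x -> nrm (x.1 - Q x.2) < eps /\ gap delta rho x.2) ->
  forall x, Dom x ->
  [/\ [/\ `|sol x - x.2| <= rho / 2, `|sol x - x.2| <= K * nrm (x.1 - Q x.2) &
        forall i, dot (x.1 - Q (sol x)) (f i (sol x)) = 0],
      forall p, (forall i, D i != 0 -> `|p ord0 i - x.2 ord0 i| <= rho) ->
        (forall i, dot (x.1 - Q p) (f i p) = 0) ->
        forall i, D i != 0 -> p ord0 i = sol x ord0 i,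
      (forall a h1 h2, dsol x (a *: h1 + h2) = a *: dsol x h1 + dsol x h2) /\
        forall h, `|dsol x h| <= K * (nrm h.1 + `|h.2|),
      forall e, 0 < e -> exists2 r, 0 < r & forall h, Dom (x + h) ->
        nrm h.1 + `|h.2| < r ->
        `|sol (x + h) - sol x - dsol x h| <= e * (nrm h.1 + `|h.2|) &
      forall e, 0 < e -> exists2 r, 0 < r & forall x', Dom x' ->
        nrm (x' - x).1 + `|(x' - x).2| < r ->
        forall h, `|dsol x' h - dsol x h| <= e * (nrm h.1 + `|h.2|)].
Proof.
pose A := S * N%:R + 1.
have A0 : 0 < A by rewrite ltr_wpDl// mulr_ge0.
(* As [eta * F <= delta], the coefficient in [Mid_coef] is at most [A * (delta + delta)], which is
   [2^-1]. *)
pose delta := (4 * A)^-1; pose eta := (4 * A * (F + 1))^-1.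
have F1 : 0 < F + 1 by rewrite ltr_wpDl.
have delta0 : 0 < delta by rewrite invr_gt0 mulr_gt0.
have eta0 : 0 < eta by rewrite invr_gt0 !mulr_gt0.
have SN : S * (N%:R * (delta + eta * F)) <= 2^-1.
  have : eta * F <= delta.
    rewrite /eta invfM -/delta -mulrA ger_pMr// mulrC ler_pdivrMr// mul1r.
    by rewrite lerDl.
  move=> eF; apply: (@le_trans _ _ (A * (delta + delta))).
    rewrite mulrA ler_pM ?mulr_ge0 ?addr_ge0 ?mulr_ge0 ?(ltW eta0) ?(ltW delta0)//.
      by rewrite /A lerDl.
    by rewrite lerD2l.
  by rewrite le_eqVlt; apply/orP; left; apply/eqP; rewrite /delta; field; rewrite lt0r_neq0.
(* Moving by [rho] changes the residual by at most [eta / 2], and the defect, below [eps], takes the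
   other half of [eta]. The second bound in [eps] makes [G] at most [rho / 4] at the centre, as the
   fixed point argument requires. *)
pose rho := eta / (2 * (LQ + 1)).
have L1 : 0 < LQ + 1 by rewrite ltr_wpDl.
have rho0 : 0 < rho by rewrite divr_gt0// mulr_gt0.
have SF1 : 0 < S * F + 1 by rewrite ltr_wpDl// mulr_ge0.
pose eps := Num.min (eta / 2) (rho / (4 * (S * F + 1))).
have eps0 : 0 < eps by rewrite lt_min !divr_gt0// mulr_gt0.
have K'0 : 0 <= 2 * K by rewrite mulr_ge0.
exists rho, delta, eps, (2 * K).
exists (implicit_fun G snd rho), (implicit_der G B M snd rho).
split=> // Dom DomP.
have vle x p : Dom x -> `|p - x.2| <= rho -> nrm (x.1 - Q p) <= eta.
  move=> /DomP[xe _] px; rewrite -(subrKA (Q x.2)); apply: le_trans (nrmD _ _) _.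
  have : nrm (Q x.2 - Q p) <= LQ * rho.
    by rewrite nrmB (le_trans (Qlip _ _))// ler_wpM2l.
  have : LQ * rho <= eta / 2.
    have -> : LQ * rho = LQ / (LQ + 1) * (eta / 2).
      by rewrite /rho; field; rewrite lt0r_neq0.
    by rewrite ger_pMl ?divr_gt0// ler_pdivrMr// mul1r lerDl.
  by move: xe; rewrite lt_min => /andP[xe _]; move: xe; lra.
have Mid x p : Dom x -> `|p - x.2| <= rho -> forall w, `|w - M x p w| <= `|w| / 2.
  move=> Dx px w; have [_ gx] := DomP x Dx.
  by apply: (Mid_coef (ltW delta0) (ltW eta0) SN gx) => // p'; exact: vle.
have Gnrm x : `|G x x.2| <= S * F * nrm (x.1 - Q x.2).
  apply: mx_norm_le => [|i j]; first by rewrite !mulr_ge0 ?nrm_ge0.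
  rewrite ord1 mxE subrr mulr0 sub0r normrN normrM -mulrA ler_pM// mulrC.
  by apply: le_trans (dot_le _ _) _; rewrite ler_wpM2l ?nrm_ge0.
have Gc x : Dom x -> `|G x x.2| <= rho / 4.
  move=> /DomP[+ _]; rewrite lt_min => /andP[_ xe].
  apply: le_trans (Gnrm x) _; apply: (@le_trans _ _ ((S * F + 1) * (rho / (4 * (S * F + 1))))).
    by apply: ler_pM; rewrite ?mulr_ge0 ?nrm_ge0 ?lerDl// ltW.
  by rewrite le_eqVlt; apply/orP; left; apply/eqP; field; rewrite lt0r_neq0.
have clip x x' : `|x'.2 - x.2| <= nx (x' - x) by rewrite lerDr nrm_ge0.
move=> x Dx; have [xb xG] := implicit_funP rho0 Mlin Mdiff Mid Gc Dx.
split.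
- split=> //; last exact: G_eq0.
  apply: le_trans (implicit_bound rho0 Mlin Mdiff Mid Gc Dx) _.
  rewrite -mulrA ler_wpM2l// (le_trans (Gnrm x))// ler_wpM2r ?nrm_ge0//.
  by rewrite lerDr.
- move=> p px crit i Di; pose p' := \row_i (if D i == 0 then x.2 ord0 i else p ord0 i) : P.
  rewrite -(implicit_unique rho0 Mlin Mdiff Mid Gc Dx _ (G_crit crit)) ?mxE ?(negbTE Di)//.
  apply: mx_norm_le => [|k j]; first exact: ltW.
  rewrite (ord1 k) !mxE; case: ifPn => [_|Dj]; first by rewrite subrr normr0 ltW.
  exact: px.
- split=> [a h1 h2|h]; first exact: (implicit_der_linear rho0 Blin Mlin Mdiff Mid Gc _ _ _ Dx).
  exact: (implicit_der_bound rho0 Bbound Mlin Mdiff Mid Gc h Dx).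
- move=> e e0; exact: (implicit_differentiable nx_ge0 rho0 K_ge0 GB Bbound Bcont
    Mlin Mdiff Mid Gc clip Dx e0).
- move=> e e0; exact: (implicit_der_continuous nx_ge0 rho0 K_ge0 GB Bbound Bcont
    Mlin Mdiff Mcont Mid Gc clip Dx e0).
Qed.

End projection.

(** * Sobolev functions *)

Section L2_linear.
Context d (T : measurableType d) (R : realType).
Variable mu : {measure set T -> \bar R}.
Implicit Types f g : T -> R.

Lemma toL2D f g : f \in Lfun mu 2%:E -> g \in Lfun mu 2%:E ->
  f + g \in Lfun mu 2%:E /\ toL2 mu (f + g) = toL2 mu f + toL2 mu g.
Proof.
move=> f2 g2; have fg2 : f + g \in Lfun mu 2%:E.
  have -> : f + g = (toL2 mu f + toL2 mu g : LfunType mu (@lee1n R 2)) :> (T -> R).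
    by rewrite -[RHS]/((toL2 mu f : T -> R) + (toL2 mu g : T -> R)) !toL2K.
  exact: LfunP.
split=> //; apply/LfuneqP => x.
by rewrite -[RHS]/((toL2 mu f : T -> R) x + (toL2 mu g : T -> R) x) !toL2K.
Qed.

Lemma toL2Z (a : R) f : f \in Lfun mu 2%:E ->
  a *: f \in Lfun mu 2%:E /\ toL2 mu (a *: f) = a *: toL2 mu f.
Proof.
move=> f2; have af2 : a *: f \in Lfun mu 2%:E.
  have -> : a *: f = (a *: toL2 mu f : LfunType mu (@lee1n R 2)) :> (T -> R).
    by rewrite -[RHS]/(a *: (toL2 mu f : T -> R)) !toL2K.
  exact: LfunP.
split=> //; apply/LfuneqP => x.
by rewrite -[RHS]/(a * (toL2 mu f : T -> R) x) !toL2K.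
Qed.

Lemma toL2B f g : f \in Lfun mu 2%:E -> g \in Lfun mu 2%:E ->
  f - g \in Lfun mu 2%:E /\ toL2 mu (f - g) = toL2 mu f - toL2 mu g.
Proof.
move=> f2 g2; have [g2' gE] := toL2Z (-1) g2; have [fg2 fgE] := toL2D f2 g2'.
by move: fg2 fgE; rewrite gE !scaleN1r.
Qed.

Lemma toL2_sum (I : finType) (F : I -> T -> R) : (forall i, F i \in Lfun mu 2%:E) ->
  \sum_i F i \in Lfun mu 2%:E /\ toL2 mu (\sum_i F i) = \sum_i toL2 mu (F i).
Proof.
move=> F2; elim/big_ind2: _ => [|f f' g g' [f2 <-] [g2 <-]|i _]; last by split.
  by split; [exact: (LfunP (0 : LfunType mu (@lee1n R 2)))|exact: (toL2_val (0 : LfunType mu (@lee1n R 2)))].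
exact: toL2D.
Qed.

End L2_linear.

Section sobolev_space.
Context {R : realType} {n : nat}.
Local Notation V := 'rV[R]_n.
Local Notation mu := (@lebesgue_rV R n).
Local Notation H := (LfunType mu (@lee1n R 2)).
Implicit Types (f h : H) (y w : V).
Local Notation e_ k := (delta_mx ord0 k : V).

Lemma weak_pderivE k f h : weak_pderiv k f h <->
  forall phi, test_function phi ->
    dot f (toL2 mu (pderiv k phi)) = - dot h (toL2 mu phi).
Proof.
split=> fh phi tphi; have := fh phi tphi;
  have := test_function_L2 tphi; have := test_function_L2 (test_function_pderiv k tphi);
  by move=> dp2 p2; rewrite /dot !toL2K.
Qed.

Lemma weak_pderiv_dot k f h phi : weak_pderiv k f h -> test_function phi ->
  dot f (toL2 mu (pderiv k phi)) = - dot h (toL2 mu phi).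
Proof. by move=> /weak_pderivE; apply. Qed.

Definition has_weak_gradient f (g : 'I_n -> H) := forall k, weak_pderiv k f (g k).

Lemma weak_gradientD f f' g g' : has_weak_gradient f g -> has_weak_gradient f' g' ->
  has_weak_gradient (f + f') (fun k => g k + g' k).
Proof.
move=> fg fg' k; apply/weak_pderivE => phi tphi.
by rewrite !dotDl (weak_pderiv_dot (fg k))// (weak_pderiv_dot (fg' k))// opprD.
Qed.

Lemma weak_gradientZ a f g : has_weak_gradient f g ->
  has_weak_gradient (a *: f) (fun k => a *: g k).
Proof.
move=> fg k; apply/weak_pderivE => phi tphi.
by rewrite !dotZl (weak_pderiv_dot (fg k))// mulrN.
Qed.

Lemma weak_gradient_tr y f g : has_weak_gradient f g ->
  has_weak_gradient (tr y f) (fun k => tr y (g k)).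
Proof.
move=> fg k; apply/weak_pderivE => phi tphi; have p2 := test_function_L2 tphi.
have dp2 := test_function_L2 (test_function_pderiv k tphi).
rewrite !dot_trl -!toL2_translate// -pderiv_translate; last first.
  by move=> x; exact: test_function_derivable.
apply: weak_pderiv_dot => //; exact: test_function_translate.
Qed.

Lemma weak_gradient_sum (I : finType) (f : I -> H) (g : I -> 'I_n -> H) :
  (forall i, has_weak_gradient (f i) (g i)) ->
  has_weak_gradient (\sum_i f i) (fun k => \sum_i g i k).
Proof.
move=> fg k; elim/big_ind2: _ => [|a a' b b' aa bb|i _]; last exact: fg.
  by apply/weak_pderivE => phi tphi; rewrite !dot0l oppr0.
apply/weak_pderivE => phi tphi.
by rewrite !dotDl (weak_pderiv_dot aa)// (weak_pderiv_dot bb)// opprD.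
Qed.

Lemma sobolev1P (f : V -> R) : sobolev 1 f <->
  f \in Lfun mu 2%:E /\ exists g, has_weak_gradient (toL2 mu f) g.
Proof.
split=> [[f2 fg]|[f2 [g fg]]]; split=> //.
  have /choice[g gP] : forall k, exists g : H, weak_pderiv k f g.
    by move=> k; have [g [g2 _] fg'] := fg k; exists (toL2 mu g); rewrite toL2K.
  by exists g => k; rewrite toL2K.
move=> k; exists (g k : V -> R); last by have := fg k; rewrite toL2K.
by split=> //; exact: LfunP.
Qed.

Lemma L2norm_toL2 (f : V -> R) : f \in Lfun mu 2%:E -> L2norm f = nrm (toL2 mu f).
Proof. by move=> f2; rewrite /nrm toL2K. Qed.

Lemma L2norm_le_H1norm (f : V -> R) : f \in Lfun mu 2%:E -> nrm (toL2 mu f) <= H1norm f.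
Proof.
move=> f2; rewrite /H1norm -L2norm_toL2//.
have N0 : 0 <= L2norm f by rewrite L2norm_toL2// nrm_ge0.
rewrite -[leLHS](ger0_norm N0) -sqrtr_sqr ler_wsqrtr// lerDl sumr_ge0// => k _.
exact: sqr_ge0.
Qed.

Lemma H1norm_ge0 (f : V -> R) : 0 <= H1norm f.
Proof. exact: sqrtr_ge0. Qed.

Lemma nrm_eq f h : nrm (f - h) = 0 -> nrm f = nrm h.
Proof.
move=> fh; have := nrmD (f - h) h; have := nrmD (h - f) f.
rewrite !subrK (nrmB h f) fh !add0r => hf fh'.
by apply/eqP; rewrite eq_le fh' hf.
Qed.

(** [wpderiv] is an arbitrary choice, but all weak derivatives have the same norm, so the given
    gradient may be used instead. The rest compares a Euclidean norm with a sum. *)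
Lemma H1norm_le f g : has_weak_gradient f g -> H1norm f <= nrm f + \sum_k nrm (g k).
Proof.
move=> fg; have wE k : L2norm (wpderiv k f) = nrm (g k).
  rewrite /wpderiv; case: xgetP => [w _ [w2 fw]|/(_ (g k))[]]; last by split; [exact: LfunP|].
  rewrite L2norm_toL2//; rewrite -(toL2K w2) in fw.
  by apply/esym/nrm_eq; exact: weak_pderiv_unique (fg k) fw.
rewrite /H1norm; under eq_bigr do rewrite wE.
have s0 : 0 <= \sum_k nrm (g k) by apply: sumr_ge0 => k _; exact: nrm_ge0.
rewrite -[leRHS]ger0_norm ?addr_ge0 ?nrm_ge0// -sqrtr_sqr ler_wsqrtr//.
rewrite sqrrD -/(nrm f) -addrA lerD2l.
apply: (@le_trans _ _ ((\sum_k nrm (g k)) ^+ 2)); last first.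
  by rewrite lerDr mulrn_wge0// mulr_ge0// nrm_ge0.
have [_] : 0 <= \sum_k nrm (g k) /\ \sum_k nrm (g k) ^+ 2 <= (\sum_k nrm (g k)) ^+ 2.
  elim/big_ind2: _ => [|a a' b b' [a0 aa] [b0 bb]|k _]; last by split=> //; exact: nrm_ge0.
    by rewrite expr0n.
  split; first exact: addr_ge0.
  rewrite sqrrD; have := mulr_ge0 a0 b0; lra.
exact.
Qed.

Lemma weak_pderiv_null k f h : weak_pderiv k f h -> nrm f = 0 -> nrm h = 0.
Proof.
move=> fh f0; apply/eqP; rewrite eq_le nrm_ge0 andbT; apply: nrm_le_dual => // phi tphi.
rewrite -[in dot h phi](toL2_val phi) -[X in X <= _]normrN -(weak_pderiv_dot fh)//.
by apply: le_trans (dot_le _ _) _; rewrite f0 !mul0r.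
Qed.

(** The translation by [w] is made one coordinate at a time, along the list [s]; the bound [r]
    contains all intermediate translations. Each coordinate costs [e] times the norm of [w] twice:
    for the one-dimensional remainder, and for replacing a translated derivative by the derivative
    itself. *)
Lemma tr_diff_seq f g (s : seq 'I_n) r e w : has_weak_gradient f g -> 0 <= e ->
  (forall y k, `|y| <= r -> nrm (tr y (g k) - g k) <= e) ->
  (size s)%:R * `|w| <= r ->
  nrm (tr (\sum_(k <- s) w ord0 k *: e_ k) f - f + \sum_(k <- s) w ord0 k *: g k) <=
    (size s)%:R * (2 * e * `|w|).
Proof.
move=> fg e0 gr.
have ek k : `|e_ k| <= 1.
  by apply: mx_norm_le => // i l; rewrite mxE; case: (_ && _); rewrite ?normr1 ?normr0.
have wk (k : 'I_n) : `|w ord0 k *: e_ k| <= `|w|.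
  by rewrite normrZ -[leRHS]mulr1 ler_pM// coord_le_norm.
elim: s => [|k s IH] /= sr; first by rewrite !big_nil tr0 subrr addr0 nrm0 mul0r.
have sr' : (size s)%:R * `|w| <= r by apply: le_trans sr; rewrite ler_wpM2r// ler_nat.
have s1 : (size s).+1%:R = (size s)%:R + 1 :> R by rewrite natr1.
rewrite !big_cons; set y := \sum_(j <- s) _; set t := w ord0 k.
have yr : `|y| <= r.
  apply: le_trans sr'; rewrite /y; elim: (s) => [|j q IHq]; first by rewrite big_nil normr0 mul0r.
  rewrite big_cons /= -natr1 mulrDl mul1r addrC (le_trans (ler_normD _ _))//.
  by rewrite lerD.
have -> : tr (t *: e_ k + y) f - f + (t *: g k + \sum_(j <- s) w ord0 j *: g j) =
  tr y (tr (t *: e_ k) f - f + t *: g k) - t *: (tr y (g k) - g k) +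
   (tr y f - f + \sum_(j <- s) w ord0 j *: g j).
  rewrite trD trB trZ tr_tr [y + _]addrC scalerBr opprB.
  have zid (Z : zmodType) (a b c u v : Z) : a + c + (u - c) + (b + v) = a + b + (u + v).
    by rewrite [a + c + _]addrACA subrr addr0 addrACA.
  by rewrite zid subrKA.
apply: le_trans (nrmD _ _) _; rewrite s1 mulrDl mul1r addrC; apply: lerD; first exact: IH.
apply: le_trans (nrmD _ _) _; rewrite nrm_tr nrmN nrmZ.
have -> : 2 * e * `|w| = `|w| * e + `|w| * e by ring.
have tw : `|t| <= `|w| by exact: coord_le_norm.
apply: lerD; last by rewrite ler_pM ?nrm_ge0// gr.
apply: (@le_trans _ _ (`|t| * e)); last by rewrite ler_wpM2r.
apply: weak_diff_quot => // c ct; apply: gr.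
rewrite normrZ; apply: (@le_trans _ _ (`|w| * 1)).
  by rewrite ler_pM// (le_trans ct).
rewrite mulr1; apply: le_trans sr; rewrite ler_peMl// ler1n//.
Qed.

Lemma size_index_ord : size (index_enum 'I_n) = n.
Proof. by rewrite -sum1_size sum_nat_const card_ord muln1. Qed.

Lemma tr_diff f g e : has_weak_gradient f g -> 0 < e -> exists2 r, 0 < r &
  forall y w, `|w| < r ->
    nrm (tr (y + w) f - tr y f + \sum_k w ord0 k *: tr y (g k)) <= e * `|w|.
Proof.
move=> fg e0; pose e1 := e / (2 * n%:R + 1).
have N0 : 0 < 2 * n%:R + 1 :> R by rewrite ltr_wpDl.
have e10 : 0 < e1 by rewrite divr_gt0.
have [|k|r r0 gr] := @fin_radius R _ (fun k r => forall y, `|y| < r -> nrm (tr y (g k) - g k) < e1).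
- by move=> k r r' r'r gr y yr; apply: gr; exact: lt_le_trans r'r.
- exact: tr_continuous.
have n1 : 0 < n%:R + 1 :> R by rewrite ltr_wpDl.
exists (r / 2 / (n%:R + 1)) => [|y w]; first by rewrite !divr_gt0.
rewrite ltr_pdivlMr// => wr.
have -> : tr (y + w) f - tr y f + \sum_k w ord0 k *: tr y (g k) =
    tr y (tr w f - f + \sum_k w ord0 k *: g k).
  rewrite trD trB tr_tr; congr (_ + _).
  rewrite (big_morph (tr y) (trD y) (_ : tr y 0 = 0)).
    by apply: eq_bigr => k _; rewrite trZ.
  by rewrite -(scale0r 0) trZ !scale0r.
rewrite nrm_tr {1}[w]row_sum_delta.
apply: le_trans (tr_diff_seq (r := r / 2) (e := e1) fg (ltW e10) _ _) _.
- move=> z k zr; apply/ltW/gr; apply: le_lt_trans zr _.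
  by rewrite ltr_pdivrMr// ltr_pMr// ltr1n.
- rewrite size_index_ord; apply: le_trans (ltW wr); rewrite mulrC.
  by rewrite ler_wpM2l// lerDl.
rewrite size_index_ord mulrA ler_wpM2r//.
have -> : n%:R * (2 * e1) = e1 * (2 * n%:R) by ring.
by rewrite /e1 mulrAC ler_pdivrMr// ler_wpM2l ?ltW// ltrDl.
Qed.

Lemma tr_lipschitz f g : has_weak_gradient f g -> forall y w,
  nrm (tr (y + w) f - tr y f) <= (2 * n%:R * (2 * \sum_k nrm (g k)) + \sum_k nrm (g k)) * `|w|.
Proof.
move=> fg y w; set s := \sum_k _; have s0 : 0 <= s by apply: sumr_ge0 => k _; exact: nrm_ge0.
have gs k : nrm (g k) <= s by rewrite /s (bigD1 k)//= lerDl sumr_ge0// => i _; exact: nrm_ge0.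
have -> : tr (y + w) f - tr y f = tr y (tr w f - f) by rewrite trB tr_tr.
rewrite nrm_tr -(addrK (\sum_k w ord0 k *: g k) (tr w f - f)).
apply: le_trans (nrmD _ _) _; rewrite nrmN mulrDl; apply: lerD.
  rewrite {1}[w]row_sum_delta.
  (* A translation changes a function by at most twice its norm, so the modulus [2 * s] is valid at
     every radius and [r] can be as large as [w] demands. *)
  apply: le_trans (tr_diff_seq (r := n%:R * `|w|) (e := 2 * s) fg _ _ _) _.
  - by rewrite mulr_ge0.
  - move=> z k _; apply: le_trans (nrmD _ _) _; rewrite nrmN nrm_tr mulr_natl mulr2n.
    by rewrite lerD.
  - by rewrite size_index_ord.
  - by rewrite size_index_ord !mulrA [2 * n%:R]mulrC lexx.
apply: le_trans (nrm_sum _ _ _) _; rewrite /s mulr_suml; apply: ler_sum => k _.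
by rewrite nrmZ mulrC ler_wpM2l ?nrm_ge0// coord_le_norm.
Qed.

(** The orthogonality conditions use pointwise derivatives, the expansion of translations uses weak
    ones. By [pderiv_weak] they agree almost everywhere, so the pointwise derivatives are square
    integrable and inherit weak gradients. *)
Lemma regular_gradient (u : V -> R) : continuously_differentiable 1 u -> sobolev 2 u ->
  exists (g : 'I_n -> H) (dg : 'I_n -> 'I_n -> H),
  [/\ forall k, g k = pderiv k u :> (V -> R), has_weak_gradient (toL2 mu u) g &
      forall k, has_weak_gradient (g k) (dg k)].
Proof.
move=> [cu du] [u2 su].
have p2 k : pderiv k u \in Lfun mu 2%:E /\ exists h' : 'I_n -> H, has_weak_gradient (toL2 mu (pderiv k u)) h'.
  have [g0 /sobolev1P[g2 [dh gh]] ug0] := su k.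
  have ug : weak_pderiv k (toL2 mu u) (toL2 mu g0) by rewrite !toL2K.
  have [|d2 dae] := pderiv_weak _ ug; first by move=> x; rewrite toL2K//; exact: (du k).1.
  rewrite !toL2K// in d2 dae; split=> //; exists dh => i.
  apply/weak_pderivE => phi tphi; rewrite -(weak_pderiv_dot (gh i))//.
  by apply: dot_ae; rewrite !toL2K.
have /choice[dg dgP] : forall k, exists h' : 'I_n -> H, has_weak_gradient (toL2 mu (pderiv k u)) h'.
  by move=> k; have [] := p2 k.
exists (fun k => toL2 mu (pderiv k u)), dg; split=> // k; first by rewrite toL2K// (p2 k).1.
have [g0 /sobolev1P[g2 [dh gh]] ug0] := su k.
have ug : weak_pderiv k (toL2 mu u) (toL2 mu g0) by rewrite !toL2K.
have [|d2 dae] := pderiv_weak _ ug; first by move=> x; rewrite toL2K//; exact: (du k).1.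
rewrite !toL2K// in d2 dae.
apply/weak_pderivE => phi tphi; rewrite (weak_pderiv_dot ug)//; congr (- _).
apply: dot_ae; rewrite !toL2K//.
by apply: filterS dae => x + _ => /(_ I) ->.
Qed.

End sobolev_space.

(** * The manifold of multisolitons *)

Section packing.
Context {R : realType} {m n d : nat}.
Local Notation I := ('I_m * 'I_n + 'I_d)%type.
Local Notation N := #|{: I}|.
Local Notation P := 'rV[R]_N.
Implicit Types (p w : P) (z : 'M[R]_(m, n)) (a : 'rV[R]_d).

(** All the parameters form one row vector with the sup norm, the setting of the implicit function
    theorem; its coordinates are numbered by the enumeration of the sum type. *)
Definition pack z a : P :=
  \row_l match enum_val l with inl jk => z jk.1 jk.2 | inr i => a ord0 i end.
Definition shifts p : 'M[R]_(m, n) := \matrix_(j, k) p ord0 (enum_rank (inl (j, k) : I)).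
Definition coefs p : 'rV[R]_d := \row_i p ord0 (enum_rank (inr i : I)).

Lemma packl z a j k : pack z a ord0 (enum_rank (inl (j, k) : I)) = z j k.
Proof. by rewrite mxE enum_rankK. Qed.

Lemma packr z a i : pack z a ord0 (enum_rank (inr i : I)) = a ord0 i.
Proof. by rewrite mxE enum_rankK. Qed.

Lemma shifts_pack z a : shifts (pack z a) = z.
Proof. by apply/matrixP => j k; rewrite mxE packl. Qed.

Lemma coefs_pack z a : coefs (pack z a) = a.
Proof. by apply/rowP => i; rewrite mxE packr. Qed.

Lemma pack_linear c z1 z2 a1 a2 :
  pack (c *: z1 + z2) (c *: a1 + a2) = c *: pack z1 a1 + pack z2 a2.
Proof. by apply/rowP => l; rewrite !mxE; case: (enum_val l) => [jk|i]; rewrite !mxE. Qed.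

Lemma shifts_linear c p w : shifts (c *: p + w) = c *: shifts p + shifts w.
Proof. by apply/matrixP => j k; rewrite !mxE. Qed.

Lemma coefs_linear c p w : coefs (c *: p + w) = c *: coefs p + coefs w.
Proof. by apply/rowP => i; rewrite !mxE. Qed.

Lemma shiftsD p w : shifts (p + w) = shifts p + shifts w.
Proof. by rewrite -{1}[p]scale1r shifts_linear scale1r. Qed.

Lemma coefsD p w : coefs (p + w) = coefs p + coefs w.
Proof. by rewrite -{1}[p]scale1r coefs_linear scale1r. Qed.

Lemma shifts_le p : `|shifts p| <= `|p|.
Proof. by apply: mx_norm_le => // j k; rewrite mxE coord_le_norm. Qed.

Lemma coefs_le p : `|coefs p| <= `|p|.
Proof. by apply: mx_norm_le => // j k; rewrite mxE coord_le_norm. Qed.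

Lemma pack_le z : `|pack z 0| <= `|z|.
Proof.
apply: mx_norm_le => // i l; rewrite mxE; case: (enum_val l) => [jk|j].
  exact: coord_le_norm.
by rewrite mxE normr0.
Qed.

Lemma sum_pack (W : lmodType R) (F : I -> W) w :
  \sum_l w ord0 l *: F (enum_val l) =
  \sum_j \sum_k shifts w j k *: F (inl (j, k)) + \sum_i coefs w ord0 i *: F (inr i).
Proof.
rewrite (reindex enum_rank) /=; last exact: onW_bij (enum_rank_bij _).
under eq_bigr do rewrite enum_rankK.
rewrite big_sumType /= pair_big /=; congr (_ + _).
  by apply: eq_bigr => -[j k] _ /=; rewrite mxE.
by apply: eq_bigr => i _; rewrite mxE.
Qed.

End packing.

Section euclidean_norm.
Context {R : realType} {n : nat}.

(** Separation is Euclidean, while translations are measured in the sup norm; the crude factor [n]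
    suffices for choosing [L]. *)
Lemma enorm_le (x : 'rV[R]_n) : enorm x <= n%:R * `|x|.
Proof.
have nx0 : 0 <= n%:R * `|x| by rewrite mulr_ge0.
rewrite -[leRHS](ger0_norm nx0) -sqrtr_sqr ler_wsqrtr// exprMn.
apply: (@le_trans _ _ (\sum_(i < n) `|x| ^+ 2)).
  apply: ler_sum => i _; rewrite -[leLHS]real_normK ?num_real// lerXn2r ?nnegrE//.
  exact: coord_le_norm.
rewrite sumr_const card_ord -[leLHS]mulr_natl ler_wpM2r ?sqr_ge0// expr2.
by case: (n) => [|k]; rewrite ?mul0r// ler_peMl// ler1n.
Qed.

Lemma enormZ (c : R) (x : 'rV[R]_n) : 0 <= c -> enorm (c *: x) = c * enorm x.
Proof.
move=> c0; rewrite /enorm; under eq_bigr do rewrite mxE exprMn.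
by rewrite -mulr_sumr sqrtrM ?sqr_ge0// sqrtr_sqr ger0_norm.
Qed.

End euclidean_norm.

Section soliton_manifold.
Context {R : realType} {n m d : nat}.
Local Notation V := 'rV[R]_n.
Local Notation mu := (@lebesgue_rV R n).
Local Notation H := (LfunType mu (@lee1n R 2)).
Local Notation I := ('I_m * 'I_n + 'I_d)%type.
Local Notation N := #|{: I}|.
Local Notation P := 'rV[R]_N.
Implicit Types (p w : P).
Variables (psi : H) (U : 'I_m -> H) (DU : 'I_m -> 'I_n -> H)
  (DDU : 'I_m -> 'I_n -> 'I_n -> H) (PHI : 'I_d -> H).
Hypothesis U_DU : forall j, has_weak_gradient (U j) (DU j).
Hypothesis DU_DDU : forall j k, has_weak_gradient (DU j k) (DDU j k).
Hypothesis DU_orth : forall j i k, i != k -> dot (DU j i) (DU j k) = 0.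
Hypothesis PHI_orth : forall r q, r != q -> dot (PHI r) (PHI q) = 0.

Definition soliton_sum p : H :=
  psi + \sum_j tr (row j (shifts p)) (U j) + \sum_i coefs p ord0 i *: PHI i.

(** The minus sign comes from translating by [x - y]. Up to sign these are the functions in the
    orthogonality conditions. *)
Definition tangent_at p (i : I) : H := match i with
  | inl jk => - tr (row jk.1 (shifts p)) (DU jk.1 jk.2) | inr i => PHI i end.

Definition tangent (l : 'I_N) p : H := tangent_at p (enum_val l).

(** A tangent vector moves with its own soliton only, so mixed derivatives between different
    solitons vanish. The two minus signs cancel. *)
Definition tangent_der_at p (i i' : I) : H := match i, i' with
  | inl jk, inl jk' => if jk.1 == jk'.1 then tr (row jk.1 (shifts p)) (DDU jk.1 jk.2 jk'.2) else 0
  | _, _ => 0 end.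

Definition tangent_der (l l' : 'I_N) p : H := tangent_der_at p (enum_val l) (enum_val l').

Definition gram (l : 'I_N) : R := match enum_val l with
  | inl jk => dot (DU jk.1 jk.2) (DU jk.1 jk.2) | inr i => dot (PHI i) (PHI i) end.

Let rowD (A B : 'M[R]_(m, n)) j : row j (A + B) = row j A + row j B.
Proof. by apply/rowP => k; rewrite !mxE. Qed.

Let row_le (A : 'M[R]_(m, n)) j : `|row j A| <= `|A|.
Proof. by apply: mx_norm_le => // i k; rewrite mxE coord_le_norm. Qed.

Let shift_le p j : `|row j (shifts p)| <= `|p|.
Proof. exact: le_trans (row_le _ _) (shifts_le _). Qed.

Let soliton_sumB p w : soliton_sum (p + w) - soliton_sum p =
  \sum_j (tr (row j (shifts p) + row j (shifts w)) (U j) - tr (row j (shifts p)) (U j)) +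
  \sum_i coefs w ord0 i *: PHI i.
Proof.
rewrite /soliton_sum opprD addrACA opprD [X in X + _]addrACA subrr add0r -sumrB -sumrB; congr (_ + _).
  by apply: eq_bigr => j _; rewrite shiftsD rowD.
by apply: eq_bigr => i _; rewrite coefsD mxE scalerDl [_ + coefs w _ _ *: _]addrC addrK.
Qed.

Lemma soliton_sum_diff p e : 0 < e -> exists2 r, 0 < r & forall w, `|w| < r ->
  nrm (soliton_sum (p + w) - soliton_sum p - \sum_l w ord0 l *: tangent l p) <= e * `|w|.
Proof.
move=> e0; pose e1 := e / (m%:R + 1).
have m1 : 0 < m%:R + 1 :> R by rewrite ltr_wpDl.
have e10 : 0 < e1 by rewrite divr_gt0.
have [|j|r r0 Ur] := @fin_radius R _ (fun j r => forall (y w : V), `|w| < r ->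
  nrm (tr (y + w) (U j) - tr y (U j) + \sum_k w ord0 k *: tr y (DU j k)) <= e1 * `|w|).
- by move=> j r r' r'r Ur y w wr; apply: Ur; exact: lt_le_trans r'r.
- exact: tr_diff.
exists r => // w wr; rewrite (sum_pack (tangent_at p)) soliton_sumB /tangent_at /=.
rewrite opprD addrACA subrr addr0 -sumrB.
apply: le_trans (nrm_sum _ _ _) _; apply: (@le_trans _ _ (\sum_(j < m) e1 * `|w|)).
  apply: ler_sum => j _.
  have -> : \sum_k shifts w j k *: - tr (row j (shifts p)) (DU j k) =
      - \sum_k row j (shifts w) ord0 k *: tr (row j (shifts p)) (DU j k).
    by rewrite -sumrN; apply: eq_bigr => k _; rewrite scalerN !mxE.
  rewrite opprK; apply: le_trans (Ur j _ _ _) _; first exact: le_lt_trans (shift_le _ _) _.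
  by rewrite ler_wpM2l ?shift_le// ltW.
rewrite sumr_const card_ord -[leLHS]mulr_natl mulrA ler_wpM2r// /e1 mulrCA ger_pMr//.
by rewrite ler_pdivrMr// mul1r lerDl.
Qed.

Lemma soliton_sum_lip : exists2 L, 0 <= L &
  forall p p', nrm (soliton_sum p' - soliton_sum p) <= L * `|p' - p|.
Proof.
pose C j := 2 * n%:R * (2 * \sum_k nrm (DU j k)) + \sum_k nrm (DU j k).
have C0 j : 0 <= C j.
  have s0 : 0 <= \sum_k nrm (DU j k) by apply: sumr_ge0 => k _; exact: nrm_ge0.
  by rewrite addr_ge0// !mulr_ge0.
exists (\sum_j C j + \sum_i nrm (PHI i)) => [|p p'].
  by rewrite addr_ge0// sumr_ge0// => i _; exact: nrm_ge0.
have -> : p' = p + (p' - p) by rewrite addrC subrK.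
set w := p' - p; rewrite [p + w]addrC addrK [w + p]addrC soliton_sumB mulrDl.
apply: le_trans (nrmD _ _) _; apply: lerD; apply: le_trans (nrm_sum _ _ _) _; rewrite mulr_suml;
  apply: ler_sum => j _.
  by apply: le_trans (tr_lipschitz (U_DU j) _ _) _; apply: (ler_wpM2l (C0 j)); exact: shift_le.
rewrite nrmZ mulrC ler_wpM2l ?nrm_ge0// (le_trans (coord_le_norm _ _ _))//.
exact: coefs_le.
Qed.

Lemma tangent_diff l p e : 0 < e -> exists2 r, 0 < r & forall w, `|w| < r ->
  nrm (tangent l (p + w) - tangent l p - \sum_l' w ord0 l' *: tangent_der l l' p) <= e * `|w|.
Proof.
move=> e0; rewrite /tangent /tangent_der; case: (enum_val l) => [[j k]|i] /=; last first.
  exists 1 => // w _; rewrite subrr add0r nrmN big1 ?nrm0 ?mulr_ge0 ?(ltW e0)// => l' _.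
  by rewrite scaler0.
have [r r0 Ur] := tr_diff (DU_DDU j k) e0.
exists r => // w wr.
have -> : \sum_l' w ord0 l' *: tangent_der_at p (inl (j, k)) (enum_val l') =
    \sum_k' row j (shifts w) ord0 k' *: tr (row j (shifts p)) (DDU j k k').
  rewrite (sum_pack (tangent_der_at p (inl (j, k)))) /=.
  rewrite [X in _ + X = _]big1 ?addr0 => [|i _]; last by rewrite scaler0.
  rewrite (bigD1 j)//= [X in _ + X = _]big1 ?addr0 => [|j' j'j]; last first.
    by rewrite big1// => k' _; rewrite eq_sym (negbTE j'j) scaler0.
  by apply: eq_bigr => k' _; rewrite eqxx !mxE.
rewrite -nrmN !opprD !opprK shiftsD rowD.
apply: le_trans (Ur _ _ _) _; first exact: le_lt_trans (shift_le _ _) _.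
by rewrite ler_wpM2l ?shift_le// ltW.
Qed.

Lemma tangent_dot l p : dot (tangent l p) (tangent l p) = gram l.
Proof.
rewrite /tangent /gram; case: (enum_val l) => [[j k]|i] //=.
by rewrite dotNl dotNr opprK dot_tr.
Qed.

Lemma tangent_bound : exists2 F, 0 <= F &
  (forall l p, nrm (tangent l p) <= F) /\ (forall l l' p, nrm (tangent_der l l' p) <= F).
Proof.
pose S1 := \sum_j \sum_k nrm (DU j k); pose S2 := \sum_i nrm (PHI i).
pose S3 := \sum_j \sum_k \sum_k' nrm (DDU j k k').
have S10 : 0 <= S1 by do 2 (apply: sumr_ge0 => ? _); exact: nrm_ge0.
have S20 : 0 <= S2 by apply: sumr_ge0 => ? _; exact: nrm_ge0.
have S30 : 0 <= S3 by do 3 (apply: sumr_ge0 => ? _); exact: nrm_ge0.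
exists (S1 + S2 + S3); first by rewrite !addr_ge0.
split=> [l p|l l' p].
  rewrite /tangent; case: (enum_val l) => [[j k]|i] /=.
    rewrite nrmN nrm_tr; apply: (@le_trans _ _ S1); last by rewrite -addrA lerDl addr_ge0.
    rewrite /S1 (bigD1 j)//= (bigD1 k)//= -addrA lerDl addr_ge0// sumr_ge0// => ? _; first exact: nrm_ge0.
    by apply: sumr_ge0 => ? _; exact: nrm_ge0.
  apply: (@le_trans _ _ S2); last by rewrite addrAC lerDr addr_ge0.
  by rewrite /S2 (bigD1 i)//= lerDl sumr_ge0// => ? _; exact: nrm_ge0.
rewrite /tangent_der /tangent_der_at; case: (enum_val l) => [[j k]|i]; last by rewrite nrm0 !addr_ge0.
case: (enum_val l') => [[j' k']|i']; last by rewrite nrm0 !addr_ge0.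
case: eqP => _ /=; last by rewrite nrm0 !addr_ge0.
rewrite nrm_tr; apply: (@le_trans _ _ S3); last by rewrite lerDr addr_ge0.
rewrite /S3 (bigD1 j)//= (bigD1 k)//= (bigD1 k')//= -!addrA lerDl !addr_ge0// sumr_ge0// => ? _.
- exact: nrm_ge0.
- by apply: sumr_ge0 => ? _; exact: nrm_ge0.
- by do 2 (apply: sumr_ge0 => ? _); exact: nrm_ge0.
Qed.

Lemma tangent_der_cont l l' p e : 0 < e -> exists2 r, 0 < r & forall w, `|w| < r ->
  nrm (tangent_der l l' (p + w) - tangent_der l l' p) <= e.
Proof.
move=> e0; rewrite /tangent_der /tangent_der_at.
case: (enum_val l) => [[j k]|i]; last by exists 1 => // w _; rewrite subrr nrm0 ltW.
case: (enum_val l') => [[j' k']|i']; last by exists 1 => // w _; rewrite subrr nrm0 ltW.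
case: eqP => _ /=; last by exists 1 => // w _; rewrite subrr nrm0 ltW.
have [r r0 cr] := tr_continuous (DDU j k k') e0.
exists r => // w wr; rewrite shiftsD rowD -tr_tr -trB nrm_tr.
by apply/ltW/cr; exact: le_lt_trans (shift_le _ _) _.
Qed.

Lemma gram_null j k : dot (DU j k) (DU j k) = 0 -> nrm (U j) = 0.
Proof.
move=> D0; apply: (weak_pderiv_eq0 (U_DU j k)).
by apply/eqP; rewrite -sqrf_eq0 nrm_sqr D0.
Qed.

(** If any derivative of [U j] were null, then [U j] would be null by [gram_null], and so would
    [DU j k]. Hence all coordinates of the shift of [U j] are nondegenerate together. *)
Lemma gram_nondegenerate j k p p' : dot (DU j k) (DU j k) != 0 ->
  (forall l, gram l != 0 -> p ord0 l = p' ord0 l) ->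
  row j (shifts p) = row j (shifts p').
Proof.
move=> Djk pp'; apply/rowP => k'; rewrite !mxE; apply: pp'; rewrite /gram enum_rankK /=.
apply: contra Djk => /eqP/gram_null U0.
have := weak_pderiv_null (U_DU j k) U0; rewrite -nrm_sqr => ->.
by rewrite expr0n.
Qed.

Lemma soliton_sum_deg p p' : (forall l, gram l != 0 -> p ord0 l = p' ord0 l) ->
  nrm (soliton_sum p - soliton_sum p') = 0.
Proof.
move=> pp'; have -> : p = p' + (p - p') by rewrite addrC subrK.
set w := p - p'; rewrite soliton_sumB.
apply/eqP; rewrite eq_le nrm_ge0 andbT.
apply: le_trans (nrmD _ _) _; rewrite -[leRHS]addr0; apply: lerD.
  apply: le_trans (nrm_sum _ _ _) _; apply: sumr_le0 => j _.
  have [k|none] := pickP (fun k => dot (DU j k) (DU j k) != 0).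
    move=> /gram_nondegenerate/(_ pp') pj; rewrite (_ : row j (shifts w) = 0).
      by rewrite addr0 subrr nrm0.
    apply/rowP => i; have := congr1 (fun x : V => x ord0 i) pj.
    by rewrite !mxE => ->; rewrite subrr.
  (* When all derivatives are null, [U j] is null as soon as there is a direction; for [n = 0] the
     shift itself is trivial. *)
  have [k _|n0] := pickP (fun k : 'I_n => true).
    have U0 : nrm (U j) = 0 by apply: (@gram_null j k); apply/eqP/negPn; rewrite none.
    by apply: le_trans (nrmD _ _) _; rewrite nrmN !nrm_tr U0 addr0.
  rewrite (_ : row j (shifts w) = 0) ?addr0 ?subrr ?nrm0//.
  by apply/rowP => i; have := n0 i.
apply: le_trans (nrm_sum _ _ _) _; apply: sumr_le0 => i _; rewrite nrmZ.
have [P0|Pi] := eqVneq (dot (PHI i) (PHI i)) 0.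
  suff -> : nrm (PHI i) = 0 by rewrite mulr0.
  by apply/eqP; rewrite -sqrf_eq0 nrm_sqr P0.
rewrite !mxE pp' ?subrr ?normr0 ?mul0r//.
by rewrite /gram enum_rankK.
Qed.

Lemma tangent_deg l p p' : gram l != 0 ->
  (forall l', gram l' != 0 -> p ord0 l' = p' ord0 l') -> tangent l p = tangent l p'.
Proof.
move=> + pp'; rewrite /gram /tangent; case: (enum_val l) => [[j k]|i] //= Djk.
by rewrite (gram_nondegenerate Djk pp').
Qed.

Lemma tangent_gap delta rho : 0 < delta -> 0 <= rho -> exists2 L, 0 < L &
  forall y : 'M[R]_(m, n), (forall j k, j != k -> L < enorm (row j y - row k y)) ->
    (forall j, L < enorm (row j y)) -> gap tangent delta rho (pack y 0).
Proof.
move=> d0 rho0.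
pose fn (i : I) : H := match i with inl jk => DU jk.1 jk.2 | inr i => PHI i end.
have [L L0 LP] : exists2 L, 0 < L & forall i i' : I, forall a b : V, L < `|a - b| ->
    `|dot (tr a (fn i)) (tr b (fn i'))| < delta.
  (* [fin_radius] takes minima of small radii, so a large distance is represented by its inverse. *)
  have [|i|r r0 rP] := @fin_radius R (I * I)%type (fun ii r => 0 < r ->
    forall a b : V, r^-1 < `|a - b| -> `|dot (tr a (fn ii.1)) (tr b (fn ii.2))| < delta).
  - move=> ii r r' r'r rP r'0 a b ab; have r0 := lt_le_trans r'0 r'r.
    by apply: (rP r0); apply: le_lt_trans ab; rewrite lef_pV2.
  - have [L L0 LP] := tr_orthogonal (fn i.1) (fn i.2) d0.
    by exists L^-1; rewrite ?invr_gt0// invrK.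
  by exists r^-1; rewrite ?invr_gt0// => i i'; exact: (rP (i, i')).
(* [2 * rho] allows two centres to move within the ball, and the factor [n] converts the Euclidean
   norm to the sup norm. *)
pose L1 := n%:R * (L + 2 * rho) + 1; have L10 : 0 < L1.
  by rewrite ltr_wpDl// mulr_ge0// addr_ge0 ?(ltW L0)// mulr_ge0.
have L1P (x : V) : L1 < enorm x -> L + 2 * rho < `|x|.
  move=> /lt_le_trans/(_ (enorm_le x)) xL; rewrite ltNge; apply/negP => xle.
  have : n%:R * `|x| <= n%:R * (L + 2 * rho) by rewrite ler_wpM2l.
  by move: xL; rewrite /L1; lra.
exists L1 => // y yy y0 p py.
have py_ j : `|row j (shifts p) - row j y| <= rho.
  apply: le_trans py; have -> : row j (shifts p) - row j y = row j (shifts (p - pack y 0)).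
    by apply/rowP => k; rewrite !mxE enum_rankK.
  exact: shift_le.
have zz j k : j != k -> L < `|row j (shifts p) - row k (shifts p)|.
  move=> jk; have := L1P _ (yy _ _ jk); have := py_ j; have := py_ k => pk pj h.
  have : `|row j y - row k y| <= `|row j (shifts p) - row k (shifts p)| + 2 * rho.
    have -> : row j y - row k y = (row j (shifts p) - row k (shifts p)) +
        ((row k (shifts p) - row k y) - (row j (shifts p) - row j y)).
      by apply/rowP => i; rewrite !mxE; ring.
    apply: le_trans (ler_normD _ _) _; rewrite lerD2l (le_trans (ler_normB _ _))//.
    by rewrite mulr_natl mulr2n lerD.
  by move: h; lra.
have z0 j : L < `|row j (shifts p)|.
  have := L1P _ (y0 j); have := py_ j => pj h.
  have : `|row j y| <= `|row j (shifts p)| + rho.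
    rewrite -{1}(subKr (row j (shifts p)) (row j y)) (le_trans (ler_normB _ _))//.
    by rewrite lerD2l.
  by move: h rho0; lra.
(* Derivatives of one [U j] are translated alike and stay exactly orthogonal, as do the [PHI i]. All
   other pairs are far apart, a [PHI i] counting as translated by [0]: hence the distances to the
   origin. *)
have key (i i' : I) : i != i' -> `|dot (tangent_at p i) (tangent_at p i')| <= delta.
  case: i => [[j k]|i]; case: i' => [[j' k']|i'] ii' /=; rewrite ?dotNl ?dotNr ?opprK ?normrN.
  - have [jj'|jj'] := eqVneq j j'.
      rewrite -jj' dot_tr DU_orth ?normr0 ?ltW//.
      by apply: contra ii' => /eqP ->; rewrite jj'.
    exact/ltW/(LP (inl (j, k)) (inl (j', k')))/zz.
  - rewrite -(tr0 (PHI i')); apply/ltW/(LP (inl (j, k)) (inr i')); rewrite subr0; exact: z0.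
  - rewrite -(tr0 (PHI i)); apply/ltW/(LP (inr i) (inl (j', k'))); rewrite sub0r normrN; exact: z0.
  - by rewrite PHI_orth ?normr0 ?ltW//; apply: contra ii' => /eqP ->.
by move=> l l' ll'; apply: key; rewrite (inj_eq enum_val_inj).
Qed.

End soliton_manifold.

(** * From L2 parameters to differentiability in the H^1 norm *)

Section C1_transfer.
Context {R : realType} {n m d : nat}.
Local Notation V := 'rV[R]_n.
Local Notation mu := (@lebesgue_rV R n).
Local Notation H := (LfunType mu (@lee1n R 2)).
Local Notation P := 'rV[R]_#|{: ('I_m * 'I_n + 'I_d)%type}|.
Local Notation X := (H * P)%type.

Definition param (u : V -> R) (y : 'M[R]_(m, n)) : X := (toL2 mu u, pack y 0).

Lemma paramD (u h : V -> R) (y z : 'M[R]_(m, n)) : u \in Lfun mu 2%:E -> h \in Lfun mu 2%:E ->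
  param (u + h) (y + z) = param u y + param h z.
Proof.
move=> u2 h2; congr pair; first exact: (toL2D u2 h2).2.
by have := pack_linear 1 y z (0 : 'rV[R]_d) 0; rewrite !scale1r addr0.
Qed.

Lemma paramZ c (h : V -> R) (z : 'M[R]_(m, n)) : h \in Lfun mu 2%:E ->
  param (c *: h) (c *: z) = c *: param h z.
Proof.
move=> h2; congr pair; first exact: (toL2Z c h2).2.
by have := pack_linear c z 0 (0 : 'rV[R]_d) 0; rewrite !addr0 scaler0 => ->;
  apply/rowP => l; rewrite !mxE; case: (enum_val l) => [jk|i]; rewrite !mxE addr0.
Qed.

Lemma param_le (h : V -> R) (z : 'M[R]_(m, n)) : h \in Lfun mu 2%:E ->
  nrm (param h z).1 + `|(param h z).2| <= H1norm h + `|z|.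
Proof. by move=> h2; apply: lerD; [exact: L2norm_le_H1norm|exact: pack_le]. Qed.

Lemma sobolev1_L2 (h : V -> R) : sobolev 1 h -> h \in Lfun mu 2%:E.
Proof. by case. Qed.

(** The H^1 norm dominates the L2 norm, so a derivative found in L2 serves in H^1. [F] extracts the
    shifts or the coefficients, and [E] turns absolute positions into displacements by adding
    [- y]. *)
Lemma C1_on_param (W : normedModType R) (F : P -> W) (E : 'M[R]_(m, n) -> W)
    (near : (V -> R) -> 'M[R]_(m, n) -> Prop) (sol : X -> P) (dsol : X -> X -> P) (K : R) :
  0 <= K ->
  (forall c p q, F (c *: p + q) = c *: F p + F q) -> (forall p, `|F p| <= `|p|) ->
  (forall c p q, E (c *: p + q) = c *: E p + E q) -> (forall p, `|E p| <= `|p|) ->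
  (forall u y, near u y -> u \in Lfun mu 2%:E) ->
  (forall x, (exists u y, near u y /\ x = param u y) ->
  [/\ (forall a h1 h2, dsol x (a *: h1 + h2) = a *: dsol x h1 + dsol x h2) /\
        forall h, `|dsol x h| <= K * (nrm h.1 + `|h.2|),
      forall e, 0 < e -> exists2 r, 0 < r & forall h, (exists u y, near u y /\ x + h = param u y) ->
        nrm h.1 + `|h.2| < r ->
        `|sol (x + h) - sol x - dsol x h| <= e * (nrm h.1 + `|h.2|) &
      forall e, 0 < e -> exists2 r, 0 < r & forall x', (exists u y, near u y /\ x' = param u y) ->
        nrm (x' - x).1 + `|(x' - x).2| < r ->
        forall h, `|dsol x' h - dsol x h| <= e * (nrm h.1 + `|h.2|)]) ->
  C1_on near (fun u y => F (sol (param u y)) + E y).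
Proof.
move=> K0 Flin Fle Elin Ele near2 solP.
have FB p q : F (p - q) = F p - F q by rewrite addrC -scaleN1r Flin scaleN1r addrC.
have ED p q : E (p + q) = E p + E q by rewrite -{1}[p]scale1r Elin scale1r.
exists (fun u y h z => F (dsol (param u y) (param h z)) + E z) => u y uy.
have u2 := near2 _ _ uy.
have [|[dlin dle] ddiff dcont] := solP (param u y); first by exists u, y.
split.
- move=> c h1 h2 z1 z2 /sobolev1_L2 h12 /sobolev1_L2 h22.
  have ch := (toL2Z c h12).1.
  by rewrite paramD// paramZ// dlin Flin Elin scalerDr addrACA.
- exists (K + 1) => h z /sobolev1_L2 h2; apply: le_trans (ler_normD _ _) _.
  rewrite mulrDl mul1r; apply: lerD.
    apply: le_trans (Fle _) _; apply: le_trans (dle _) _.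
    by rewrite ler_wpM2l// param_le.
  by apply: le_trans (Ele _) _; rewrite lerDr H1norm_ge0.
- move=> e e0; have [r r0 rP] := ddiff e e0; exists r => // h z /sobolev1_L2 h2 uhyz hz.
  rewrite paramD// ED.
  have -> : F (sol (param u y + param h z)) + (E y + E z) - (F (sol (param u y)) + E y) -
      (F (dsol (param u y) (param h z)) + E z) =
      F (sol (param u y + param h z) - sol (param u y) - dsol (param u y) (param h z)).
    have zid (Z : zmodType) (a b c p q : Z) : a + (p + q) - (b + p) - (c + q) = a - b - c.
      by rewrite [- (b + p)]opprD [a + _ + _]addrACA [p + q]addrC addrK [- (c + q)]opprD
        addrACA subrr addr0.
    by rewrite !FB zid.
  apply: le_trans (Fle _) _.
  have lt : nrm (param h z).1 + `|(param h z).2| < r by apply: le_lt_trans hz; exact: param_le.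
  apply: le_trans (rP _ _ lt) _; last by rewrite ler_wpM2l ?(ltW e0)// param_le.
  by exists (u + h), (y + z); rewrite paramD.
- move=> e e0; have [r r0 rP] := dcont e e0; exists r => // u' y' u'y' hr h z /sobolev1_L2 h2.
  have u'2 := near2 _ _ u'y'.
  have hE : param u' y' - param u y = param (u' - u) (y' - y).
    have uu2 := (toL2B u'2 u2).1.
    have <- : param (u' - u + u) (y' - y + y) = param u' y' by rewrite !subrK.
    by rewrite paramD ?addrK.
  rewrite opprD addrACA subrr addr0 -FB; apply: le_trans (Fle _) _.
  apply: le_trans (rP _ _ _ _) _.
  + by exists u', y'.
  + by rewrite hE; apply: le_lt_trans hr; apply: param_le; exact: (toL2B u'2 u2).1.
  + by rewrite ler_wpM2l ?(ltW e0)// param_le.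
Qed.

Lemma C1_on_continuous (W : normedModType R) (D : (V -> R) -> 'M[R]_(m, n) -> Prop)
    (F : (V -> R) -> 'M[R]_(m, n) -> W) : C1_on D F ->
  forall u y, D u y -> forall e, 0 < e -> exists2 r, 0 < r &
  forall u' y', D u' y' -> sobolev 1 (u' - u) -> H1norm (u' - u) + `|y' - y| < r ->
    `|F u' y' - F u y| <= e.
Proof.
move=> [dF dFP] u y uy e e0; have [_ [K KP] /(_ 1 ltr01)[r r0 rP] _] := dFP u y uy.
have K1 : 0 < `|K| + 1 by rewrite ltr_wpDl.
exists (Num.min r (e / (`|K| + 1))) => [|u' y' u'y' su]; first by rewrite lt_min r0 divr_gt0.
rewrite lt_min => /andP[hr he].
have uE : u + (u' - u) = u' by rewrite addrC subrK.
have yE : y + (y' - y) = y' by rewrite addrC subrK.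
have := rP (u' - u) (y' - y) su; rewrite uE yE => /(_ u'y' hr).
have := KP (u' - u) (y' - y) su; set a := dF _ _ _ _; set b := F u' y' - F u y.
set q := H1norm _ + _ in hr he * => aK ba.
have q0 : 0 <= q by rewrite addr_ge0// H1norm_ge0.
rewrite -(subrK a b); apply: le_trans (ler_normD _ _) _; apply: le_trans (lerD ba aK) _.
rewrite -mulrDl; move: he; rewrite ltr_pdivlMr// => /ltW; apply: le_trans.
by rewrite mulrC ler_wpM2l// addrC lerD2r ler_norm.
Qed.

End C1_transfer.

(** * Decompositions as critical points *)

Section decomposition.
Context {R : realType} {n m d : nat}.
Local Notation V := 'rV[R]_n.
Local Notation mu := (@lebesgue_rV R n).
Local Notation H := (LfunType mu (@lee1n R 2)).
Variables (psi : V -> R) (u_ : 'I_m -> V -> R) (phi_ : 'I_d -> V -> R).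
Hypothesis psi_H1 : sobolev 1 psi.
Hypothesis u_H1 : forall j, sobolev 1 (u_ j).
Hypothesis phi_H1 : forall i, sobolev 1 (phi_ i).
Variable DU : 'I_m -> 'I_n -> H.
Hypothesis DUE : forall j k, DU j k = pderiv k (u_ j) :> (V -> R).

Local Notation U := (fun j => toL2 mu (u_ j)).
Local Notation PHI := (fun i => toL2 mu (phi_ i)).
Local Notation Q := (soliton_sum (toL2 mu psi) U PHI).

Lemma multisoliton_L2 y : multisoliton psi u_ y \in Lfun mu 2%:E /\
  toL2 mu (multisoliton psi u_ y) = toL2 mu psi + \sum_j tr (row j y) (toL2 mu (u_ j)).
Proof.
have t2 j : translate (row j y) (u_ j) \in Lfun mu 2%:E.
  by apply: translate_L2; exact: sobolev1_L2.
have [s2 sE] := toL2_sum t2.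
have [m2 mE] := toL2D (sobolev1_L2 psi_H1) s2.
split=> //; rewrite mE sE; congr (_ + _); apply: eq_bigr => j _.
by rewrite toL2_translate//; exact: sobolev1_L2.
Qed.

Lemma ansatz_L2 y (a : 'rV[R]_d) :
  multisoliton psi u_ y + \sum_i a ord0 i *: phi_ i \in Lfun mu 2%:E /\
  toL2 mu (multisoliton psi u_ y + \sum_i a ord0 i *: phi_ i) = Q (pack y a).
Proof.
have [m2 mE] := multisoliton_L2 y.
have p2 i : a ord0 i *: phi_ i \in Lfun mu 2%:E.
  by apply: (toL2Z _ (sobolev1_L2 (phi_H1 i))).1.
have [s2 sE] := toL2_sum p2; have [a2 aE] := toL2D m2 s2.
split=> //; rewrite aE mE sE /soliton_sum; congr (_ + _ + _).
  by apply: eq_bigr => j _; rewrite shifts_pack.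
by apply: eq_bigr => i _; rewrite coefs_pack (toL2Z _ (sobolev1_L2 (phi_H1 i))).2.
Qed.

Lemma ansatz_sobolev y (a : 'rV[R]_d) :
  sobolev 1 (multisoliton psi u_ y + \sum_i a ord0 i *: phi_ i).
Proof.
have [a2 aE] := ansatz_L2 y a; apply/sobolev1P; split=> //; rewrite aE.
have [_ [gp gpP]] := (sobolev1P _).1 psi_H1.
have /choice[gu guP] : forall j, exists g, has_weak_gradient (toL2 mu (u_ j)) g.
  by move=> j; have [] := (sobolev1P _).1 (u_H1 j).
have /choice[gf gfP] : forall i, exists g, has_weak_gradient (toL2 mu (phi_ i)) g.
  by move=> i; have [] := (sobolev1P _).1 (phi_H1 i).
eexists; apply: weak_gradientD; first apply: weak_gradientD; first exact: gpP.
  by apply: weak_gradient_sum => j; apply: weak_gradient_tr; exact: guP.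
by apply: weak_gradient_sum => i; apply: weak_gradientZ; exact: gfP.
Qed.

Lemma sobolev1B (f g : V -> R) : sobolev 1 f -> sobolev 1 g -> sobolev 1 (f - g).
Proof.
move=> /sobolev1P[f2 [f' ff']] /sobolev1P[g2 [g' gg']].
have [fg2 fgE] := toL2B f2 g2; apply/sobolev1P; split=> //; rewrite fgE.
eexists; apply: weak_gradientD ff' _; rewrite -scaleN1r; exact: weak_gradientZ.
Qed.

Lemma L2dot_toL2 (f g : V -> R) : f \in Lfun mu 2%:E -> g \in Lfun mu 2%:E ->
  L2dot f g = dot (toL2 mu f) (toL2 mu g).
Proof. by move=> f2 g2; rewrite /dot !toL2K. Qed.

Lemma residual_orthogonal (v : V -> R) (z : 'M[R]_(m, n)) (a : 'rV[R]_d) : v \in Lfun mu 2%:E ->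
  ((forall k j, L2dot v (translate (row j z) (pderiv k (u_ j))) = 0) /\
   (forall i, L2dot v (phi_ i) = 0)) <->
  forall l, dot (toL2 mu v) (tangent DU PHI l (pack z a)) = 0.
Proof.
move=> v2.
have tE k j : L2dot v (translate (row j z) (pderiv k (u_ j))) =
    dot (toL2 mu v) (tr (row j z) (DU j k)).
  by rewrite -DUE L2dot_toL2// ?translate_L2 ?LfunP// /tr toL2_val.
have pE i : L2dot v (phi_ i) = dot (toL2 mu v) (toL2 mu (phi_ i)).
  by rewrite L2dot_toL2//; exact: sobolev1_L2.
split=> [[vt vp] l|vl].
  rewrite /tangent /tangent_at; case: (enum_val l) => [[j k]|i] /=; last by rewrite -pE.
  by rewrite dotNr shifts_pack -tE vt oppr0.
split=> [k j|i].
  have := vl (enum_rank (inl (j, k))); rewrite /tangent enum_rankK /= dotNr shifts_pack -tE.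
  by move/eqP; rewrite oppr_eq0 => /eqP.
by have := vl (enum_rank (inr i)); rewrite /tangent enum_rankK /= -pE.
Qed.

(** The remainder [v] is determined almost everywhere as [u] minus the ansatz, and inner products
    ignore null sets. Conversely this difference belongs to H^1, as both terms do. *)
Lemma decomposesP u y s (a : 'rV[R]_d) : sobolev 1 u ->
  decomposes psi u_ phi_ u y s a <->
  forall l, dot (toL2 mu u - Q (pack (y + s) a)) (tangent DU PHI l (pack (y + s) a)) = 0.
Proof.
move=> su; have u2 := sobolev1_L2 su; have [a2 aE] := ansatz_L2 (y + s) a.
have [r2 rE] := toL2B u2 a2.
split=> [[v [sv uv vt vp]] l|crit].
  have v2 := sobolev1_L2 sv.
  rewrite -aE -rE; rewrite (@dot_ae _ _ _ _ _ (toL2 mu v)).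
    by apply: (residual_orthogonal _ _ v2).1.
  apply: filterS uv => x + _ => /(_ I) ux; rewrite !toL2K//.
  rewrite -[LHS]/(u x - (multisoliton psi u_ (y + s) x + (\sum_i a ord0 i *: phi_ i) x)) ux.
  rewrite -[X in X - _]/(multisoliton psi u_ (y + s) x + v x + (\sum_i a ord0 i *: phi_ i) x).
  ring.
exists (u - (multisoliton psi u_ (y + s) + \sum_i a ord0 i *: phi_ i)).
have [vt vp] := (residual_orthogonal _ a r2).2 (fun l => etrans (congr1 (fun w => dot w _) rE)
  (etrans (congr1 (fun w => dot (_ - w) _) aE) (crit l))).
split=> //; first by apply: sobolev1B => //; exact: ansatz_sobolev.
apply: aeW => x _.
set b := multisoliton _ _ _; set c := \sum_i _.
rewrite -[RHS]/(b x + (u x - (b x + c x)) + c x).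
ring.
Qed.

Lemma defectE u y : u \in Lfun mu 2%:E ->
  defect psi u_ u y = nrm (toL2 mu u - Q (pack y 0)).
Proof.
move=> u2; have [a2 aE] := ansatz_L2 y 0.
have mE : multisoliton psi u_ y + \sum_i (0 : 'rV[R]_d) ord0 i *: phi_ i = multisoliton psi u_ y.
  by rewrite big1 ?addr0// => i _; rewrite mxE scale0r.
rewrite mE in a2 aE; have [r2 rE] := toL2B u2 a2.
by rewrite /defect L2norm_toL2// rE aE.
Qed.

End decomposition.

(** * Uniqueness *)

Section connectedness.
Context {R : realType}.

(** The values of [D] avoid the open interval from [0] to [c], so by the intermediate value theorem
    [D] cannot rise from [0] to a value at least [c]. *)
Lemma continuation (D : R -> R) (a b c : R) : a <= b -> 0 < c -> (forall t, 0 <= D t) ->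
  (forall t, a <= t -> t <= b -> forall e, 0 < e -> exists2 r, 0 < r &
    forall t', a <= t' -> t' <= b -> `|t' - t| < r -> `|D t' - D t| <= e) ->
  D b < c -> (forall t, a <= t -> t <= b -> D t < c -> D t = 0) -> D a = 0.
Proof.
move=> ab c0 D0 Dc Dbc Dz; apply: contrapT => /eqP Da0.
have Db : D b = 0 by exact: Dz.
have Dac : c <= D a.
  by rewrite leNgt; apply/negP => /Dz h; rewrite h ?eqxx in Da0.
(* Clamping to the segment extends [D] to a continuous function on the line. *)
pose cl t := Num.max a (Num.min t b).
have cl_ge t : a <= cl t by rewrite le_max lexx.
have cl_le t : cl t <= b by rewrite ge_max ab ge_min lexx orbT.
have clE t : a <= t -> t <= b -> cl t = t.
  by move=> at_ tb; rewrite /cl min_l// max_r.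
have cl_lip s t : `|cl s - cl t| <= `|s - t|.
  rewrite /cl; case: (leP s b) => sb; case: (leP t b) => tb.
  - by case: (leP a s) => as_; case: (leP a t) => at_; rewrite ?subrr ?normr0//;
      rewrite ler_norml; apply/andP; split; move: (ler_norm (s - t)) (ler_norm (t - s));
      rewrite (distrC t s); lra.
  - by case: (leP a s) => as_; case: (leP a b) => ab'; rewrite ?subrr ?normr0//;
      rewrite ler_norml; apply/andP; split; move: (ler_norm (s - t)) (ler_norm (t - s));
      rewrite (distrC t s); lra.
  - by case: (leP a b) => ab'; case: (leP a t) => at_; rewrite ?subrr ?normr0//;
      rewrite ler_norml; apply/andP; split; move: (ler_norm (s - t)) (ler_norm (t - s));
      rewrite (distrC t s); lra.
  - by rewrite subrr normr0.
have cD : {within `[a, b], continuous (D \o cl)}.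
  apply: continuous_subspaceT => t; apply/cvgrPdist_le => e e0.
  have [r r0 rP] := Dc (cl t) (cl_ge t) (cl_le t) e e0.
  apply/nbhs_ballP; exists r => //= s; rewrite /ball/= => ts; rewrite distrC; apply: rP => //.
  by apply: le_lt_trans (cl_lip _ _) _; rewrite distrC.
have [|t] := @IVT R (D \o cl) a b (c / 2) ab cD.
  rewrite /= !clE// Db; apply/andP; split.
    by rewrite ge_min divr_ge0 ?orbT// ltW.
  by rewrite le_max (le_trans _ Dac)// ler_pdivrMr// ler_peMr ?ler1n// ltW.
rewrite in_itv/= => /andP[at_ tb] /=; rewrite clE// => Dt.
have : D t = 0 by apply: Dz => //; rewrite Dt ltr_pdivrMr// ltr_pMr// ltr1n.
by rewrite Dt => /eqP; rewrite mulf_eq0 invr_eq0 pnatr_eq0 orbF => /eqP c00; rewrite c00 ltxx in c0.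
Qed.

End connectedness.

Section path.
Context {R : realType} {n m d : nat}.
Local Notation V := 'rV[R]_n.
Local Notation mu := (@lebesgue_rV R n).
Local Notation H := (LfunType mu (@lee1n R 2)).
Variables (psi : V -> R) (u_ : 'I_m -> V -> R).
Hypothesis psi_H1 : sobolev 1 psi.
Hypothesis u_H1 : forall j, sobolev 1 (u_ j).

Definition path_fun (u : V -> R) (y : 'M[R]_(m, n)) (t : R) : V -> R :=
  multisoliton psi u_ (t *: y) + t^-1 *: (u - multisoliton psi u_ y).

Let multisoliton_sobolev y : sobolev 1 (multisoliton psi u_ y).
Proof.
(* With [d = 0] the sum over the [phi_i] is empty. *)
have := @ansatz_sobolev R n m 0 psi u_ (fun _ => psi) psi_H1 u_H1 (fun _ => psi_H1) y 0.
by rewrite big_ord0 addr0.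
Qed.

Lemma row_scale (t : R) (y : 'M[R]_(m, n)) j : row j (t *: y) = t *: row j y.
Proof. by apply/rowP => k; rewrite !mxE. Qed.

(** Distances are multiplied by [t] and the defect is divided by it, so for [t >= 1] the path cannot
    leave the domain. *)
Lemma near_path L eps u y t : 1 <= t -> 0 <= L -> near_multisoliton psi u_ L eps u y ->
  near_multisoliton psi u_ L eps (path_fun u y t) (t *: y) /\
  defect psi u_ (path_fun u y t) (t *: y) = t^-1 * defect psi u_ u y.
Proof.
move=> t1 L0 [su yy uy y0]; have t0 : 0 < t by exact: lt_le_trans t1.
have u2 := sobolev1_L2 su; have m2 z := sobolev1_L2 (multisoliton_sobolev z).
have [r2 rE] := toL2B u2 (m2 y); have [tr2 trE'] := toL2Z t^-1 r2.
have dE : defect psi u_ (path_fun u y t) (t *: y) = t^-1 * defect psi u_ u y.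
  rewrite /defect /path_fun addrAC subrr add0r !L2norm_toL2//.
  by rewrite trE' nrmZ ger0_norm// invr_ge0 ltW.
have grow (x : V) : L < enorm x -> L < enorm (t *: x).
  move=> Lx; rewrite enormZ ?ltW//; apply: lt_le_trans Lx _.
  by rewrite ler_peMl// sqrtr_ge0.
split=> //; split=> [|j k jk||j].
- have -> : path_fun u y t = multisoliton psi u_ (t *: y) - (- t^-1) *: (u - multisoliton psi u_ y).
    by rewrite scaleNr opprK.
  apply: sobolev1B => //.
  have [_ [g gP]] := (sobolev1P _).1 (sobolev1B su (multisoliton_sobolev y)).
  apply/sobolev1P; have [a2 aE] := toL2Z (- t^-1) r2; split=> //; rewrite aE.
  by eexists; exact: weak_gradientZ gP.
- by rewrite !row_scale -scalerBr; exact/grow/yy.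
- rewrite dE; apply: le_lt_trans uy; apply: ler_piMl; last by rewrite invf_le1.
  by rewrite /defect /L2norm fine_ge0// Lnorm_ge0.
- by rewrite row_scale; exact/grow/y0.
Qed.

Lemma tr_line_continuous (f : H) (x : V) e : 0 < e -> exists2 r, 0 < r &
  forall t t' : R, `|t' - t| < r -> nrm (tr (t' *: x) f - tr (t *: x) f) <= e.
Proof.
move=> e0; have [r r0 fr] := tr_continuous f e0.
have x0 : 0 < `|x| + 1 by rewrite ltr_wpDl.
exists (r / (`|x| + 1)) => [|t t']; first by rewrite divr_gt0.
rewrite ltr_pdivlMr// => tt'.
have -> : tr (t' *: x) f - tr (t *: x) f = tr (t *: x) (tr ((t' - t) *: x) f - f).
  by rewrite trB tr_tr -scalerDl [t + _]addrC subrK.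
rewrite nrm_tr; apply/ltW/fr; rewrite normrZ; apply: le_lt_trans tt'.
by rewrite ler_wpM2l// lerDl.
Qed.

(** Continuity in H^1 is L2 continuity of translations, used for the [u_j] and for their weak
    gradients, together with continuity of [t^-1] in front of a fixed function. *)
Lemma path_continuous u y t e : sobolev 1 u -> 1 <= t -> 0 < e -> exists2 r, 0 < r &
  forall t', 1 <= t' -> `|t' - t| < r ->
    sobolev 1 (path_fun u y t' - path_fun u y t) /\
    H1norm (path_fun u y t' - path_fun u y t) + `|t' *: y - t *: y| < e.
Proof.
move=> su t1 e0; have u2 := sobolev1_L2 su; have m2 z := sobolev1_L2 (multisoliton_sobolev z).
have [r2 rE] := toL2B u2 (m2 y).
have [_ [wg wgP]] := (sobolev1P _).1 (sobolev1B su (multisoliton_sobolev y)).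
have /choice[gu guP] : forall j, exists g, has_weak_gradient (toL2 mu (u_ j)) g.
  by move=> j; have [] := (sobolev1P _).1 (u_H1 j).
set w := toL2 mu (u - multisoliton psi u_ y) in wgP.
(* The sum of all bounds in units of [e1], with [1] to spare for strictness. *)
pose C := m%:R + nrm w + \sum_(k < n) (m%:R + nrm (wg k)) + `|y| + 1.
have C0 : 0 < C.
  rewrite ltr_wpDl// !addr_ge0 ?nrm_ge0 ?sumr_ge0// => k _.
  by rewrite addr_ge0 ?nrm_ge0.
pose e1 := e / C; have e10 : 0 < e1 by rewrite divr_gt0.
have [|j|ru ru0 ruP] := @fin_radius R _ (fun j r => forall t t' : R, `|t' - t| < r ->
  nrm (tr (t' *: row j y) (toL2 mu (u_ j)) - tr (t *: row j y) (toL2 mu (u_ j))) <= e1).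
- by move=> j r r' r'r rP s s' ss'; apply: rP; exact: lt_le_trans r'r.
- exact: tr_line_continuous.
have [|jk|rg rg0 rgP] := @fin_radius R ('I_m * 'I_n)%type (fun jk r => forall t t' : R, `|t' - t| < r ->
  nrm (tr (t' *: row jk.1 y) (gu jk.1 jk.2) - tr (t *: row jk.1 y) (gu jk.1 jk.2)) <= e1).
- by move=> j r r' r'r rP s s' ss'; apply: rP; exact: lt_le_trans r'r.
- exact: tr_line_continuous.
exists (Num.min e1 (Num.min ru rg)) => [|t' t'1]; first by rewrite !lt_min e10 ru0.
rewrite !lt_min => /and3P[te1 tru trg].
pose h : H := \sum_j (tr (t' *: row j y) (toL2 mu (u_ j)) - tr (t *: row j y) (toL2 mu (u_ j))) +
  (t'^-1 - t^-1) *: w.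
pose g k : H := \sum_j (tr (t' *: row j y) (gu j k) - tr (t *: row j y) (gu j k)) +
  (t'^-1 - t^-1) *: wg k.
have hg : has_weak_gradient h g.
  apply: weak_gradientD; last exact: weak_gradientZ.
  apply: weak_gradient_sum => j k.
  have := weak_gradientD (weak_gradient_tr (t' *: row j y) (guP j))
    (weak_gradientZ (-1) (weak_gradient_tr (t *: row j y) (guP j))) k.
  by rewrite !scaleN1r.
have pE s : path_fun u y s \in Lfun mu 2%:E /\ toL2 mu (path_fun u y s) =
   toL2 mu psi + \sum_j tr (s *: row j y) (toL2 mu (u_ j)) + s^-1 *: w.
  have [a2 aE] := toL2Z s^-1 r2; have [b2 bE] := toL2D (m2 (s *: y)) a2.
  split=> //; rewrite bE aE (multisoliton_L2 psi_H1 u_H1 _).2; congr (_ + _ + _).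
  by apply: eq_bigr => j _; rewrite row_scale.
have [p2 pdE] := toL2B (pE t').1 (pE t).1.
have hE : toL2 mu (path_fun u y t' - path_fun u y t) = h.
  rewrite pdE (pE t').2 (pE t).2 /h sumrB scalerBl opprD addrACA; congr (_ + _).
  by rewrite opprD addrACA subrr add0r.
split; first by apply/sobolev1P; split=> //; rewrite hE; exists g.
rewrite -(toL2K p2) hE; apply: le_lt_trans (lerD (H1norm_le hg) (lexx _)) _.
(* As [t] and [t'] are at least [1], inversion does not increase their distance. *)
have ti : `|t'^-1 - t^-1| <= e1.
  have t0 : 0 < t by exact: lt_le_trans t1.
  have t'0 : 0 < t' by exact: lt_le_trans t'1.
  have -> : t'^-1 - t^-1 = (t - t') / (t * t') by field; rewrite !lt0r_neq0.
  rewrite normrM distrC normfV ler_pdivrMr ?normr_gt0 ?mulf_neq0 ?lt0r_neq0//.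
  apply: le_trans (ltW te1) _; apply: ler_peMr; first exact: ltW.
  by rewrite ger0_norm ?mulr_ege1// mulr_ge0// ltW.
have tb (F1 : 'I_m -> H) (w1 : H) : (forall j, nrm (F1 j) <= e1) ->
    nrm (\sum_j F1 j + (t'^-1 - t^-1) *: w1) <= e1 * (m%:R + nrm w1).
  move=> F1e; apply: le_trans (nrmD _ _) _; rewrite mulrDr; apply: lerD.
    apply: le_trans (nrm_sum _ _ _) _; apply: (@le_trans _ _ (\sum_(j < m) e1)).
      by apply: ler_sum => j _.
    by rewrite sumr_const card_ord mulr_natr.
  by rewrite nrmZ ler_wpM2r ?nrm_ge0.
have hb : nrm h <= e1 * (m%:R + nrm w) by apply: tb => j; exact: ruP.
have gb : \sum_k nrm (g k) <= e1 * \sum_(k < n) (m%:R + nrm (wg k)).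
  rewrite mulr_sumr; apply: ler_sum => k _; apply: tb => j; exact: (rgP (j, k)).
have yb : `|t' *: y - t *: y| <= e1 * `|y|.
  by rewrite -scalerBl normrZ ler_wpM2r// ltW.
have eC : e = e1 * C by rewrite /e1 divfK// lt0r_neq0.
rewrite eC /C !mulrDr -mulrDr mulr1; apply: le_lt_trans (lerD (lerD hb gb) yb) _.
by rewrite mulrDr ltrDl.
Qed.

End path.

(** * Existence and uniqueness of the modulation parameters *)

Section modulation_parameters.
Context {R : realType} {n m d : nat}.
Local Notation V := 'rV[R]_n.
Local Notation mu := (@lebesgue_rV R n).
Local Notation P := 'rV[R]_#|{: ('I_m * 'I_n + 'I_d)%type}|.

Lemma sobolev21 (f : V -> R) : sobolev 2 f -> sobolev 1 f.
Proof.
by move=> [f2 fk]; split=> // k; have [g [g2 _] fg] := fk k; exists g.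
Qed.

Lemma pack_unpack (p : P) : pack (shifts p) (coefs p) = p.
Proof.
apply/rowP => l; rewrite mxE -[in RHS](enum_valK l).
by case: (enum_val l) => [[j k]|i]; rewrite mxE.
Qed.

Lemma pack_le2 (z : 'M[R]_(m, n)) (a : 'rV[R]_d) : `|pack z a| <= `|z| + `|a|.
Proof.
apply: mx_norm_le => [|i l]; first by rewrite addr_ge0.
rewrite mxE; case: (enum_val l) => [jk|j].
  by rewrite (le_trans (coord_le_norm _ _ _))// lerDl.
by rewrite (le_trans (coord_le_norm _ _ _))// lerDr.
Qed.

Lemma packB (z z' : 'M[R]_(m, n)) (a a' : 'rV[R]_d) :
  pack (z - z') (a - a') = pack z a - pack z' a'.
Proof. by apply/rowP => l; rewrite !mxE; case: (enum_val l) => [jk|i]; rewrite !mxE. Qed.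

Lemma far_path (psi : V -> R) (u_ : 'I_m -> V -> R) (L eps M eta : R) u y :
  sobolev 1 psi -> (forall j, sobolev 1 (u_ j)) -> 0 < L -> 0 <= M -> 0 < eta ->
  near_multisoliton psi u_ L eps u y -> exists2 T, 1 <= T & forall t, T <= t ->
  (M%:E < separation (t *: y))%E /\
  defect psi u_ (path_fun psi u_ u y t) (t *: y) < eta.
Proof.
move=> psi1 u1 L0 M0 eta0 uy.
have D0 : 0 <= defect psi u_ u y by rewrite /defect /L2norm fine_ge0// Lnorm_ge0.
have ML0 : 0 <= M / L by rewrite divr_ge0// ltW.
have De0 : 0 <= defect psi u_ u y / eta by rewrite divr_ge0// ltW.
(* At time [t] the separation is at least [t * L] and the defect is divided by [t]; the last two
   summands make these pass [M] and [eta]. *)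
exists (1 + M / L + defect psi u_ u y / eta) => [|t tT].
  by rewrite -addrA lerDl addr_ge0.
have t1 : 1 <= t by apply: le_trans tT; rewrite -addrA lerDl addr_ge0.
have t0 : 0 < t by exact: lt_le_trans t1.
have [_ dE] := near_path psi1 u1 t1 (ltW L0) uy; have [_ yy _ y0] := uy; split.
  have tL : M < t * L.
    rewrite -ltr_pdivrMr//; apply: lt_le_trans tT; rewrite addrAC ltrDr.
    by rewrite ltr_pwDl.
  apply: (@lt_le_trans _ _ (t * L)%:E); first by rewrite lte_fin.
  apply: le_ereal_inf_tmp => _ [[j _ <-]|[[j k] /= jk <-]]; rewrite lee_fin.
    by rewrite row_scale enormZ ?(ltW t0)// ler_wpM2l ?(ltW t0)// ltW.
  by rewrite !row_scale -scalerBr enormZ ?(ltW t0)// ler_wpM2l ?(ltW t0)// ltW// yy.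
rewrite dE mulrC ltr_pdivrMr// mulrC -ltr_pdivrMr//; apply: lt_le_trans tT.
by rewrite ltrDr ltr_pwDl.
Qed.

End modulation_parameters.

Theorem proposition7p6 (R : realType) (n m d : nat) (hn : (0 < n)%N)
    (u_ : 'I_m -> 'rV[R]_n -> R) (phi_ : 'I_d -> 'rV[R]_n -> R)
    (psi : 'rV[R]_n -> R) (C alpha : R) (hC : 0 < C) (halpha : 0 < alpha)
    (u_C1 : forall j, continuously_differentiable 1 (u_ j))
    (u_H2 : forall j, sobolev 2 (u_ j))
    (phi_C1 : forall i, continuously_differentiable 1 (phi_ i))
    (phi_H2 : forall i, sobolev 2 (phi_ i))
    (u_decay : forall x j k,
      `|pderiv k (u_ j) x| <= C * expR (- (alpha * enorm x)))
    (phi_decay : forall x i, `|phi_ i x| <= C * expR (- (alpha * enorm x)))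
    (u_orth : forall j (i k : 'I_n), i != k ->
      L2dot (pderiv i (u_ j)) (pderiv k (u_ j)) = 0)
    (phi_orth : forall r q : 'I_d, r != q -> L2dot (phi_ r) (phi_ q) = 0)
    (psi_H2 : sobolev 2 psi) :
  exists L eps : R, [/\ 0 < L, 0 < eps &
    exists (S : ('rV[R]_n -> R) -> 'M[R]_(m, n) -> 'M[R]_(m, n))
           (A : ('rV[R]_n -> R) -> 'M[R]_(m, n) -> 'rV[R]_d),
      modulation psi u_ phi_ L eps S A /\
      forall S' A', modulation psi u_ phi_ L eps S' A' ->
        forall u y, near_multisoliton psi u_ L eps u y ->
          (forall j, (exists x, u_ j x != 0) ->
             row j (S' u y) = row j (S u y)) /\
          (forall i, (exists x, phi_ i x != 0) ->
             A' u y ord0 i = A u y ord0 i)].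
Proof.
pose mu := @lebesgue_rV R n.
have psi1 := sobolev21 psi_H2; have u1 j := sobolev21 (u_H2 j).
have phi1 i := sobolev21 (phi_H2 i).
have /choice[G GP] : forall j, exists G : ('I_n -> LfunType mu (@lee1n R 2)) *
    ('I_n -> 'I_n -> LfunType mu (@lee1n R 2)),
  [/\ forall k, G.1 k = pderiv k (u_ j) :> ('rV[R]_n -> R), has_weak_gradient (toL2 mu (u_ j)) G.1 &
      forall k, has_weak_gradient (G.1 k) (G.2 k)].
  by move=> j; have [g [dg gP]] := regular_gradient (u_C1 j) (u_H2 j); exists (g, dg).
pose DU j := (G j).1; pose DDU j := (G j).2.
have DUE j k : DU j k = pderiv k (u_ j) :> ('rV[R]_n -> R) by have [+ _ _] := GP j; exact.
have U_DU j : has_weak_gradient (toL2 mu (u_ j)) (DU j) by case: (GP j).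
have DU_DDU j k : has_weak_gradient (DU j k) (DDU j k) by have [_ _] := GP j; exact.
pose PHI i := toL2 mu (phi_ i).
have DU_orth j i k : i != k -> dot (DU j i) (DU j k) = 0.
  by move=> ik; have := u_orth j i k ik; rewrite -!DUE.
have PHI_orth r q : r != q -> dot (PHI r) (PHI q) = 0.
  by move=> rq; rewrite -L2dot_toL2 ?phi_orth//; exact: sobolev1_L2.
pose Q := soliton_sum (toL2 mu psi) (fun j => toL2 mu (u_ j)) PHI.
have [F F0 [f_le f'_le]] := tangent_bound DU DDU PHI.
have [LQ LQ0 Qlip] := soliton_sum_lip (toL2 mu psi) PHI U_DU.
have [rho [delta [eps [K [sol [dsol [[rho0 delta0 eps0 K0] solP]]]]]]] :=
  projection_C1 F0 LQ0 (soliton_sum_diff (toL2 mu psi) PHI U_DU) Qlip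
    (tangent_diff PHI DU_DDU) f_le f'_le (tangent_der_cont DDU)
    (tangent_dot DU PHI) (soliton_sum_deg (toL2 mu psi) (PHI := PHI) U_DU) (tangent_deg (PHI := PHI) U_DU).
have [L L0 LP] := tangent_gap DU_orth PHI_orth delta0 (ltW rho0).
pose near := near_multisoliton psi u_ L eps.
pose Dom x := exists u y, near u y /\ x = param (d := d) u y.
have near2 u y : near u y -> u \in Lfun mu 2%:E by case=> /sobolev1_L2.
have defE u y : near u y -> defect psi u_ u y = nrm ((param (d := d) u y).1 - Q (param u y).2).
  by move=> uy; exact: defectE psi1 u1 phi1 _ _ (near2 _ _ uy).
have {}solP := solP Dom.
have DomP x : Dom x -> nrm (x.1 - Q x.2) < eps /\ gap (tangent DU PHI) delta rho x.2.
  move=> [u [y [uy ->]]]; rewrite -defE//; case: uy => _ yy de y0; split=> //.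
  exact: LP.
have {}solP := solP DomP.
have DomI u y : near u y -> Dom (param u y) by move=> uy; exists u, y.
pose S u y := shifts (sol (param u y)) - y; pose A u y := coefs (sol (param u y)).
have solE u y : pack (y + S u y) (A u y) = sol (param u y).
  by rewrite /S addrC subrK pack_unpack.
have C1sol x : Dom x -> [/\ (forall a h1 h2, dsol x (a *: h1 + h2) = a *: dsol x h1 + dsol x h2) /\
        forall h, `|dsol x h| <= K * (nrm h.1 + `|h.2|),
      forall e, 0 < e -> exists2 r, 0 < r & forall h, Dom (x + h) ->
        nrm h.1 + `|h.2| < r ->
        `|sol (x + h) - sol x - dsol x h| <= e * (nrm h.1 + `|h.2|) &
      forall e, 0 < e -> exists2 r, 0 < r & forall x', Dom x' ->
        nrm (x' - x).1 + `|(x' - x).2| < r ->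
        forall h, `|dsol x' h - dsol x h| <= e * (nrm h.1 + `|h.2|)].
  by move=> /solP[].
have K1 : 0 < K + 1 by rewrite ltr_wpDl.
have sol_small u y e : near u y -> 0 < e -> defect psi u_ u y < e / (K + 1) ->
    `|sol (param u y) - pack y 0| < e.
  move=> uy e0; rewrite ltr_pdivlMr// => de; have [[_ sK _] _ _ _ _] := solP _ (DomI _ _ uy).
  apply: le_lt_trans sK _; apply: le_lt_trans de; rewrite -defE// mulrC ler_wpM2l ?lerDl//.
  by rewrite /defect /L2norm fine_ge0// Lnorm_ge0.
have SAmod : modulation psi u_ phi_ L eps S A.
  split.
  - split.
      apply: (C1_on_param K0 (@shifts_linear _ _ _ _) (@shifts_le _ _ _ _)
        (E := fun z => - z) _ _ near2 C1sol).
        by move=> c p q; rewrite opprD scalerN.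
      by move=> p; rewrite normrN.
    have -> : A = fun u y => coefs (sol (param u y)) + 0.
      by apply/funext => u; apply/funext => y; rewrite addr0.
    apply: (C1_on_param K0 (@coefs_linear _ _ _ _) (@coefs_le _ _ _ _)
      (E := fun=> 0) _ _ near2 C1sol).
      by move=> c p q; rewrite scaler0 addr0.
    by move=> p; rewrite normr0.
  - move=> u y uy; apply/(decomposesP psi1 u1 phi1 DUE); first by case: uy.
    by rewrite solE; have [[_ _]] := solP _ (DomI _ _ uy).
  (* The bound of the solution by the defect holds on the whole domain, so the separation threshold
     [1] is arbitrary. *)
  - move=> e e0; exists 1, (e / (K + 1)); split=> //; first exact: divr_gt0.
    move=> u y uy _ de; apply: le_lt_trans (sol_small u y e uy e0 de).
    rewrite /S -[X in _ - X](shifts_pack y (0 : 'rV[R]_d)) (_ : _ - _ =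
      shifts (sol (param u y) - pack y 0)) ?shifts_le//.
    by apply/matrixP => j k; rewrite !mxE.
  - move=> e e0; exists 1, (e / (K + 1)); split=> //; first exact: divr_gt0.
    move=> u y uy _ de; apply: le_lt_trans (sol_small u y e uy e0 de).
    rewrite (_ : A u y = coefs (sol (param u y) - pack y 0)) ?coefs_le//.
    by apply/rowP => i; rewrite !mxE enum_rankK mxE subr0.
exists L, eps; split=> //; exists S, A; split=> // S' A' mod' u y uy.
pose g l := gram DU PHI l.
(* Where [g] vanishes the parameter is not determined by [u]. *)
pose mask (p : 'rV[R]_#|{: ('I_m * 'I_n + 'I_d)%type}|) := \row_l (if g l == 0 then 0 else p ord0 l).
have mask_le p : `|mask p| <= `|p|.
  apply: mx_norm_le => // i l; rewrite mxE; case: ifP => _; rewrite ?normr0//.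
  exact: coord_le_norm.
pose D v z := mask (pack (S' v z - S v z) (A' v z - A v z)).
(* [sol] is within [rho / 2] of the centre. A solution whose nondegenerate coordinates are within
   [rho / 2] of those of [sol] thus lies in the range where uniqueness holds. *)
have local v z : near v z -> `|D v z| < rho / 2 -> D v z = 0.
  move=> vz Dr; apply/rowP => l; rewrite /D mxE [RHS]mxE; case: ifPn => // gl.
  have [[sb _ _] uniq _ _ _] := solP _ (DomI _ _ vz).
  have pE : pack (z + S' v z) (A' v z) - sol (param v z) = pack (S' v z - S v z) (A' v z - A v z).
    by rewrite -solE -packB; congr pack; rewrite opprD addrACA subrr add0r.
  have vs : sobolev 1 v by case: vz.
  have crit := (decomposesP psi1 u1 phi1 DUE z (S' v z) (A' v z) vs).1.
  have close : forall l, g l != 0 ->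
      `|pack (z + S' v z) (A' v z) ord0 l - (param (d := d) v z).2 ord0 l| <= rho.
    move=> l' gl'; rewrite -(subrKA (sol (param v z) ord0 l')) (splitr rho).
    apply: le_trans (ler_normD _ _) _; apply: lerD.
      have -> : pack (z + S' v z) (A' v z) ord0 l' - sol (param v z) ord0 l' = D v z ord0 l'.
        rewrite [RHS]mxE (negbTE gl') -pE !mxE//.
      by apply/ltW; apply: le_lt_trans Dr; exact: coord_le_norm.
    apply: le_trans sb; have := coord_le_norm (sol (param v z) - (param (d := d) v z).2) ord0 l'.
    by rewrite !mxE.
  case: mod' => _ dec' _ _.
  by rewrite -pE mxE (uniq _ close (crit (dec' v z vz)) l gl) mxE subrr.
have path_near t : 1 <= t -> near (path_fun psi u_ u y t) (t *: y).
  by move=> t1; have [] := near_path psi1 u1 t1 (ltW L0) uy.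
have [[S'C A'C] _ S'0 A'0] := mod'; have [[SC AC] _ S0 A0] := SAmod.
(* [S'], [A'], [S] and [A] contribute less than [rho / 8] each, hence together less than the
   threshold [rho / 2] of [local]. *)
have r80 : 0 < rho / 8 by rewrite divr_gt0.
have [T T1 TP] : exists2 T, 1 <= T & `|D (path_fun psi u_ u y T) (T *: y)| < rho / 2.
  have far (W : normedModType R) (f : _ -> _ -> W) : tends_to0 psi u_ L eps f -> exists2 T, 1 <= T &
      forall t, T <= t -> `|f (path_fun psi u_ u y t) (t *: y)| < rho / 8.
    move=> /(_ _ r80)[M [eta [M0 eta0 fP]]].
    have [T T1 TP] := far_path psi1 u1 L0 (ltW M0) eta0 uy.
    exists T => // t Tt; have [t1 t2] := TP t Tt; apply: fP => //; apply: path_near.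
    exact: le_trans Tt.
  have [T1 T11 P1] := far _ _ S'0; have [T2 T21 P2] := far _ _ A'0.
  have [T3 T31 P3] := far _ _ S0; have [T4 T41 P4] := far _ _ A0.
  (* All four times are at least [1], so their sum exceeds each of them. *)
  exists (T1 + T2 + T3 + T4); first lra.
  have {}P1 := P1 (T1 + T2 + T3 + T4); have {}P2 := P2 (T1 + T2 + T3 + T4).
  have {}P3 := P3 (T1 + T2 + T3 + T4); have {}P4 := P4 (T1 + T2 + T3 + T4).
  move: P1 P2 P3 P4; rewrite /D; set v := path_fun _ _ _ _ _; set z := _ *: y.
  move=> /(_ ltac:(lra)) P1 /(_ ltac:(lra)) P2 /(_ ltac:(lra)) P3 /(_ ltac:(lra)) P4.
  apply: le_lt_trans (mask_le _) _; apply: le_lt_trans (pack_le2 _ _) _.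
  apply: le_lt_trans (lerD (ler_normB _ _) (ler_normB _ _)) _.
  by lra.
have D1 : `|D (path_fun psi u_ u y 1) (1 *: y)| = 0.
  apply: (@continuation R (fun t => `|D (path_fun psi u_ u y t) (t *: y)|) 1 T (rho / 2)) => //.
  - exact: divr_gt0.
  - move=> t t1 _ e e0; have e40 : 0 < e / 4 by rewrite divr_gt0.
    have [r1 r10 P1] := C1_on_continuous S'C (path_near t t1) e40.
    have [r2 r20 P2] := C1_on_continuous A'C (path_near t t1) e40.
    have [r3 r30 P3] := C1_on_continuous SC (path_near t t1) e40.
    have [r4 r40 P4] := C1_on_continuous AC (path_near t t1) e40.
    have su : sobolev 1 u by case: uy.
    have [|r r0 rP] := path_continuous psi1 u1 y su t1 (_ : 0 < Num.min (Num.min r1 r2) (Num.min r3 r4)).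
      by rewrite !lt_min r10 r20 r30.
    exists r => // t' t'1 _ tt'; have [s'] := rP t' t'1 tt'.
    rewrite !lt_min => /andP[/andP[h1 h2] /andP[h3 h4]].
    have {}P1 := P1 _ _ (path_near _ t'1) s' h1; have {}P2 := P2 _ _ (path_near _ t'1) s' h2.
    have {}P3 := P3 _ _ (path_near _ t'1) s' h3; have {}P4 := P4 _ _ (path_near _ t'1) s' h4.
    apply: le_trans (ler_dist_dist _ _) _.
    move: P1 P2 P3 P4; set v' := path_fun _ _ _ _ _; set v := path_fun _ _ _ _ _ => P1 P2 P3 P4.
    have -> : D v' (t' *: y) - D v (t *: y) = mask (pack
      ((S' v' (t' *: y) - S' v (t *: y)) - (S v' (t' *: y) - S v (t *: y)))
      ((A' v' (t' *: y) - A' v (t *: y)) - (A v' (t' *: y) - A v (t *: y)))).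
      apply/rowP => l; rewrite !mxE; case: ifP => _; first by rewrite subrr.
      by case: (enum_val l) => [jk|i]; rewrite !mxE; ring.
    apply: le_trans (mask_le _) _; apply: le_trans (pack_le2 _ _) _.
    apply: le_trans (lerD (ler_normB _ _) (ler_normB _ _)) _.
    by lra.
  - move=> t t1 _ Dt; rewrite local ?normr0//; exact: path_near.
have pu : path_fun psi u_ u y 1 = u.
  by rewrite /path_fun scale1r invr1 scale1r addrC subrK.
move: D1; rewrite pu scale1r => /normr0_eq0/rowP D1.
(* A continuous function that is nonzero somewhere has positive norm, so its parameters are not
   masked. *)
have null (f : 'rV[R]_n -> R) x : sobolev 1 f -> continuous f -> f x != 0 ->
    nrm (toL2 mu f) = 0 -> False.
  move=> f1 cf fx /nrm0_ae; rewrite toL2K ?sobolev1_L2// => /(continuous_ae0 cf)/(_ x) fx0.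
  by rewrite fx0 eqxx in fx.
split=> [j [x ux]|i [x px]].
  apply/rowP => k; rewrite !mxE.
  have := D1 (enum_rank (inl (j, k))); rewrite !mxE enum_rankK /g /gram enum_rankK /= !mxE.
  case: ifPn => [/eqP gjk _|_ /eqP]; last by rewrite subr_eq0 => /eqP.
  exfalso; apply: (null (u_ j) x) => //; first exact: cdiff_continuous (u_C1 j).
  exact: gram_null U_DU _ _ gjk.
have := D1 (enum_rank (inr i)); rewrite !mxE enum_rankK /g /gram enum_rankK /= !mxE.
case: ifPn => [/eqP gi _|_ /eqP]; last by rewrite subr_eq0 => /eqP.
exfalso; apply: (null (phi_ i) x) => //; first exact: cdiff_continuous (phi_C1 i).
by apply/eqP; rewrite -sqrf_eq0 nrm_sqr gi.
Qed.
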